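(* Let $R$ be an associative ring with identity such that the pure-injective envelope of every flat left $R$-module is flat, and let $\mathbf{K}^{\mathcal{F}}$ denote the class of flat left $R$-modules with pure embeddings. The following are equivalent. (1) $R$ is left perfect. (2) $\mathbf{K}^{\mathcal{F}}$ is superstable. (3) There is a cardinal $\lambda \geq (|R| + \aleph_0)^+$ such that $\mathbf{K}^{\mathcal{F}}$ has uniqueness of limit models of cardinality $\lambda$. (4) Every limit model in $\mathbf{K}^{\mathcal{F}}$ is $\Sigma$-pure-injective. (5) For every cardinal $\lambda \geq |R| + \aleph_0$, $\mathbf{K}^{\mathcal{F}}$ has uniqueness of limit models of cardinality $\lambda$.
   Context: $R$ is left perfect if every flat left $R$-module is projective. $\mathbf{K}^{\mathcal{F}} = (K_{flat}, \leq_{pp})$, where $K_{flat}$ is the class of flat left $R$-modules and $\leq_{pp}$ is the pure submodule relation. $\mathbf{K}^{\mathcal{F}}_{\lambda}$ is the class of flat left $R$-modules of cardinality $\lambda$, and $\mathbf{K}^{\mathcal F}_{\leq\lambda}$ those of cardinality at most $\lambda$. A pure embedding $f: M \to N$ is an isomorphism from $M$ onto a pure submodule of $N$. For $N \leq_{pp} M$ in $\mathbf{K}^{\mathcal{F}}$, $M$ is universal over $N$ if $|M| = |N|=\lambda$ (cardinalities) and for every $N^* \in \mathbf{K}^{\mathcal{F}}_{\leq \lambda}$ with $N \leq_{pp} N^*$ there is a pure embedding $f: N^* \to M$ fixing $N$ pointwise. Let $\lambda$ be an infinite cardinal and $\alpha < \lambda^+$ a limit ordinal. $M$ is a $(\lambda,\alpha)$-limit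 model if there is a $\leq_{pp}$-increasing continuous chain $\{M_i : i < \alpha\} \subseteq \mathbf{K}^{\mathcal{F}}_\lambda$ (continuous: unions at limit stages) such that $M_{i+1}$ is universal over $M_i$ for each $i<\alpha$, and $M = \bigcup_{i<\alpha} M_i$. $M$ is a $\lambda$-limit model if it is a $(\lambda, \alpha)$-limit model for some limit ordinal $\alpha < \lambda^+$; $M$ is a limit model if it is a $\lambda$-limit model for some infinite cardinal $\lambda$. The class has uniqueness of limit models of cardinality $\lambda$ if it has $\lambda$-limit models and any two $\lambda$-limit models are isomorphic. It is superstable if there is a cardinal $\mu$ such that it has uniqueness of limit models of cardinality $\lambda$ for every $\lambda \geq \mu$. A module $M$ is $\Sigma$-pure-injective if the direct sum $M^{(I)}$ is pure-injective for every index set $I$. *)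

(* Defs.v *)
From HB Require Import structures.
From mathcomp Require Import all_boot all_order all_algebra.
From mathcomp Require Import boolp classical_sets functions cardinality wochoice.

Set Implicit Arguments.
Unset Strict Implicit.
Unset Printing Implicit Defensive.

Import GRing.Theory.
Local Open Scope ring_scope.
Local Open Scope card_scope.
Local Open Scope classical_set_scope.

(* A cardinal is represented by any type of that cardinality; equality of     *)
(* cardinals is equipotence. The named constant keeps all cardinals, index    *)
(* sets, ordinals and (through [module_card] and [direct_sum]) carriers of    *)
(* modules in one and the same universe, which plays the role of the class of *)
(* all sets.                                                                  *)
Definition cardinal : Type := Type.

Definition cle (kappa lambda : cardinal) : Prop :=
  [set: kappa] #<= [set: lambda].
Definition ceq (kappa lambda : cardinal) : Prop :=
  [set: kappa] #= [set: lambda].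
Definition clt (kappa lambda : cardinal) : Prop :=
  cle kappa lambda /\ ~ cle lambda kappa.
Definition cinfinite (kappa : cardinal) : Prop := infinite_set [set: kappa].

Definition is_succ_cardinal (kappa kappa' : cardinal) : Prop :=
  clt kappa kappa' /\ forall mu : cardinal, clt kappa mu -> cle kappa' mu.

(* Ordinals are represented by well-ordered types (A, le), [le] being the     *)
(* reflexive order; the strict order [i < j] is [~~ le j i].                  *)
Definition is_next (A : Type) (le : rel A) (i j : A) : Prop :=
  minimum_of le [pred k | ~~ le k i] j.

Definition is_limit_point (A : Type) (le : rel A) (i : A) : Prop :=
  (exists j, ~~ le i j) /\ (forall j, ~ is_next le j i).

Definition is_limit_ordinal (A : Type) (le : rel A) : Prop :=
  [/\ well_order le, inhabited A & forall i, exists j, is_next le i j].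

(* The ordinal alpha is below lambda^+: as lambda^+ is an initial ordinal,    *)
(* this is a condition on the cardinality of alpha.                           *)
Definition below_succ_cardinal (A lambda : cardinal) : Prop :=
  exists lambda' : cardinal, is_succ_cardinal lambda lambda' /\ clt A lambda'.

Section Submodules.
Variables (R : nzRingType) (M : lmodType R).

Definition submodule_type (S : submodClosed M) := {x : M | x \in S}.

HB.instance Definition _ (S : submodClosed M) := SubType.on (submodule_type S).
HB.instance Definition _ (S : submodClosed M) :=
  [Choice of submodule_type S by <:].
HB.instance Definition _ (S : submodClosed M) :=
  [SubChoice_isSubLmodule of submodule_type S by <:].

Definition submodule_incl (S T : submodClosed M) (ST : {subset S <= T})
    (x : submodule_type S) : submodule_type T :=
  exist _ (val x) (ST _ (valP x)).

End Submodules.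

Section DirectSum.
Variables (R : nzRingType) (I : cardinal) (M : lmodType R).

Definition finite_support : {pred I -> M} :=
  fun f => `[< finite_set [set i | f i != 0] >].

Lemma finite_support_submod : submod_closed finite_support.
Proof.
split=> [|a f g /asboolP finf /asboolP fing]; apply/asboolP.
  by rewrite (_ : mkset _ = set0) // -subset0 => i /=; rewrite eqxx.
apply: (@sub_finite_set _ _ ([set i | f i != 0] `|` [set i | g i != 0])).
  move=> i /= fgi; have [fi0|] := eqVneq (f i) 0; last by left.
  right; apply: contra_neq fgi => gi0.
  by rewrite /GRing.add/= /GRing.scale/= fi0 gi0 scaler0 addr0.
by rewrite finite_setU.
Qed.

HB.instance Definition _ :=
  GRing.isSubmodClosed.Build R (I -> M) finite_support finite_support_submod.

(* M^(I): families with finite support, with pointwise operations *)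
Definition direct_sum : lmodType R := submodule_type finite_support.

End DirectSum.

Section Modules.
Variable R : nzRingType.
Implicit Types (M N : lmodType R).

Definition module_card M : cardinal := M.

Definition isomorphic M N : Prop := exists f : {linear M -> N}, bijective f.

(* Right R-modules are left modules over the converse ring R^c, with          *)
(* a . r := (r : R^c) *: a.                                                   *)
Definition balanced (A : lmodType R^c) M (G : zmodType)
    (beta : A -> M -> G) : Prop :=
  [/\ forall a, {morph beta a : m m' / m + m'},
      forall m, {morph beta^~ m : a a' / a + a'} &
      forall a (r : R) m, beta ((r : R^c) *: a) m = beta a (r *: m)].

(* tau exhibits the abelian group T as the tensor product of A and M over R *)
Definition is_tensor_product (A : lmodType R^c) M (T : zmodType)
    (tau : A -> M -> T) : Prop :=
  balanced tau /\
  forall (G : zmodType) (beta : A -> M -> G), balanced beta ->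
    exists2 g : {additive T -> G}, (forall a m, g (tau a m) = beta a m) &
      forall g' : {additive T -> G},
        (forall a m, g' (tau a m) = beta a m) -> g' =1 g.

Definition flat M : Prop :=
  forall (A B : lmodType R^c) (f : {linear A -> B}), injective f ->
  forall (TA TB : zmodType) (tauA : A -> M -> TA) (tauB : B -> M -> TB),
    is_tensor_product tauA -> is_tensor_product tauB ->
  forall fM : {additive TA -> TB},
    (forall a m, fM (tauA a m) = tauB (f a) m) -> injective fM.

Definition projective M : Prop :=
  forall (A B : lmodType R) (p : {linear A -> B}) (g : {linear M -> B}),
    (forall b, exists a, p a = b) ->
    exists h : {linear M -> A}, forall m, p (h m) = g m.

Definition left_perfect : Prop := forall M, flat M -> projective M.

(* M satisfies the positive primitive formula "exists y, D y + E x = 0" at x *)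
Definition pp_holds M (m n k : nat) (D : 'M[R]_(m, n)) (E : 'M[R]_(m, k))
    (x : 'I_k -> M) : Prop :=
  exists y : 'I_n -> M, forall i,
    \sum_(j < n) D i j *: y j + \sum_(l < k) E i l *: x l = 0.

Definition pure_embedding M N (f : M -> N) : Prop :=
  [/\ linear f, injective f &
      forall (m n k : nat) (D : 'M[R]_(m, n)) (E : 'M[R]_(m, k))
             (x : 'I_k -> M),
        pp_holds D E x <-> pp_holds D E (f \o x)].

Definition pure_injective M : Prop :=
  forall (A B : lmodType R) (f : A -> B) (g : {linear A -> M}),
    pure_embedding f ->
    exists h : {linear B -> M}, forall a, h (f a) = g a.

Definition sigma_pure_injective M : Prop :=
  forall I : cardinal, pure_injective (direct_sum I M).

(* e : M -> E is the pure-injective envelope of M: E is pure-injective, and   *)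
(* minimum over M among the pure-injective modules containing M purely.       *)
Definition is_pure_injective_envelope M (E : lmodType R) (e : M -> E) : Prop :=
  [/\ pure_injective E, pure_embedding e &
      forall (N : lmodType R) (g : M -> N),
        pure_injective N -> pure_embedding g ->
        exists2 f : E -> N, pure_embedding f & forall x, f (e x) = g x].

(* Meant for a pure embedding iota : N -> M of flat modules, which stands for *)
(* the inclusion of N in M.                                                   *)
Definition universal_over N M (iota : N -> M) : Prop :=
  ceq (module_card M) (module_card N) /\
  forall (N' : lmodType R) (e : N -> N'),
    flat N' -> cle (module_card N') (module_card N) -> pure_embedding e ->
    exists2 f : N' -> M, pure_embedding f & forall x, f (e x) = iota x.

Definition is_limit_model_chain (lambda : cardinal) M (A : cardinal)
    (le : rel A) (X : A -> submodClosed M) : Prop :=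
  [/\ forall i, flat (submodule_type (X i)) /\
                ceq (module_card (submodule_type (X i))) lambda,
      forall i j, le i j ->
        exists Xij : {subset X i <= X j}, pure_embedding (submodule_incl Xij),
      forall i, is_limit_point le i ->
        forall x, x \in X i -> exists j, ~~ le i j /\ x \in X j,
      forall i j, is_next le i j ->
        exists Xij : {subset X i <= X j}, universal_over (submodule_incl Xij) &
      forall x : M, exists i, x \in X i].

Definition is_lambda_limit_model (lambda : cardinal) M : Prop :=
  cinfinite lambda /\
  exists (A : cardinal) (le : rel A) (X : A -> submodClosed M),
    [/\ is_limit_ordinal le, below_succ_cardinal A lambda &
        is_limit_model_chain lambda le X].

Definition is_limit_model M : Prop :=
  exists lambda : cardinal, is_lambda_limit_model lambda M.

Definition uniqueness_of_limit_models (lambda : cardinal) : Prop :=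
  (exists M, is_lambda_limit_model lambda M) /\
  (forall M N, is_lambda_limit_model lambda M ->
     is_lambda_limit_model lambda N -> isomorphic M N).

Definition flat_superstable : Prop :=
  exists mu : cardinal, forall lambda : cardinal,
    cle mu lambda -> uniqueness_of_limit_models lambda.

(* |R| + aleph_0 *)
Definition ring_card : cardinal := (R + nat)%type.

End Modules.

(* Main.v *)
From HB Require Import structures.
From Stdlib Require List.
Require Import Defs.
From mathcomp Require Import all_boot all_order all_algebra.
From mathcomp Require Import boolp classical_sets functions cardinality wochoice.

(** Write mu for |R| + aleph_0. All five conditions turn out to be equivalent to
    the single property [flats_pure_injective]: every flat module is pure injective.

    Perfect rings. If R is left perfect and M is flat, then the pure-injective
    envelope E of M is flat by hypothesis, E / M is flat because M is pure in E,
    so E / M is projective and M is a direct summand of E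
    ([perfect_pure_injective]). Conversely, the kernel of a free cover of a flat
    module is pure, hence flat, hence pure injective, so that the cover splits
    ([pure_injective_perfect]). Here flatness is used through the equational
    criterion ([flatP]) and purity through the solvability of linear systems.

    From pure injectivity to uniqueness. For lambda >= mu, the direct sum of
    countably many copies of the free module of rank lambda is a lambda-limit model
    along the chain of its finite partial sums: an extension of such a partial sum
    splits, and the complement embeds into the next copy ([omega_limit_model]).
    Every lambda-limit model contains the free module of rank lambda as a pure
    submodule, which splits off with a projective complement of size at most
    lambda; by Eilenberg's swindle the complement is absorbed ([limit_model_free]).
    So all lambda-limit models are free of rank lambda. All limit models are
    moreover Sigma-pure-injective, since direct sums of flat modules are flat.

    Back to pure injectivity. If the direct sum of countably many copies of M is
    pure injective, then the subgroups of M defined by positive primitive formulas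
    satisfy the descending chain condition ([sum_pure_injective_dcc]). A failure
    of this condition is witnessed in a pure submodule of size at most mu. Hence
    it cannot occur in any flat module as soon as M contains every flat module of
    size at most mu purely, and modules with the chain condition are pure
    injective ([dcc_flats_pure_injective]). It remains to produce such an M, for
    which two constructions serve.

    Suppose that uniqueness holds at some lambda >= mu^+. A tower of universal
    extensions of length mu^+ is built inside a flat pure-injective module U.
    A system of positive primitive formulas in one unknown has at most mu
    parameters, all of which occur at one stage of the tower, and a solution of
    it in U can be copied into the next stage, so the union N is pure injective
    ([long_limit_model]). Then N and the sum of countably many copies of N are
    both limit models, hence isomorphic, and the sum is pure injective
    ([uniqueness_flats_pure_injective]).

    Suppose that all limit models are Sigma-pure-injective. For lambda = 2^mu the
    closure in U of a sum of small flat modules under solutions of systems is a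
    pure-injective module W of size lambda. Every flat module of size at most
    lambda embeds purely into W, by induction along a filtration whose successive
    factors have size at most mu ([filtration_embedding]), so that the sum of
    countably many copies of W is a limit model
    ([sigma_flats_pure_injective]).

    The flat pure-injective module U is in both cases the envelope of a direct sum
    of more than lambda (respectively exactly lambda) copies of a flat module Z.
    The large number of copies is what makes embeddings over a given submodule
    possible: an extension of the given map is corrected by a map into one of the
    copies, and each linear system excludes at most one copy
    ([pure_embed_over]). The existence of pure-injective envelopes is derived
    from the second character module and limits of endomorphisms
    ([envelope_exists]). *)

Set Implicit Arguments.
Unset Strict Implicit.
Unset Printing Implicit Defensive.
Import Order.TTheory GRing.Theory Num.Theory.
Local Open Scope ring_scope.
Local Open Scope classical_set_scope.
Local Open Scope card_scope.


(** * Chains of sets *)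

(** Zorn's lemma, in the form that extends partial maps. *)
Lemma maximal_extension (T : Type) (K : set (set T)) (G0 : set T) :
  K G0 ->
  (forall F : set (set T), F `<=` K -> total_on F subset -> F !=set0 ->
     K (\bigcup_(X in F) X)) ->
  exists G, [/\ K G, G0 `<=` G & forall G', K G' -> G `<=` G' -> G' = G].
Proof.
move=> K0 Kcup.
pose P : set (set T) := [set A | K (G0 `|` A)].
have [F FP totF|A [PA maxA]] := @Zorn_bigcup T P.
  have [->|/set0P[A0 FA0]] := eqVneq F set0.
    by rewrite /P /= bigcup_set0 setU0.
  rewrite /P /=.
  have -> : G0 `|` \bigcup_(X in F) X =
            \bigcup_(X in [set G0 `|` Y | Y in F]) X.
    rewrite predeqE => x; split.
      case=> [G0x|[X FX Xx]]; first by exists (G0 `|` A0); [exists A0|left].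
      by exists (G0 `|` X); [exists X|right].
    move=> [_ [Y FY <-]] [G0x|Yx]; [by left|by right; exists Y].
  apply: Kcup => [_ [Y FY <-]|_ _ [Y FY <-] [Z FZ <-]|].
  - exact: FP.
  - by have [YZ|ZY] := totF _ _ FY FZ; [left|right]; apply: setUS.
  - by exists (G0 `|` A0); exists A0.
exists (G0 `|` A); split=> // G' KG' sub.
have G0G' : G0 `|` G' = G' by rewrite setUidPr => // x G0x; apply: sub; left.
apply/seteqP; split=> // x G'x; apply: contrapT => nx.
apply: (maxA G'); last by rewrite /P /= G0G'.
split=> [y Ay|sub']; first by apply: sub; right.
by apply: nx; right; apply: sub'.
Qed.

Lemma chain_tuple (T : Type) (F : set (set T)) n (p : 'I_n -> T) :
  total_on F subset -> F !=set0 -> (forall i, (\bigcup_(X in F) X) (p i)) ->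
  exists2 X, F X & forall i, X (p i).
Proof.
move=> totF [X0 FX0]; elim: n p => [|n IH] p pF; first by exists X0 => // -[].
have [X FX Xp] := IH (fun i => p (lift ord0 i)) (fun i => pF _).
have [Y FY Yp] := pF ord0.
have [XY|YX] := totF _ _ FX FY.
  exists Y => // i; case: (unliftP ord0 i) => [j ->|->//].
  exact/XY/Xp.
exists X => // i; case: (unliftP ord0 i) => [j ->|->]; first exact: Xp.
exact: YX.
Qed.

Lemma chain_pair (T : Type) (F : set (set T)) x y :
  total_on F subset -> (\bigcup_(X in F) X) x -> (\bigcup_(X in F) X) y ->
  exists2 X, F X & X x /\ X y.
Proof.
move=> totF [X FX Xx] [Y FY Yy]; have [XY|YX] := totF _ _ FX FY.
  by exists Y => //; split=> //; apply: XY.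
by exists X => //; split=> //; apply: YX.
Qed.

(** * Submodules and quotients *)

Definition is_subgroup (V : zmodType) (S : set V) : Prop :=
  S 0 /\ forall x y, S x -> S y -> S (x - y).

Definition is_submod (R : nzRingType) (M : lmodType R) (S : set M) : Prop :=
  S 0 /\ forall a x y, S x -> S y -> S (a *: x + y).

Section SubgroupFacts.
Variables (V : zmodType) (S : set V) (subS : is_subgroup S).

Lemma subgroup0 : S 0. Proof. by case: subS. Qed.
Lemma subgroupB x y : S x -> S y -> S (x - y).
Proof. by case: subS => _; apply. Qed.
Lemma subgroupN x : S x -> S (- x).
Proof. by move=> Sx; rewrite -sub0r; apply: subgroupB => //; apply: subgroup0. Qed.
Lemma subgroupD x y : S x -> S y -> S (x + y).
Proof. by move=> Sx Sy; rewrite -[y]opprK; apply: subgroupB => //; apply: subgroupN. Qed.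
End SubgroupFacts.

Section SubmodFacts.
Variables (R : nzRingType) (M : lmodType R) (S : set M) (subS : is_submod S).

Lemma submod_subgroup : is_subgroup S.
Proof.
case: subS => S0 SP; split=> // x y Sx Sy.
by rewrite addrC -scaleN1r; apply: SP.
Qed.
Lemma submodZ a x : S x -> S (a *: x).
Proof. by case: subS => S0 SP Sx; rewrite -[_ *: _]addr0; apply: SP. Qed.
Lemma submod0 : S 0. Proof. exact: subgroup0 submod_subgroup. Qed.
Lemma submodD x y : S x -> S y -> S (x + y).
Proof. exact: subgroupD submod_subgroup _ _. Qed.
Lemma submodB x y : S x -> S y -> S (x - y).
Proof. exact: subgroupB submod_subgroup _ _. Qed.

End SubmodFacts.

Lemma submod_bigcup (R : nzRingType) (M : lmodType R) (F : set (set M)) :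
  (forall X, F X -> is_submod X) -> total_on F subset -> F !=set0 ->
  is_submod (\bigcup_(X in F) X).
Proof.
move=> subF totF [X0 FX0]; split; first by exists X0 => //; exact: submod0 (subF _ FX0).
move=> a x y Ux Uy; have [X FX [Xx Xy]] := chain_pair totF Ux Uy.
by exists X => //; have [_ SX] := subF _ FX; apply: SX.
Qed.

Lemma range_submod (R : nzRingType) (M N : lmodType R) (f : {linear M -> N}) :
  is_submod (range f).
Proof.
split; first by exists 0; rewrite ?raddf0.
by move=> a _ _ [x _ <-] [y _ <-]; exists (a *: x + y); rewrite ?linearP.
Qed.

Lemma kernel_submod (R : nzRingType) (M N : lmodType R) (f : {linear M -> N}) :
  is_submod [set x | f x = 0].
Proof.
split; first by rewrite /= raddf0.
by move=> a x y /= fx fy; rewrite linearP fx fy scaler0 addr0.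
Qed.

Section CosetRep.
Variables (V : zmodType) (S : set V) (subS : is_subgroup S).

(** The choice operator depends on the extent of the coset only, so congruent elements
    have the same representative; the quotient is the subtype of representatives. *)
Definition coset_rep (x : V) : V := choose (fun y => `[< S (y - x) >]) x.

Lemma coset_repP x : S (coset_rep x - x).
Proof.
have /asboolP// : `[< S (coset_rep x - x) >].
by apply: (@chooseP _ (fun y => `[< S (y - x) >])); apply/asboolP; rewrite subrr; apply: subgroup0.
Qed.

Lemma coset_rep_eq x y : S (x - y) -> coset_rep x = coset_rep y.
Proof.
move=> Sxy; rewrite /coset_rep.
have E : (fun z => `[< S (z - x) >]) =1 (fun z => `[< S (z - y) >]).
  move=> z; apply/asboolP/asboolP => Sz.
    by rewrite -[z](subrK x) -addrA; apply: subgroupD.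
  rewrite (_ : z - x = (z - y) - (x - y)); first exact: subgroupB.
  by rewrite opprB addrA subrK.
rewrite (eq_choose E); apply: choose_id; apply/asboolP => //.
by rewrite subrr; apply: subgroup0.
Qed.

Lemma coset_rep_id x : coset_rep (coset_rep x) = coset_rep x.
Proof. exact/coset_rep_eq/coset_repP. Qed.

Lemma coset_rep0 x : (coset_rep x = coset_rep 0) <-> S x.
Proof.
split=> [E|Sx]; last by apply: coset_rep_eq; rewrite subr0.
rewrite (_ : x = (coset_rep 0 - 0) - (coset_rep 0 - x)); last first.
  by rewrite subr0 opprB addrC subrK.
by apply: subgroupB => //; [|rewrite -E]; apply: coset_repP.
Qed.

End CosetRep.

Section Quotient.
Variables (V : zmodType) (S : set V) (subS : is_subgroup S).

Definition quotient_type (_ : is_subgroup S) : Type :=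
  {x : V | coset_rep S x == x}.

Local Notation Q := (quotient_type subS).
HB.instance Definition _ := SubType.on Q.
HB.instance Definition _ := [Choice of Q by <:].

Definition quotient_pi (x : V) : Q := exist _ (coset_rep S x) (introT eqP (coset_rep_id subS x)).

Lemma quotient_pi_eq x y : S (x - y) -> quotient_pi x = quotient_pi y.
Proof. by move=> Sxy; apply/val_inj/(coset_rep_eq subS). Qed.

Lemma quotient_val (u : Q) : quotient_pi (val u) = u.
Proof. by apply/val_inj/eqP; case: u. Qed.

Definition quotient_add (u v : Q) := quotient_pi (val u + val v).
Definition quotient_opp (u : Q) := quotient_pi (- val u).

Lemma quotient_addE x y : quotient_add (quotient_pi x) (quotient_pi y) = quotient_pi (x + y).
Proof.
apply: quotient_pi_eq; rewrite /= opprD addrACA.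
by apply: subgroupD => //; apply: coset_repP.
Qed.

Lemma quotient_oppE x : quotient_opp (quotient_pi x) = quotient_pi (- x).
Proof.
by apply: quotient_pi_eq; rewrite /= -opprD; apply: subgroupN => //; apply: coset_repP.
Qed.

Fact quotient_addA : associative quotient_add.
Proof.
move=> u v w; rewrite -(quotient_val u) -(quotient_val v) -(quotient_val w).
by rewrite !quotient_addE addrA.
Qed.
Fact quotient_addC : commutative quotient_add.
Proof. by move=> u v; rewrite /quotient_add addrC. Qed.
Fact quotient_add0 : left_id (quotient_pi 0) quotient_add.
Proof. by move=> u; rewrite -(quotient_val u) quotient_addE add0r. Qed.
Fact quotient_addN : left_inverse (quotient_pi 0) quotient_opp quotient_add.
Proof. by move=> u; rewrite -(quotient_val u) quotient_oppE quotient_addE addNr. Qed.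

HB.instance Definition _ :=
  GRing.isZmodule.Build Q quotient_addA quotient_addC quotient_add0 quotient_addN.

Fact quotient_pi_additive : zmod_morphism quotient_pi.
Proof.
by move=> x y; rewrite -[quotient_pi (x - y)]quotient_addE -[quotient_pi (- y)]quotient_oppE.
Qed.
HB.instance Definition _ := GRing.isZmodMorphism.Build V Q quotient_pi quotient_pi_additive.

Lemma quotient_pi0 x : quotient_pi x = 0 <-> S x.
Proof.
split=> [/(congr1 val)/(coset_rep0 subS)//|Sx].
exact/val_inj/(coset_rep0 subS).
Qed.

End Quotient.

Lemma quotient_group (V : zmodType) (S : set V) : is_subgroup S ->
  exists (Q : zmodType) (pi : {additive V -> Q}),
    (forall q, exists x, pi x = q) /\ (forall x, pi x = 0 <-> S x).
Proof.
move=> subS; exists (quotient_type subS), (quotient_pi subS).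
by split=> [q|x]; [exists (val q); apply: quotient_val|apply: quotient_pi0].
Qed.

Section QuotientModule.
Variables (R : nzRingType) (M : lmodType R) (S : set M) (subS : is_submod S).

Definition quotient_module_type : Type :=
  quotient_type (submod_subgroup subS).
Local Notation Q := quotient_module_type.
HB.instance Definition _ := GRing.Zmodule.on Q.

Definition quotient_mpi : M -> Q := quotient_pi (submod_subgroup subS).
Definition quotient_scale (a : R) (u : Q) : Q := quotient_mpi (a *: val u).

Lemma quotient_scaleE a x : quotient_scale a (quotient_mpi x) = quotient_mpi (a *: x).
Proof.
apply: quotient_pi_eq; rewrite /= -scalerBr; apply: submodZ => //.
exact: (coset_repP (submod_subgroup subS)).
Qed.

Fact quotient_mpiD x y : quotient_mpi x + quotient_mpi y = quotient_mpi (x + y).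
Proof. exact: quotient_addE. Qed.
Lemma quotient_mval (u : Q) : quotient_mpi (val u) = u.
Proof. exact: quotient_val. Qed.

Fact quotient_scaleA a b (v : Q) : quotient_scale a (quotient_scale b v) = quotient_scale (a * b) v.
Proof. by rewrite -(quotient_mval v) !quotient_scaleE scalerA. Qed.
Fact quotient_scale1 : left_id 1 quotient_scale.
Proof. by move=> v; rewrite -(quotient_mval v) quotient_scaleE scale1r. Qed.
Fact quotient_scaleDr : right_distributive quotient_scale +%R.
Proof.
move=> a u v; rewrite -(quotient_mval u) -(quotient_mval v).
by rewrite !(quotient_mpiD, quotient_scaleE) scalerDr.
Qed.
Fact quotient_scaleDl v : {morph quotient_scale^~ v : a b / a + b}.
Proof.
move=> a b; rewrite -(quotient_mval v).
by rewrite !(quotient_mpiD, quotient_scaleE) scalerDl.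
Qed.
HB.instance Definition _ := GRing.Zmodule_isLmodule.Build R Q
  quotient_scaleA quotient_scale1 quotient_scaleDr quotient_scaleDl.

Fact quotient_mpi_linear : linear quotient_mpi.
Proof.
by move=> a x y; rewrite -quotient_mpiD; congr (_ + _); rewrite -quotient_scaleE.
Qed.
HB.instance Definition _ := GRing.isLinear.Build R M Q _ quotient_mpi quotient_mpi_linear.

End QuotientModule.

Lemma quotient_module (R : nzRingType) (M : lmodType R) (S : set M) : is_submod S ->
  exists (Q : lmodType R) (pi : {linear M -> Q}),
    (forall q, exists x, pi x = q) /\ (forall x, pi x = 0 <-> S x).
Proof.
move=> subS; exists (quotient_module_type subS), (quotient_mpi subS).
by split=> [q|x]; [exists (val q); apply: quotient_mval|apply: quotient_pi0].
Qed.

Definition set_pred (M : Type) (S : set M) : {pred M} := fun x => `[< S x >].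

Lemma set_pred_closed (R : nzRingType) (M : lmodType R) (S : set M) :
  is_submod S -> submod_closed (set_pred S).
Proof.
case=> S0 SP; split=> [|a x y /asboolP Sx /asboolP Sy]; first exact/asboolP.
exact/asboolP/SP.
Qed.

Lemma submod_of_set (R : nzRingType) (M : lmodType R) (S : set M) :
  is_submod S -> exists T : submodClosed M, forall x, (x \in T) <-> S x.
Proof.
move=> /set_pred_closed clS.
pose T : submodClosed M := HB.pack (set_pred S) (GRing.isSubmodClosed.Build R M (set_pred S) clS).
by exists T => x; split=> [/asboolP|Sx] //; apply/asboolP.
Qed.

Definition linear_pack (R : nzRingType) (M N : lmodType R) (f : M -> N) (lf : linear f) :
  {linear M -> N} := HB.pack f (GRing.isLinear.Build R M N _ f lf).

Definition additive_pack (M N : zmodType) (f : M -> N) (lf : zmod_morphism f) :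
  {additive M -> N} := HB.pack f (GRing.isZmodMorphism.Build M N f lf).

Lemma submod_of_set_incl (R : nzRingType) (M : lmodType R) (S : set M) :
  is_submod S -> exists (N : lmodType R) (i : {linear N -> M}),
     injective i /\ forall x, S x <-> exists n, i n = x.
Proof.
move=> /submod_of_set[T TS].
have lin : linear (fun u : submodule_type T => val u) by [].
exists (submodule_type T), (linear_pack lin); split; first exact: val_inj.
move=> x; rewrite -TS; split=> [xT|[n <-]]; last exact: valP.
by exists (exist _ x xT).
Qed.

Section LinearMaps.
Variable R : nzRingType.
Implicit Types M N Y : lmodType R.

Lemma linear_factor M N Y (i : {linear N -> M}) (t : {linear Y -> M}) :
  injective i -> (forall y, exists x, i x = t y) ->
  exists t' : {linear Y -> N}, forall y, i (t' y) = t y.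
Proof.
move=> inji /choice[f fP].
have lf : linear f by move=> a x y; apply: inji; rewrite (linearP i) !fP linearP.
by exists (linear_pack lf).
Qed.

Fact fst_linear M N : linear (fst : (M * N)%type -> M). Proof. by []. Qed.
Fact snd_linear M N : linear (snd : (M * N)%type -> N). Proof. by []. Qed.
Fact inl_linear M N : linear (fun x => (x, 0) : (M * N)%type).
Proof. by move=> a x y; rewrite -[RHS]/(a *: x + y, a *: 0 + 0) scaler0 addr0. Qed.
Fact inr_linear M N : linear (fun y => (0, y) : (M * N)%type).
Proof. by move=> a x y; rewrite -[RHS]/(a *: 0 + 0, a *: x + y) scaler0 addr0. Qed.

Definition linear_fst M N := linear_pack (@fst_linear M N).
Definition linear_snd M N := linear_pack (@snd_linear M N).
Definition linear_inl M N := linear_pack (@inl_linear M N).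
Definition linear_inr M N := linear_pack (@inr_linear M N).

Fact pair_linear M N Y (f : {linear Y -> M}) (g : {linear Y -> N}) :
  linear (fun y => (f y, g y)).
Proof. by move=> a x y; rewrite -[RHS]/(a *: f x + f y, a *: g x + g y) !linearP. Qed.
Definition linear_pair M N Y f g := linear_pack (@pair_linear M N Y f g).

End LinearMaps.


(** * Linear systems and purity *)

Definition tuple_cat (T : Type) m n (p : 'I_m -> T) (q : 'I_n -> T) : 'I_(m + n) -> T :=
  fun i => match fintype.split i with inl a => p a | inr b => q b end.

Lemma tuple_catl (T : Type) m n (p : 'I_m -> T) (q : 'I_n -> T) i :
  tuple_cat p q (lshift n i) = p i.
Proof.
rewrite /tuple_cat; case: split_ordP => [j /lshift_inj->//|j /eqP].
by rewrite eq_lrshift.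
Qed.

Lemma tuple_catr (T : Type) m n (p : 'I_m -> T) (q : 'I_n -> T) i :
  tuple_cat p q (rshift m i) = q i.
Proof.
rewrite /tuple_cat; case: split_ordP => [j /eqP|j /rshift_inj->//].
by rewrite eq_rlshift.
Qed.

Section Systems.
Variable R : nzRingType.

Definition mxact (M : lmodType R) m n (D : 'M[R]_(m, n)) (y : 'I_n -> M) : 'I_m -> M :=
  fun i => \sum_(j < n) D i j *: y j.

Definition solvable (M : lmodType R) m n (D : 'M[R]_(m, n)) (p : 'I_m -> M) : Prop :=
  exists y, mxact D y = p.

(** Systems D y = p with arbitrary right-hand sides are the positive primitive
    formulas up to notation: the formula D y + E x = 0 is the system with p = - E x,
    and E = -1 gives back all p. Preservation of solvability is automatic for a
    linear map, so only its reflection is asked. *)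
Definition pure (M N : lmodType R) (f : M -> N) : Prop :=
  forall m n (D : 'M[R]_(m, n)) (p : 'I_m -> M), solvable D (f \o p) -> solvable D p.

Section Act.
Variables (M : lmodType R) (m n : nat) (D : 'M[R]_(m, n)).
Implicit Types (y z : 'I_n -> M).

Lemma mxactD y z : mxact D (y + z) = mxact D y + mxact D z.
Proof.
apply/funext => i; rewrite /mxact /= -[RHS]big_split /=.
by apply: eq_bigr => j _; rewrite -scalerDr.
Qed.

Lemma mxact0 : mxact D (0 : 'I_n -> M) = 0.
Proof. by apply/funext => i; rewrite /mxact /= big1 // => j _; rewrite scaler0. Qed.

Lemma mxactN y : mxact D (- y) = - mxact D y.
Proof.
apply/funext => i; rewrite /mxact [RHS]/GRing.opp /= -sumrN.
by apply: eq_bigr => j _; rewrite -scalerN.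
Qed.

Lemma mxactB y z : mxact D (y - z) = mxact D y - mxact D z.
Proof. by rewrite mxactD mxactN. Qed.

Lemma mxact_lin (N : lmodType R) (f : {linear M -> N}) y :
  mxact D (f \o y) = f \o mxact D y.
Proof.
by apply/funext => i; rewrite /mxact /= linear_sum; apply: eq_bigr => j _; rewrite linearZ.
Qed.
End Act.

Section ActM.
Variable M : lmodType R.

Lemma mxactM m n k (D : 'M[R]_(m, n)) (E : 'M[R]_(n, k)) (y : 'I_k -> M) :
  mxact (D *m E) y = mxact D (mxact E y).
Proof.
apply/funext => i; rewrite /mxact.
under [RHS]eq_bigr do rewrite scaler_sumr.
rewrite exchange_big /=; apply: eq_bigr => j _.
by rewrite mxE scaler_suml; apply: eq_bigr => l _; rewrite scalerA.
Qed.

Lemma mxact1 m (y : 'I_m -> M) : mxact 1%:M y = y.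
Proof.
apply/funext => i; rewrite /mxact (bigD1 i) //= mxE eqxx scale1r big1 ?addr0 // => j ji.
by rewrite mxE eq_sym (negbTE ji) scale0r.
Qed.

Lemma mxact0l m n (y : 'I_n -> M) : mxact (0 : 'M_(m, n)) y = 0.
Proof. by apply/funext => i; rewrite /mxact big1 // => j _; rewrite mxE scale0r. Qed.

Lemma mxactNl m n (D : 'M_(m, n)) (y : 'I_n -> M) : mxact (- D) y = - mxact D y.
Proof.
apply/funext => i; rewrite /mxact [RHS]/GRing.opp /= -sumrN.
by apply: eq_bigr => j _; rewrite mxE scaleNr.
Qed.

Lemma mxact_row m n1 n2 (A : 'M_(m, n1)) (B : 'M_(m, n2)) (y : 'I_n1 -> M) (z : 'I_n2 -> M) :
  mxact (row_mx A B) (tuple_cat y z) = mxact A y + mxact B z.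
Proof.
apply/funext => i; rewrite /mxact big_split_ord /=.
by congr (_ + _); apply: eq_bigr => j _; rewrite ?row_mxEl ?row_mxEr ?tuple_catl ?tuple_catr.
Qed.

Lemma mxact_col m1 m2 n (A : 'M_(m1, n)) (B : 'M_(m2, n)) (y : 'I_n -> M) :
  mxact (col_mx A B) y = tuple_cat (mxact A y) (mxact B y).
Proof.
apply/funext => i; rewrite /mxact /tuple_cat; case: split_ordP => j ->;
by apply: eq_bigr => k _; rewrite ?col_mxEu ?col_mxEd.
Qed.

Lemma tuple_catK m n (y : 'I_(m + n) -> M) :
  tuple_cat (y \o lshift n) (y \o @rshift m n) = y.
Proof. by apply/funext => i; rewrite /tuple_cat; case: split_ordP => j ->. Qed.

End ActM.

Section Solvable.
Variables (M : lmodType R) (m n : nat) (D : 'M[R]_(m, n)).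

Lemma solvable0 : solvable D (0 : 'I_m -> M).
Proof. by exists 0; rewrite mxact0. Qed.
Lemma solvableD (p q : 'I_m -> M) : solvable D p -> solvable D q -> solvable D (p + q).
Proof. by move=> [y <-] [z <-]; exists (y + z); rewrite mxactD. Qed.
Lemma solvableN (p : 'I_m -> M) : solvable D p -> solvable D (- p).
Proof. by move=> [y <-]; exists (- y); rewrite mxactN. Qed.
Lemma solvableB (p q : 'I_m -> M) : solvable D p -> solvable D q -> solvable D (p - q).
Proof. by move=> Sp Sq; apply: solvableD => //; apply: solvableN. Qed.
Lemma solvable_lin (N : lmodType R) (f : {linear M -> N}) (p : 'I_m -> M) :
  solvable D p -> solvable D (f \o p).
Proof. by move=> [y <-]; exists (f \o y); rewrite mxact_lin. Qed.
End Solvable.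

Lemma pp_solvable (M : lmodType R) m n k (D : 'M[R]_(m, n)) (E : 'M[R]_(m, k)) (x : 'I_k -> M) :
  pp_holds D E x <-> solvable D (- mxact E x).
Proof.
split=> [[y Hy]|[y Hy]]; exists y.
  by apply/funext => i; apply/eqP; rewrite -addr_eq0; apply/eqP; apply: Hy.
move=> i; have := congr1 (fun g => g i) Hy; rewrite /mxact => ->.
by rewrite [(- _) i]/GRing.opp /= addNr.
Qed.

Lemma pure_inj (M N : lmodType R) (f : {linear M -> N}) : pure f -> injective f.
Proof.
move=> pf x y fxy.
(* the system 0 = x - y, without unknowns *)
have [z /(congr1 (fun g => g ord0))] : solvable (0 : 'M_(1, 0)) (fun _ => x - y).
  apply: pf; exists 0; rewrite mxact0; apply/funext => i /=.
  by rewrite linearB /= fxy subrr.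
by rewrite /mxact big_ord0 => /esym/eqP; rewrite subr_eq0 => /eqP.
Qed.

Lemma pure_embedding_pack (M N : lmodType R) (f : {linear M -> N}) :
  pure f -> pure_embedding f.
Proof.
move=> pf; split; [exact: linearP|exact: pure_inj|].
move=> m n k D E x; rewrite !pp_solvable mxact_lin.
have -> : - (f \o mxact E x) = f \o (- mxact E x) by apply/funext => i /=; rewrite linearN.
by split=> [/(solvable_lin f)|/pf].
Qed.

Lemma pure_embeddingP (M N : lmodType R) (f : M -> N) :
  pure_embedding f -> exists2 g : {linear M -> N}, g = f :> (M -> N) & pure g.
Proof.
move=> [lf _ pf]; exists (linear_pack lf) => // m n D p sp.
have := pf m n m D (- 1%:M) p; rewrite !pp_solvable !mxactNl !mxact1 !opprK => pfp.
exact/pfp.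
Qed.

Lemma pure_comp (M N P : lmodType R) (f : M -> N) (g : N -> P) :
  pure f -> pure g -> pure (g \o f).
Proof. by move=> pf pg m n D p sp; apply/pf/pg. Qed.

Lemma pure_compl (M N P : lmodType R) (f : M -> N) (g : {linear N -> P}) :
  pure (g \o f) -> pure f.
Proof. by move=> pgf m n D p /(solvable_lin g) /pgf. Qed.

Lemma pure_factor (M N Y : lmodType R) (i : {linear N -> M}) (t : {linear Y -> M}) :
  injective i -> pure t -> (forall y, exists x, i x = t y) ->
  exists2 t' : {linear Y -> N}, pure t' & forall y, i (t' y) = t y.
Proof.
move=> inji pt /(linear_factor inji)[t' t'P]; exists t' => //.
apply: (@pure_compl _ _ _ _ i); rewrite (_ : i \o t' = t) //; exact/funext.
Qed.

Lemma pure_retract (M N : lmodType R) (f : M -> N) (r : {linear N -> M}) :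
  cancel f r -> pure f.
Proof.
move=> rf m n D p /(solvable_lin r); congr solvable.
by apply/funext => i /=; rewrite rf.
Qed.

Lemma pure_id (M : lmodType R) : pure (@idfun M).
Proof. by move=> m n D p. Qed.

Lemma solvable_comp_inj (M N : lmodType R) (i : {linear M -> N}) m n (D : 'M[R]_(m, n))
   (y : 'I_n -> M) p : injective i -> mxact D (i \o y) = i \o p -> mxact D y = p.
Proof.
move=> inji; rewrite mxact_lin => E; apply/funext => j; apply: inji.
exact: (congr1 (fun g => g j) E).
Qed.

End Systems.


(** * The equational criterion for flatness *)

Lemma quotient_lift (V Q G : zmodType) (pi : {additive V -> Q}) (h : {additive V -> G}) :
  (forall q, exists x, pi x = q) -> (forall x, pi x = 0 -> h x = 0) ->
  exists g : {additive Q -> G}, forall x, g (pi x) = h x.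
Proof.
move=> /choice[s piK] kerh.
have hE x y : pi x = pi y -> h x = h y.
  by move=> E; apply/eqP; rewrite -subr_eq0 -raddfB kerh // raddfB E subrr.
have addg : zmod_morphism (h \o s).
  by move=> x y /=; rewrite -raddfB; apply: hE; rewrite raddfB !piK.
by exists (additive_pack addg) => x; apply: hE; rewrite piK.
Qed.

Lemma morphD_zmod_morphism (V G : zmodType) (f : V -> G) :
  {morph f : x y / x + y} -> zmod_morphism f.
Proof. by move=> fD x y; have := fD (x - y) y; rewrite subrK => ->; rewrite addrK. Qed.

Section EquationalFlatness.
Variable R : nzRingType.

(** Linear relations in M follow from linear relations in R. *)
Definition equationally_flat (M : lmodType R) : Prop :=
  forall n (r : 'M[R]_(1, n)) (x : 'I_n -> M), mxact r x = 0 ->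
  exists k (C : 'M[R]_(n, k)) (y : 'I_k -> M), x = mxact C y /\ r *m C = 0.

(** The relations are trivialized one after the other, each time in terms of the
    elements y produced by the previous ones. *)
Lemma equationally_flat_mx (M : lmodType R) : equationally_flat M ->
  forall p n (D : 'M[R]_(p, n)) (x : 'I_n -> M), mxact D x = 0 ->
  exists k (C : 'M[R]_(n, k)) (y : 'I_k -> M), x = mxact C y /\ D *m C = 0.
Proof.
move=> EM; elim=> [|p IH] n D x Dx.
  by exists n, 1%:M, x; rewrite mxact1; split=> //; apply/matrixP => -[].
move: D Dx; rewrite -[p.+1]/(1 + p)%N => D.
rewrite -[D]vsubmxK mxact_col => Dx.
have [u0 d0] : mxact (usubmx D) x = 0 /\ mxact (dsubmx D) x = 0.
  split; apply/funext => i; [have := congr1 (@^~ (lshift p i)) Dx|have := congr1 (@^~ (rshift 1 i)) Dx];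
  by rewrite /= ?tuple_catl ?tuple_catr.
have [k [C [y [xE DC]]]] := EM _ _ _ u0.
have [k' [C' [y' [yE DC']]]] : exists k' (C' : 'M[R]_(k, k')) (y' : 'I_k' -> M),
    y = mxact C' y' /\ dsubmx D *m C *m C' = 0.
  by apply: IH; rewrite mxactM -xE.
exists k', (C *m C'), y'; split; first by rewrite mxactM -yE.
by rewrite mulmxA mul_col_mx DC mul_col_mx DC' mul0mx col_mx0.
Qed.

Lemma converse_scale (s x : R) : (s : R^c) *: (x : R^c^o) = (x * s : R).
Proof. by []. Qed.

Section FlatEquational.
Variables (M : lmodType R) (n : nat) (r : 'M[R]_(1, n)).

(** For the right ideal I = r R^n, the tensor product of I and M is M^n modulo
    [relspan], the class of (c_i x)_i being the tensor of r c and x: the vector c is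
    determined by r c up to the solutions of r c' = 0. *)
Let relspan : set ('I_n -> M) :=
  [set u | exists k (C : 'M[R]_(n, k)) (y : 'I_k -> M), u = mxact C y /\ r *m C = 0].

Let relspan_subgroup : is_subgroup relspan.
Proof.
split; first by exists 0, 0, 0; rewrite mxact0 mulmx0.
move=> u v [k [C [y [-> rC]]]] [l [E [z [-> rE]]]].
exists (k + l)%N, (row_mx C (- E)), (tuple_cat y z).
by rewrite mxact_row mxactNl; split=> //; rewrite mul_mx_row rC mulmxN rE oppr0 row_mx0.
Qed.

Let ideal : set (R^c^o) := [set a | exists c : 'cV[R]_n, (r *m c) 0 0 = a].

Let ideal_submod : is_submod ideal.
Proof.
split; first by exists 0; rewrite mulmx0 mxE.
move=> s _ _ [c <-] [d <-]; exists (\matrix_(i, j) (c i j * s) + d).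
rewrite mulmxDr mxE; congr (_ + _).
rewrite converse_scale !mxE mulr_suml; apply: eq_bigr => j _.
by rewrite mxE mulrA.
Qed.

(** Tensoring the inclusion of I in R with M gives the map of M^n / [relspan] to M
    induced by r; flatness says that it is injective. *)
Lemma flat_relspan : flat M -> forall x, mxact r x = 0 -> relspan x.
Proof.
move=> flatM.
have [A [f [injf idf]]] := submod_of_set_incl ideal_submod.
have [TA [pi [pisurj piker]]] := quotient_group relspan_subgroup.
have /choice[co coP] : forall a : A, exists c : 'cV[R]_n, (r *m c) 0 0 = f a.
  by move=> a; apply/idf; exists a.
pose sc (c : 'cV[R]_n) (x : M) : 'I_n -> M := fun i => c i 0 *: x.
pose tauA (a : A) (x : M) : TA := pi (sc (co a) x).
have scP c d x : r *m c = r *m d -> pi (sc c x) = pi (sc d x).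
  move=> E; apply/eqP; rewrite -subr_eq0 -raddfB; apply/eqP/piker.
  exists 1%N, (c - d), (fun _ => x); rewrite mulmxBr E subrr; split=> //.
  apply/funext => i; rewrite /mxact big_ord1 !mxE scalerDl scaleNr.
  by [].
have mx11 (c d : 'M[R]_1) : c 0 0 = d 0 0 -> c = d.
  by move=> E; apply/matrixP => i j; rewrite !ord1.
have tauAE a c x : f a = (r *m c) 0 0 -> tauA a x = pi (sc c x).
  by move=> E; apply: scP; apply: mx11; rewrite coP.
have balA : balanced tauA.
  split=> [a x y|x a b|a s x].
  - rewrite /tauA -raddfD; congr (pi _).
    by apply/funext => i; rewrite /sc scalerDr.
  - rewrite (@tauAE _ (co a + co b)); last by rewrite raddfD mulmxDr mxE !coP.
    rewrite /tauA -raddfD; congr (pi _).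
    by apply/funext => i; rewrite /sc mxE scalerDl.
  - rewrite (@tauAE _ (\matrix_(i, j) (co a i j * s))); last first.
      rewrite linearZ /= -coP converse_scale !mxE mulr_suml; apply: eq_bigr => j _.
      by rewrite mxE mulrA.
    by congr (pi _); apply/funext => i; rewrite /sc mxE scalerA.
have /choice[e eP] : forall j : 'I_n, exists e : A, f e = r 0 j.
  move=> j; apply/idf; exists (delta_mx j 0); rewrite mxE (bigD1 j) //= big1 ?addr0.
    by rewrite mxE !eqxx mulr1.
  by move=> i ij; rewrite mxE (negbTE ij) mulr0.
have bal0l (G : zmodType) (B : lmodType R^c) (beta : B -> M -> G) x : balanced beta -> beta 0 x = 0.
  case=> _ aD _; have /= := aD x 0 0; rewrite addr0 => /eqP.
  by rewrite -subr_eq0 opprD addrA subrr sub0r oppr_eq0 => /eqP.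
have bal_suml (G : zmodType) (B : lmodType R^c) (beta : B -> M -> G) x (I : Type) (s : seq I) F : balanced beta ->
    beta (\sum_(i <- s) F i) x = \sum_(i <- s) beta (F i) x.
  move=> bb; apply: (big_morph (beta^~ x)) => [a b|]; first by case: bb => _ aD _; apply: aD.
  exact: bal0l.
have bal_sumr (G : zmodType) (B : lmodType R^c) (beta : B -> M -> G) a (I : Type) (s : seq I) F : balanced beta ->
    beta a (\sum_(i <- s) F i) = \sum_(i <- s) beta a (F i).
  case=> xD _ _; apply: (big_morph (beta a)) => [x y|]; first by rewrite xD.
  have /= := xD a 0 0; rewrite addr0 => /eqP.
  by rewrite -subr_eq0 opprD addrA subrr sub0r oppr_eq0 => /eqP.
have sumE (c : 'cV[R]_n) : f (\sum_j (c j 0 : R^c) *: e j) = (r *m c) 0 0.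
  rewrite linear_sum mxE; apply: eq_bigr => j _.
  by rewrite linearZ /= eP.
have tensA : is_tensor_product tauA.
  split=> // G beta bal; have [xD aD sw] := bal.
  pose h (u : 'I_n -> M) := \sum_j beta (e j) (u j).
  have hadd : zmod_morphism h.
    move=> u v; rewrite /h -sumrB; apply: eq_bigr => j _.
    exact: morphD_zmod_morphism (xD _) _ _.
  have [|g gP] := @quotient_lift _ _ _ pi (additive_pack hadd) pisurj.
    move=> u /piker[k [C [y [-> rC]]]]; rewrite /= /h /mxact.
    under eq_bigr do rewrite bal_sumr //.
    rewrite exchange_big /= big1 // => l _.
    under eq_bigr do rewrite -sw.
    rewrite -bal_suml //.
    rewrite (_ : \sum_i _ = 0) ?bal0l //; apply: injf; rewrite raddf0.
    have := sumE (col l C); rewrite [in r *m _]colE mulmxA rC mul0mx mxE => <-.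
    by congr (f _); apply: eq_bigr => j _; rewrite mxE.
  exists g => [a x|g' gP' t].
    rewrite gP /= /h /sc; under eq_bigr do rewrite -sw.
    rewrite -bal_suml //; congr beta; apply: injf.
    by rewrite sumE coP.
  have [u <-] := pisurj t; rewrite gP /= /h.
  have -> : u = \sum_j sc (delta_mx j 0) (u j).
    apply/funext => i; rewrite fct_sumE (bigD1 i) //= big1 ?addr0 /sc.
      by rewrite mxE !eqxx scale1r.
    by move=> j ji; rewrite mxE eq_sym (negbTE ji) scale0r.
  rewrite 2!raddf_sum; apply: eq_bigr => j _.
  rewrite -[X in beta _ X]/(_ j) -gP'.
  have <- : tauA (e j) (u j) = pi (sc (delta_mx j 0) (u j)).
    apply: tauAE; rewrite eP mxE (bigD1 j) //= big1 ?addr0 ?mxE ?eqxx ?mulr1 //.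
    by move=> i ij; rewrite mxE (negbTE ij) mulr0.
  congr (g' (tauA _ _)).
  rewrite fct_sumE (bigD1 j) //= big1 ?addr0 /sc; first by rewrite mxE !eqxx scale1r.
  by move=> i ij; rewrite mxE eq_sym (negbTE ij) scale0r.
pose tauB (b : R^c^o) (x : M) : M := (b : R) *: x.
have balB : balanced tauB.
  split=> [b x y|x a b|a s x]; rewrite /tauB.
  - exact: scalerDr.
  - exact: (@scalerDl R).
  - by rewrite converse_scale scalerA.
have tensB : is_tensor_product tauB.
  split=> // G beta bal; have [xD aD sw] := bal.
  have gadd : zmod_morphism (beta 1) by apply: morphD_zmod_morphism.
  exists (additive_pack gadd) => [a x|g' gP' t].
    by rewrite /= -sw converse_scale mul1r.
  by rewrite /= -gP' /tauB scale1r.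
pose h (u : 'I_n -> M) := mxact r u 0.
have hadd : zmod_morphism h by move=> u v; rewrite /h mxactB.
have [|fM fMP] := @quotient_lift _ _ _ pi (additive_pack hadd) pisurj.
  by move=> u /piker[k [C [y [-> rC]]]]; rewrite /= /h -mxactM rC mxact0l.
have inj := flatM A (R^c^o) f injf TA M tauA tauB tensA tensB fM.
move=> x rx; apply/piker/inj.
  move=> a m; rewrite fMP /= /h /mxact /sc /tauB -coP mxE scaler_suml.
  by apply: eq_bigr => j _; rewrite scalerA.
by rewrite raddf0 fMP /= /h rx.
Qed.
End FlatEquational.

Lemma flat_equationally_flat (M : lmodType R) : flat M -> equationally_flat M.
Proof. by move=> flatM n r x rx; apply: flat_relspan. Qed.

End EquationalFlatness.


Lemma sum_uniq_widen (T : eqType) (V : zmodType) (X Y : seq T) (F : T -> V) :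
  uniq X -> uniq Y -> {subset X <= Y} -> (forall x, x \notin X -> F x = 0) ->
  \sum_(x <- X) F x = \sum_(x <- Y) F x.
Proof.
move=> uX uY XY F0; have : perm_eq X [seq x <- Y | x \in X].
  apply: uniq_perm => //; first exact: filter_uniq.
  by move=> x; rewrite mem_filter andb_idr // => /XY.
move=> pXY; rewrite (perm_big _ pXY) big_filter big_mkcond /=.
by apply: eq_bigr => x _; case: ifPn => // /F0.
Qed.

Lemma sum_indicator (R : nzRingType) (M : lmodType R) (X : seq M) (c : M) :
  uniq X -> c \in X -> \sum_(x <- X) (x == c)%:R *: x = c :> M.
Proof.
move=> uX cX; rewrite -(@sum_uniq_widen _ _ [:: c]) //=.
- by rewrite big_seq1 eqxx scale1r.
- by move=> x; rewrite inE => /eqP ->.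
- by move=> x; rewrite inE => /negbTE ->; rewrite scale0r.
Qed.

Section EquationalFlat.
Variables (R : nzRingType) (M : lmodType R).

(** M is presented by the family of all its elements as generators; these are the
    relations of that presentation. *)
Definition linear_relation (k : M -> R) : Prop :=
  exists X : seq M, [/\ uniq X, forall x, x \notin X -> k x = 0 &
                        \sum_(x <- X) k x *: x = 0].

Section Presentation.
Variable B : lmodType R^c.

(** The tensor product of B and M is spanned by the functions M -> B with finite support,
    modulo this subgroup. All functions are admitted here: the quotient is only the
    target of a balanced map that detects the vanishing of tensors. *)
Definition tensor_relations : set (M -> B) :=
  [set g | exists n (b : 'I_n -> B) (k : 'I_n -> M -> R),
     (forall l, linear_relation (k l)) /\
     g = fun x => \sum_l (k l x : R^c) *: b l].

Lemma tensor_relations_subgroup : is_subgroup tensor_relations.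
Proof.
split.
  exists 0, (fun _ => 0), (fun _ _ => 0); split=> [[]//|].
  by apply/funext => x; rewrite big_ord0.
move=> _ _ [n [b [k [kr ->]]]] [m [c [l [lr ->]]]].
exists (n + m)%N, (tuple_cat b (fun j => - c j)), (tuple_cat k l); split.
  by move=> j; rewrite /tuple_cat; case: fintype.split.
apply/funext => x; rewrite big_split_ord /= [LHS]/GRing.add /=; congr (_ + _).
  by apply: eq_bigr => j _; rewrite !tuple_catl.
rewrite -[LHS]sumrN; apply: eq_bigr => j _.
by rewrite !tuple_catr scalerN.
Qed.

Definition tensor_delta (b : B) (m : M) : M -> B := fun x => if x == m then b else 0.

Lemma tensor_relations1 (b : B) k : linear_relation k ->
  tensor_relations (fun x => (k x : R^c) *: b).
Proof.
move=> kr; exists 1%N, (fun _ => b), (fun _ => k); split=> //.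
by apply/funext => x; rewrite big_ord1.
Qed.

Lemma tensor_delta_balanced (Q : zmodType) (pi : {additive (M -> B) -> Q}) :
  (forall g, pi g = 0 <-> tensor_relations g) ->
  balanced (fun b m => pi (tensor_delta b m)).
Proof.
move=> piker; split=> [b x y|x b c|b s x].
- apply/eqP; rewrite -raddfD -subr_eq0 -raddfB; apply/eqP/piker.
  pose k z : R := (z == x + y)%:R - ((z == x)%:R + (z == y)%:R).
  rewrite (_ : _ - _ = fun z => (k z : R^c) *: b); last first.
    apply/funext => z; rewrite /k [RHS](@scalerBl R^c) (@scalerDl R^c).
    rewrite [LHS]/GRing.add /= [X in - X]/GRing.add /= /tensor_delta.
    by congr (_ - (_ + _)); case: eqP => _; rewrite ?scale1r ?scale0r.
  apply: tensor_relations1; exists (undup [:: x + y; x; y]); split.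
  + exact: undup_uniq.
  + move=> z; rewrite mem_undup !inE !negb_or /k => /and3P[/negbTE-> /negbTE-> /negbTE->].
    by rewrite addr0 subrr.
  + under eq_bigr do rewrite scalerBl scalerDl.
    by rewrite sumrB big_split !sum_indicator ?subrr ?undup_uniq // mem_undup !inE eqxx ?orbT.
- rewrite -raddfD; congr (pi _); apply/funext => z.
  rewrite [RHS]/GRing.add /= /tensor_delta; case: ifP => // _; by rewrite addr0.
- apply/eqP; rewrite -subr_eq0 -raddfB; apply/eqP/piker.
  pose k z : R := s * (z == x)%:R - (z == s *: x)%:R.
  rewrite (_ : _ - _ = fun z => (k z : R^c) *: b); last first.
    apply/funext => z; rewrite /k [RHS](@scalerBl R^c) /tensor_delta.
    rewrite [LHS]/GRing.add /=.
    congr (_ - _); case: eqP => _; rewrite ?scale1r ?scale0r ?mulr1 ?mulr0 ?scale0r //.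
  apply: tensor_relations1; exists (undup [:: x; s *: x]); split.
  + exact: undup_uniq.
  + move=> z; rewrite mem_undup !inE !negb_or /k => /andP[/negbTE-> /negbTE->].
    by rewrite mulr0 subrr.
  + under eq_bigr do rewrite scalerBl -scalerA.
    by rewrite sumrB -scaler_sumr !sum_indicator ?subrr ?undup_uniq // mem_undup !inE eqxx ?orbT.
Qed.

End Presentation.

(** The quotient by the subgroup spanned by the pure tensors is a map that vanishes on
    the pure tensors, as the null map does; by uniqueness both are equal. *)
Lemma tensor_generated (A : lmodType R^c) (T : zmodType) (tau : A -> M -> T) :
  is_tensor_product tau -> forall t, exists n (a : 'I_n -> A) (m : 'I_n -> M),
    t = \sum_i tau (a i) (m i).
Proof.
move=> [bal univ].
pose S : set T := [set t | exists n (a : 'I_n -> A) (m : 'I_n -> M),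
    t = \sum_i tau (a i) (m i)].
have subS : is_subgroup S.
  split; first by exists 0, (fun _ => 0), (fun _ => 0); rewrite big_ord0.
  move=> _ _ [n [a [m ->]]] [n' [a' [m' ->]]].
  exists (n + n')%N, (tuple_cat a (fun j => - a' j)), (tuple_cat m m').
  rewrite big_split_ord /=; congr (_ + _).
    by apply: eq_bigr => j _; rewrite !tuple_catl.
  rewrite -sumrN; apply: eq_bigr => j _; rewrite !tuple_catr.
  have [_ aD _] := bal.
  have /= := raddfN (additive_pack (morphD_zmod_morphism (aD (m' j)))) (a' j).
  by move=> ->.
have [Q [pi [_ piker]]] := quotient_group subS.
have [|g _ gU] := univ Q (fun _ _ => 0).
  by split=> [a x y|x a b|//]; rewrite addr0.
move=> t; apply/piker; rewrite gU; last first.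
  move=> a m; apply/piker; exists 1%N, (fun _ => a), (fun _ => m).
  by rewrite big_ord1.
by rewrite -(gU \0).
Qed.

(** If a tensor of A and M vanishes over B, then finitely many relations of M are
    responsible, forming a system D xs = 0. By the equational criterion xs = C y with
    D C = 0, so that the tensor is a sum of a'_e tensored with y_e where the images of
    the a'_e in B are combinations of the entries of D C; thus a'_e = 0 in A. *)
Lemma equationally_flat_flat : equationally_flat M -> flat M.
Proof.
move=> EM A B f injf TA TB tauA tauB tensA tensB fM fMP.
suff ker0 z : fM z = 0 -> z = 0.
  by move=> x y E; apply/eqP; rewrite -subr_eq0; apply/eqP/ker0; rewrite raddfB E subrr.
have [p [a [m ->]]] := tensor_generated tensA z.
rewrite raddf_sum; under eq_bigr do rewrite fMP.
have [Q [pi [_ piker]]] := quotient_group (tensor_relations_subgroup B).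
have [_ /(_ Q _ (tensor_delta_balanced piker))[g gP _]] := tensB.
move=> /(congr1 g); rewrite raddf0 raddf_sum.
under eq_bigr do rewrite gP.
rewrite -raddf_sum => /piker[q [b [k [krel /(congr1 (fun h : M -> B => h)) E]]]].
have /choice[Xs XsP] := krel.
pose X := undup (flatten (codom Xs) ++ codom m).
have uX : uniq X by apply: undup_uniq.
have subX l : {subset Xs l <= X}.
  move=> x xl; rewrite mem_undup mem_cat; apply/orP; left.
  by apply/flattenP; exists (Xs l) => //; apply: codom_f.
have mX i : m i \in X by rewrite mem_undup mem_cat codom_f orbT.
pose xs (j : 'I_(size X)) := nth 0 X j.
pose D : 'M[R]_(q, size X) := \matrix_(l, j) k l (xs j).
have Dxs : mxact D xs = 0.
  apply/funext => l; rewrite /mxact.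
  under eq_bigr do rewrite mxE.
  rewrite -(big_mkord xpredT (fun j => k l (nth 0 X j) *: nth 0 X j)).
  rewrite -(@big_nth _ _ _ _ 0 X xpredT (fun x => k l x *: x)).
  have [uXl k0 ksum] := XsP l.
  rewrite -(@sum_uniq_widen _ _ (Xs l)) //.
  by move=> x /k0 ->; rewrite scale0r.
have [c [C [y [xsE DC]]]] := equationally_flat_mx EM Dxs.
pose j0 i : 'I_(size X) := Ordinal (etrans (index_mem (m i) X) (mX i)).
have mE i : m i = \sum_e C (j0 i) e *: y e.
  by rewrite -[RHS]/(mxact C y (j0 i)) -xsE /xs /= nth_index.
have [balA _] := tensA; have [xD aD sw] := balA.
pose tl (x : M) := additive_pack (morphD_zmod_morphism (aD x)).
pose tr (x : A) := additive_pack (morphD_zmod_morphism (xD x)).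
have -> : \sum_i tauA (a i) (m i) = \sum_e tauA (\sum_i (C (j0 i) e : R^c) *: a i) (y e).
  transitivity (\sum_i \sum_e tauA ((C (j0 i) e : R^c) *: a i) (y e)).
    apply: eq_bigr => i _; rewrite {1}mE -[LHS]/(tr (a i) _) raddf_sum.
    by apply: eq_bigr => e _ /=; rewrite -sw.
  rewrite exchange_big; apply: eq_bigr => e _ /=.
  by rewrite -[RHS]/(tl (y e) _) raddf_sum.
rewrite big1 // => e _.
rewrite (_ : \sum_i _ = 0); first by rewrite -[LHS]/(tl (y e) _) raddf0.
apply: injf; rewrite raddf0 linear_sum.
have inj_xs : injective xs.
  by move=> i j /eqP; rewrite nth_uniq // => /eqP/val_inj.
transitivity (\sum_j (C j e : R^c) *: (\sum_i tensor_delta (f (a i)) (m i)) (xs j)).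
  under [RHS]eq_bigr do rewrite fct_sumE scaler_sumr.
  rewrite exchange_big; apply: eq_bigr => i _ /=.
  rewrite linearZ (bigD1 (j0 i)) //= big1 ?addr0.
    by rewrite /tensor_delta /xs /= nth_index // eqxx.
  move=> j jj; rewrite /tensor_delta ifN ?scaler0 //.
  apply: contra jj => /eqP xm; apply/eqP/inj_xs.
  by rewrite xm /xs /= nth_index.
rewrite E; under eq_bigr do rewrite scaler_sumr.
rewrite exchange_big big1 // => l _ /=.
have := congr1 (fun F : 'M[R]_(q, c) => F l e) DC; rewrite !mxE => DCle.
transitivity ((\sum_j D l j * C j e : R^c) *: b l); last by rewrite DCle scale0r.
by rewrite scaler_suml; apply: eq_bigr => j _; rewrite scalerA mxE.
Qed.

End EquationalFlat.

Lemma flatP (R : nzRingType) (M : lmodType R) : flat M <-> equationally_flat M.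
Proof.
by split=> [/flat_equationally_flat|/equationally_flat_flat].
Qed.


(** * Direct sums *)

(** The index set of a direct sum is a bare type: finite supports are enumerated by lists
    with the propositional membership predicate. *)
Lemma finite_set_list (T : Type) (A : set T) :
  finite_set A -> exists s : seq T, forall x, A x -> List.In x s.
Proof.
move=> /(@finite_seqP {classic T})[s As]; exists s => x; rewrite As /=.
elim: s {As} => // y s IH; rewrite inE => /orP[/eqP ->|/IH]; first by left.
by right.
Qed.

Lemma list_finite_set (T : Type) (s : seq T) : finite_set [set x | List.In x s].
Proof.
apply/(@finite_seqP {classic T}); exists s; apply/seteqP.
split=> x /=; elim: s => //= y s IH; rewrite inE.
  by case=> [->|/IH ->]; rewrite ?eqxx ?orbT.
by move=> /orP[/eqP ->|/IH]; [left|right].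
Qed.

Lemma In_undup (T : eqType) (s : seq T) x : List.In x s -> x \in undup s.
Proof.
rewrite mem_undup; elim: s => //= y s IH [->|/IH]; rewrite inE ?eqxx // => ->.
by rewrite orbT.
Qed.

Lemma leq_max_list (s : seq nat) j : List.In j s -> (j <= \max_(i <- s) i)%N.
Proof.
elim: s => //= i s IH [->|/IH ji]; rewrite big_cons ?leq_maxl //.
exact: leq_trans ji (leq_maxr _ _).
Qed.

Lemma In_flatten (T : Type) n (s : 'I_n -> seq T) i x :
  List.In x (s i) -> List.In x (flatten (map s (enum 'I_n))).
Proof.
move=> xs; have : i \in enum 'I_n by rewrite mem_enum.
elim: (enum 'I_n) => //= j l IH; rewrite inE List.in_app_iff => /orP[/eqP <-|/IH];
by [left|right].
Qed.

Section DirectSumFacts.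
Variables (R : nzRingType) (I : Type) (M : lmodType R).
Local Notation DS := (direct_sum I M).

Definition ds_fun (f : DS) : I -> M := val f.
Fact ds_fun_linear : linear ds_fun. Proof. by []. Qed.
HB.instance Definition _ := GRing.isLinear.Build R DS (I -> M) _ ds_fun ds_fun_linear.

Definition ds_coord (i : I) (f : DS) : M := ds_fun f i.
Fact ds_coord_linear i : linear (ds_coord i). Proof. by []. Qed.
HB.instance Definition _ i := GRing.isLinear.Build R DS M _ (ds_coord i) (ds_coord_linear i).

Lemma ds_coordD i (f g : DS) : ds_coord i (f + g) = ds_coord i f + ds_coord i g.
Proof. by []. Qed.

Lemma ds_ext (f g : DS) : (forall i, ds_coord i f = ds_coord i g) -> f = g.
Proof. by move=> E; apply: val_inj; apply/funext => i; apply: E. Qed.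

Lemma ds_finite (f : DS) : finite_set [set i | ds_coord i f != 0].
Proof. exact: (asboolW (valP f)). Qed.

Lemma ds_list (f : DS) : exists s, forall i, ds_coord i f != 0 -> List.In i s.
Proof. exact: finite_set_list (ds_finite f). Qed.

Lemma ds_make (f : I -> M) : finite_set [set i | f i != 0] ->
  exists g : DS, forall i, ds_coord i g = f i.
Proof.
move=> ff; have fP : f \in @finite_support R I M by apply/asboolP.
by exists (exist _ f fP).
Qed.

Lemma ds_make_list (f : I -> M) s : (forall i, f i != 0 -> List.In i s) ->
  exists g : DS, forall i, ds_coord i g = f i.
Proof.
by move=> fs; apply: ds_make; apply: sub_finite_set (list_finite_set s).
Qed.

Lemma ds_delta_finite (i : I) (m : M) :
  finite_set [set j | (if `[< j = i >] then m else 0) != 0].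
Proof.
apply: sub_finite_set (finite_set1 i) => j /=.
by case: asboolP => // _; rewrite eqxx.
Qed.

Definition ds_delta (i : I) (m : M) : DS := projT1 (cid (ds_make (ds_delta_finite i m))).

Lemma ds_deltaE i m j : ds_coord j (ds_delta i m) = if `[< j = i >] then m else 0.
Proof. exact: (projT2 (cid (ds_make (ds_delta_finite i m))) j). Qed.

Lemma ds_delta_eq i m : ds_coord i (ds_delta i m) = m.
Proof. by rewrite ds_deltaE asboolT. Qed.

Lemma ds_delta_neq i j m : j <> i -> ds_coord j (ds_delta i m) = 0.
Proof. by move=> ji; rewrite ds_deltaE asboolF. Qed.

Fact ds_delta_linear i : linear (ds_delta i).
Proof.
move=> a x y; apply: ds_ext => j; rewrite linearP /= !ds_deltaE.
by case: asboolP => // _; rewrite scaler0 addr0.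
Qed.
HB.instance Definition _ i := GRing.isLinear.Build R M DS _ (ds_delta i) (ds_delta_linear i).

Lemma ds_delta_pure i : pure (ds_delta i).
Proof. by apply: (@pure_retract _ _ _ _ (ds_coord i)) => m; rewrite /= ds_delta_eq. Qed.

Lemma ds_erase (f : DS) i : exists g : DS, (forall j, j <> i -> ds_coord j g = ds_coord j f) /\ ds_coord i g = 0.
Proof.
exists (f - ds_delta i (ds_coord i f)); split=> [j ji|].
  by rewrite linearB /= ds_delta_neq // subr0.
by rewrite linearB /= ds_delta_eq subrr.
Qed.

Lemma ds_ind (P : DS -> Prop) :
  P 0 -> (forall i m f, P f -> P (ds_delta i m + f)) -> forall f, P f.
Proof.
move=> P0 PD f; have [s] := ds_list f; elim: s f => [|i s IH] f fs.
  rewrite (_ : f = 0) //; apply: ds_ext => j; rewrite raddf0.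
  by apply/eqP; case: eqP => // /eqP /fs.
rewrite -[f](subrK (ds_delta i (ds_coord i f))) addrC; apply: PD.
apply: IH => j; rewrite linearB /= ds_deltaE; case: asboolP => [->|ji].
  by rewrite subrr eqxx.
by rewrite subr0 => /fs[/esym|].
Qed.

Lemma ds_lift (N : lmodType R) (h : I -> {linear M -> N}) :
  exists H : {linear DS -> N}, forall i m, H (ds_delta i m) = h i m.
Proof.
pose sup (f : DS) : seq {classic I} := @undup {classic I} (projT1 (cid (ds_list f))).
have supP f i : ds_coord i f != 0 -> i \in sup f.
  by rewrite /sup; case: cid => s sP /= /sP; apply: (@In_undup {classic I}).
have sup0 f i : i \notin sup f -> h i (ds_coord i f) = 0.
  by move=> /negP nf; case: (eqVneq (ds_coord i f) 0) => [->|/supP//]; rewrite raddf0.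
pose H f := \sum_(i <- sup f) h i (ds_coord i f).
have HE f (s : seq {classic I}) : uniq s -> {subset sup f <= s} -> H f = \sum_(i <- s) h i (ds_coord i f).
  by move=> us fs; apply: sum_uniq_widen (sup0 f); rewrite // undup_uniq.
have lH : linear H.
  move=> a f g; pose s := undup (sup (a *: f + g) ++ sup f ++ sup g).
  have us : uniq s by apply: undup_uniq.
  rewrite (HE _ s) ?(HE f s) ?(HE g s) //; try by
    move=> i ii; rewrite mem_undup !mem_cat ii ?orbT.
  rewrite scaler_sumr -big_split; apply: eq_bigr => i _ /=.
  by rewrite !linearP.
exists (linear_pack lH) => i m /=.
have [->|m0] := eqVneq m 0; first by rewrite !raddf0 /H big1 // => j _; rewrite !raddf0.
pose s := undup ([:: (i : {classic I})] ++ sup (ds_delta i m)).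
rewrite (HE _ s) ?undup_uniq //; last by move=> j jj; rewrite mem_undup mem_cat jj orbT.
rewrite -(@sum_uniq_widen _ _ [:: (i : {classic I})]) ?undup_uniq //.
- by rewrite big_seq1 ds_delta_eq.
- by move=> j; rewrite inE => /eqP ->; rewrite mem_undup inE eqxx.
- move=> j; rewrite inE => /eqP ji; rewrite ds_delta_neq ?raddf0 //.
Qed.

Lemma ds_lin_ext (N : lmodType R) (h h' : {linear DS -> N}) :
  (forall i m, h (ds_delta i m) = h' (ds_delta i m)) -> h =1 h'.
Proof.
move=> E; apply: ds_ind => [|i m f IH]; first by rewrite !raddf0.
by rewrite (raddfD h) (raddfD h') /= IH; congr (_ + _); apply: E.
Qed.

End DirectSumFacts.
Arguments ds_coord {R I M} i f : simpl never.

(** * Closure properties of flat modules *)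
Section FlatClosure.
Variable R : nzRingType.
Implicit Types M N B F Q : lmodType R.

Lemma flat_pure_sub M N (f : {linear N -> M}) : pure f -> flat M -> flat N.
Proof.
move=> pf /flatP FM; apply/flatP => n r x rx.
have /FM[k [C [y [fx rC]]]] : mxact r (f \o x) = 0.
  by rewrite mxact_lin rx; apply/funext => i /=; rewrite raddf0.
have [z zx] : solvable C x by apply: pf; exists y.
by exists k, C, z.
Qed.

(** A relation in the quotient lifts to a relation up to an element of the submodule;
    by purity this error is r v with v in the submodule, and x - v is a true relation. *)
Lemma flat_pure_quotient M N Q (f : {linear N -> M}) (p : {linear M -> Q}) :
  pure f -> flat M -> (forall q, exists x, p x = q) ->
  (forall x, p x = 0 <-> exists y, f y = x) -> flat Q.
Proof.
move=> pf /flatP FM psurj pker; apply/flatP => n r q rq.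
have /choice[x xq] : forall i, exists x, p x = q i by move=> i; apply: psurj.
have xqE : p \o x = q by apply/funext.
have /choice[u uE] : forall i, exists u, f u = mxact r x i.
  by move=> i; apply/pker; rewrite -[p _]/((p \o mxact r x) i) -mxact_lin xqE rq.
have [v vE] : solvable r u by apply: pf; exists x; apply/funext => i /=; rewrite uE.
have /FM[k [C [y [xE rC]]]] : mxact r (x - (f \o v : 'I_n -> M)) = 0.
  by rewrite mxactB mxact_lin vE; apply/funext => i /=; rewrite /GRing.add /= /GRing.opp /= uE subrr.
exists k, C, (p \o y); split=> //.
rewrite mxact_lin -xE -xqE; apply/funext => i /=.
rewrite raddfB /= -[p (f _)]/(p (f (v i))).
by have /pker -> : exists z, f z = f (v i) by [exists (v i)]; rewrite subr0.
Qed.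

(** A solution y in B of a system over the kernel is a relation D p(y) = 0 in F. Hence
    p(y) = C w with D C = 0, and y minus C applied to a lift of w is a solution in the
    kernel. *)
Lemma kernel_pure B F N (p : {linear B -> F}) (f : {linear N -> B}) :
  flat F -> (forall y, exists x, p x = y) -> injective f ->
  (forall x, p x = 0 <-> exists y, f y = x) -> pure f.
Proof.
move=> /flatP FF psurj injf pker m n D x [y Dy].
have /(equationally_flat_mx FF)[k [C [w [py DC]]]] : mxact D (p \o y) = 0.
  rewrite mxact_lin Dy; apply/funext => i /=; apply/pker; by exists (x i).
have /choice[w' w'E] : forall i, exists z, p z = w i by move=> i; apply: psurj.
have w'p : p \o w' = w by apply/funext.
have /choice[v vE] : forall i, exists v, f v = (y - mxact C w') i.
  move=> i; apply/pker; rewrite raddfB /= -[p (mxact _ _ _)]/((p \o _) i) -mxact_lin w'p -py.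
  by rewrite subrr.
exists v; apply: (solvable_comp_inj injf).
have -> : f \o v = y - mxact C w' by apply/funext.
by rewrite mxactB -mxactM DC mxact0l subr0.
Qed.

(** The equational criterion for M / K, stated in M. It serves for direct sums of different
    modules M / K i: as [direct_sum] takes copies of one module, such a sum is handled as
    the quotient of copies of M by the families with i-th coordinate in K i. *)
Definition flat_modulo M (K : set M) : Prop :=
  forall n (r : 'M[R]_(1, n)) (x : 'I_n -> M), K (mxact r x 0) ->
  exists k (C : 'M[R]_(n, k)) (y : 'I_k -> M), (forall i, K (x i - mxact C y i)) /\ r *m C = 0.

Lemma flat_modulo_quotient M Q (K : set M) (p : {linear M -> Q}) :
  flat Q -> (forall q, exists x, p x = q) -> (forall x, p x = 0 <-> K x) -> flat_modulo K.
Proof.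
move=> /flatP FQ psurj pker n r x /pker rx.
have /FQ[k [C [y [xE rC]]]] : mxact r (p \o x) = 0.
  by rewrite mxact_lin; apply/funext => i; rewrite ord1.
have /choice[z zE] : forall i, exists z, p z = y i by move=> i; apply: psurj.
have zy : p \o z = y by apply/funext.
exists k, C, z; split=> // i; apply/pker; rewrite raddfB /=.
by rewrite -[p (x i)]/((p \o x) i) -[p (mxact _ _ _)]/((p \o _) i) -mxact_lin zy -xE subrr.
Qed.

(** Finitely many coordinates are involved in a relation; they are treated one at a
    time. *)
Lemma flat_direct_sum_modulo (I : Type) M (K : I -> set M) Q (p : {linear direct_sum I M -> Q}) :
  (forall i, is_submod (K i)) -> (forall i, flat_modulo (K i)) ->
  (forall q, exists x, p x = q) -> (forall x, p x = 0 <-> forall i, K i (ds_coord i x)) ->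
  flat Q.
Proof.
move=> subK flatK psurj pker; apply/flatP.
have claim (s : seq I) : forall n (r : 'M[R]_(1, n)) (x : 'I_n -> direct_sum I M),
    (forall i j, ds_coord j (x i) != 0 -> List.In j s) ->
    (forall j, K j (ds_coord j (mxact r x 0))) ->
    exists k (C : 'M[R]_(n, k)) (y : 'I_k -> direct_sum I M),
      (forall i j, K j (ds_coord j (x i - mxact C y i))) /\ r *m C = 0.
  elim: s => [|j0 s IH] n r x xs Kr.
    exists 0, 0, 0; split=> [i j|]; last by rewrite mulmx0.
    rewrite mxact0 subr0; have /eqP -> : ds_coord j (x i) == 0.
      by case: eqP => // /eqP /xs.
    exact: submod0.
  have [k [C [y [yE rC]]]] : exists k (C : 'M[R]_(n, k)) (y : 'I_k -> M),
      (forall i, K j0 (ds_coord j0 (x i) - mxact C y i)) /\ r *m C = 0.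
    by apply: flatK; have := Kr j0; rewrite -[ds_coord _ _]/((ds_coord j0 \o _) 0) -mxact_lin.
  have /choice[x' x'E] : forall i, exists g : direct_sum I M,
      (forall j, j <> j0 -> ds_coord j g = ds_coord j (x i)) /\ ds_coord j0 g = 0.
    by move=> i; apply: ds_erase.
  have x'j j : j <> j0 -> ds_coord j \o x' = ds_coord j \o x.
    by move=> jj; apply/funext => i /=; have [E _] := x'E i; apply: E.
  have x'j0 : ds_coord j0 \o x' = 0.
    by apply/funext => i /=; have [_ ->] := x'E i.
  have [||k' [C' [y' [y'E rC']]]] := IH n r x'.
  - move=> i j; have [->|/eqP jj] := eqVneq (j : {classic I}) j0.
      by rewrite -[ds_coord _ _]/((ds_coord j0 \o _) i) x'j0 eqxx.
    by rewrite -[ds_coord _ _]/((ds_coord j \o _) i) x'j // => /xs[/esym|].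
  - move=> j; have [->|/eqP jj] := eqVneq (j : {classic I}) j0.
      rewrite -[ds_coord _ _]/((ds_coord j0 \o _) 0) -mxact_lin x'j0 mxact0.
      exact: submod0.
    by rewrite -[ds_coord _ _]/((ds_coord j \o _) 0) -mxact_lin x'j // mxact_lin.
  exists (k + k')%N, (row_mx C C'), (tuple_cat (ds_delta j0 \o y) y'); split; last first.
    by rewrite mul_mx_row rC rC' row_mx0.
  move=> i j; rewrite mxact_row [(_ + _) i]/GRing.add /= opprD addrA addrAC raddfB /= mxact_lin.
  have := y'E i j; have [->|/eqP jj] := eqVneq (j : {classic I}) j0.
    rewrite !raddfB /= ds_delta_eq -[ds_coord j0 (x' i)]/((ds_coord j0 \o _) i) x'j0 sub0r => KC.
    by rewrite addrAC; apply: submodD.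
  rewrite !raddfB /= ds_delta_neq // -[ds_coord j (x' i)]/((ds_coord j \o _) i) x'j //.
  by rewrite subr0.
move=> n r q rq.
have /choice[x xq] : forall i, exists x, p x = q i by move=> i; apply: psurj.
have xqE : p \o x = q by apply/funext.
have /choice[ss ssP] : forall i, exists s, forall j, ds_coord j (x i) != 0 -> List.In j s.
  by move=> i; apply: ds_list.
have [||k [C [y [xE rC]]]] := claim (flatten (map ss (enum 'I_n))) n r x.
- by move=> i j /ssP; apply: In_flatten.
- by apply/pker; rewrite -[p _]/((p \o _) 0) -mxact_lin xqE rq.
exists k, C, (p \o y); split=> //.
rewrite mxact_lin -xqE; apply/funext => i /=; apply/eqP; rewrite -subr_eq0 -raddfB.
exact/eqP/pker.
Qed.

Lemma flat_direct_sum (I : Type) M : flat M -> flat (direct_sum I M).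
Proof.
move=> flatM; apply: (@flat_direct_sum_modulo I M (fun _ => [set 0]) _ idfun).
- by move=> _; split=> // a x y /= -> ->; rewrite scaler0 addr0.
- by move=> _; apply: (@flat_modulo_quotient _ _ _ idfun) => // q; exists q.
- by move=> q; exists q.
- by move=> x; split=> [/= -> j|E]; [rewrite raddf0|apply: ds_ext => j; rewrite E raddf0].
Qed.

Lemma flat_regular : flat (R^o : lmodType R).
Proof.
apply/flatP => n r x rx; exists 1%N, (\matrix_(i, _) x i), (fun _ => 1); split.
  by apply/funext => i; rewrite /mxact big_ord1 mxE -[LHS]mulr1.
apply/matrixP => i j; rewrite !ord1 !mxE; have := congr1 (@^~ 0) rx.
by rewrite /mxact => E; rewrite -[RHS]E; apply: eq_bigr => l _; rewrite mxE.
Qed.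

Lemma flat_prod M N : flat M -> flat N -> flat (M * N)%type.
Proof.
move=> /flatP FM /flatP FN; apply/flatP => n r x rx.
have /FM[k [C [y [yE rC]]]] : mxact r (fst \o x) = 0.
  by rewrite -[fst]/(linear_fst M N : _ -> _) mxact_lin rx.
have /FN[l [D [z [zE rD]]]] : mxact r (snd \o x) = 0.
  by rewrite -[snd]/(linear_snd M N : _ -> _) mxact_lin rx.
exists (k + l)%N, (row_mx C D), (tuple_cat (linear_inl M N \o y) (linear_inr M N \o z)).
split; last by rewrite mul_mx_row rC rD row_mx0.
rewrite mxact_row !mxact_lin -yE -zE.
apply/funext => i; rewrite -[RHS]/((x i).1 + 0, 0 + (x i).2) addr0 add0r.
by case: (x i).
Qed.

Lemma flat_locally M :
  (forall n (x : 'I_n -> M), exists N (f : {linear N -> M}),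
     [/\ flat N, injective f & exists y, x = f \o y]) -> flat M.
Proof.
move=> loc; apply/flatP => n r x rx.
have [N [f [/flatP FN injf [y xE]]]] := loc n x.
have /FN[k [C [z [yE rC]]]] : mxact r y = 0.
  apply: (solvable_comp_inj injf); rewrite -xE rx.
  by apply/funext => i /=; rewrite raddf0.
by exists k, C, (f \o z); rewrite mxact_lin -yE.
Qed.

End FlatClosure.


(** * Pure injectivity, limits and algebraic compactness *)

Section PureInjective.
Variable R : nzRingType.
Implicit Types M N : lmodType R.

(** A positive primitive formula in one variable x, the parameters being kept apart: D w = e x + p is solvable in w. *)
Record formula := Formula {
  frows : nat; fcols : nat; fmx : 'M[R]_(frows, fcols); fvar : 'cV[R]_frows }.

(** Parameters form an infinite sequence, of which the first [frows phi] are read, so that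
    their type does not depend on the formula. *)
Definition holds M (phi : formula) (p : nat -> M) (x : M) : Prop :=
  solvable (fmx phi) (fun i => fvar phi i 0 *: x + p i).

(** Each formula comes with one tuple of parameters only: the solution sets of a formula for
    two tuples are cosets of the same subgroup, hence equal or disjoint. *)
Definition algebraically_compact M : Prop :=
  forall (dom : set formula) (p : formula -> nat -> M),
  (forall s : seq formula, exists x, forall phi, List.In phi s -> dom phi -> holds phi (p phi) x) ->
  exists x, forall phi, dom phi -> holds phi (p phi) x.

Definition directed (I : Type) (le : I -> I -> Prop) : Prop :=
  [/\ inhabited I, forall i, le i i, forall i j k, le i j -> le j k -> le i k &
      forall i j, exists k, le i k /\ le j k].

Lemma directed_tuple (I : Type) (le : I -> I -> Prop) n (i : 'I_n -> I) :
  directed le -> exists k, forall j, le (i j) k.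
Proof.
case=> -[i0] rle tle dle; elim: n i => [|n IH] i; first by exists i0 => -[].
have [k kP] := IH (fun j => i (lift ord0 j)); have [l [kl il]] := dle k (i ord0).
exists l => j; case: (unliftP ord0 j) => [j' ->|->//].
exact: tle (kP _) kl.
Qed.

(** Together with additivity the two conditions say that eventually constant families have
    the expected limit. *)
Definition limit_operator (I : Type) (le : I -> I -> Prop) M (lim : (I -> M) -> M) : Prop :=
  (forall c, lim (fun _ => c) = c) /\
  (forall f i0, (forall i, le i0 i -> f i = 0) -> lim f = 0).

Definition has_limits M : Prop :=
  forall (I : Type) (le : I -> I -> Prop), directed le ->
  exists lim : {linear (I -> M) -> M}, limit_operator le lim.

Lemma limit_eventually (I : Type) (le : I -> I -> Prop) M (lim : {linear (I -> M) -> M}) f g i0 :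
  limit_operator le lim -> (forall i, le i0 i -> f i = g i) -> lim f = lim g.
Proof.
case=> _ l0 fg; apply/eqP; rewrite -subr_eq0 -raddfB; apply/eqP/(l0 _ i0) => i /fg E.
by rewrite /GRing.add /= E; apply: subrr.
Qed.

Lemma limit_solvable (I : Type) (le : I -> I -> Prop) M (lim : {linear (I -> M) -> M}) i0
    m n (D : 'M[R]_(m, n)) (p : 'I_m -> I -> M) :
  limit_operator le lim -> (forall i, le i0 i -> solvable D (p^~ i)) -> solvable D (lim \o p).
Proof.
move=> limP sol.
have /choice[w wP] : forall i, exists w : 'I_n -> M, le i0 i -> mxact D w = p^~ i.
  move=> i; have [/sol[w wE]|nle] := pselect (le i0 i); first by exists w.
  by exists 0.
exists (lim \o (fun j i => w i j)); rewrite mxact_lin; apply/funext => l /=.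
apply: (limit_eventually (i0 := i0) limP) => i /wP /(congr1 (@^~ l)) <-.
by rewrite /mxact fct_sumE.
Qed.

Section EventuallyConstant.
Variables (M : lmodType R) (I : Type) (le : I -> I -> Prop) (dle : directed le).

Let econst : set (I -> M) := [set f | exists c i0, forall i, le i0 i -> f i = c].

Let econst_submod : is_submod econst.
Proof.
have [[i0] _ tle ub] := dle; split; first by exists 0, i0.
move=> a f g [c [i fc]] [d [j gd]]; have [k [ik jk]] := ub i j.
exists (a *: c + d), k => l kl.
by rewrite -(fc l (tle _ _ _ ik kl)) -(gd l (tle _ _ _ jk kl)).
Qed.

(** The eventually constant families form a pure submodule of the product: beyond a late
    index, a solution can be replaced by its value there. The map sending such a family
    to its eventual value extends to the product. *)
Lemma pure_injective_limit : pure_injective M ->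
  exists lim : {linear (I -> M) -> M}, limit_operator le lim.
Proof.
have [[i0] rle tle ub] := dle.
move=> piM; have [N [f [injf fP]]] := submod_of_set_incl econst_submod.
have pf : pure f.
  move=> m n D p [y Dy].
  have /choice[c /choice[k ck]] : forall j, exists c k, forall i, le k i -> f (p j) i = c.
    by move=> j; apply/fP; exists (p j).
  have [k0 k0P] := directed_tuple k dle.
  pose y' j i := if `[< le k0 i >] then y j k0 else y j i.
  have /choice[z zy'] : forall j, exists z, f z = y' j.
    move=> j; apply/fP; exists (y j k0), k0 => i k0i; by rewrite /y' asboolT.
  exists z; apply: (solvable_comp_inj injf).
  have -> : f \o z = y' by apply/funext.
  apply/funext => j; apply/funext => i; rewrite /mxact fct_sumE /=.
  have Dyi i' : \sum_l D j l *: y l i' = f (p j) i'.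
    by have := congr1 (fun g => g j i') Dy; rewrite /mxact fct_sumE.
  transitivity (\sum_l D j l *: y' l i); first by [].
  have [k0i|nk] := pselect (le k0 i); last first.
    have E l : y' l i = y l i by rewrite /y' asboolF.
    by under eq_bigr do rewrite E; apply: Dyi.
  have E l : y' l i = y l k0 by rewrite /y' asboolT.
  under eq_bigr do rewrite E.
  by rewrite Dyi (ck j i (tle _ _ _ (k0P j) k0i)) (ck j k0 (k0P j)).
have /choice[c cP] : forall x, exists c, exists i0, forall i, le i0 i -> f x i = c.
  by move=> x; apply/fP; exists x.
have cE x d i : (forall j, le i j -> f x j = d) -> c x = d.
  have [j jc] := cP x; move=> fd; have [k [jk ik]] := ub j i.
  by rewrite -(jc k jk) (fd k ik).
have lc : linear c.
  move=> a x y; have [i iP] := cP x; have [j jP] := cP y; have [k [ik jk]] := ub i j.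
  apply: (cE _ _ k) => l kl; rewrite linearP.
  by rewrite -(iP l (tle _ _ _ ik kl)) -(jP l (tle _ _ _ jk kl)).
have [h hP] := piM _ _ _ (linear_pack lc) (pure_embedding_pack pf).
exists h; split=> [d|g i gi0].
  have /fP[x xE] : econst (fun _ => d) by exists d, i0.
  by rewrite -xE hP /=; apply: (cE _ _ i0) => j _; rewrite xE.
have /fP[x xE] : econst g by exists 0, i.
by rewrite -xE hP /=; apply: (cE _ _ i) => j ij; rewrite xE gi0.
Qed.

End EventuallyConstant.

Lemma pure_injective_has_limits M : pure_injective M -> has_limits M.
Proof. by move=> piM I le dle; apply: pure_injective_limit. Qed.

(** The limit of the solutions of the finite subsystems, along the finite subsystems ordered
    by inclusion, satisfies each formula because these solutions eventually do. *)
Lemma has_limits_algebraically_compact M : has_limits M -> algebraically_compact M.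
Proof.
move=> limM dom p fin.
pose le (s t : seq formula) := forall phi, List.In phi s -> List.In phi t.
have dle : directed le.
  split=> [|s phi //|s t u st tu phi /st/tu//|s t]; first by exists; exact: nil.
  exists (s ++ t); split=> phi phis; apply/List.in_app_iff; by [left|right].
have [lim limP] := limM _ le dle.
have /choice[y yP] := fin.
exists (lim y) => phi dphi; rewrite /holds.
have -> : (fun i => fvar phi i 0 *: lim y + p phi i) =
          lim \o (fun (i : 'I_(frows phi)) s => fvar phi i 0 *: y s + p phi i).
  apply/funext => i /=.
  rewrite -[RHS]/(lim (fvar phi i 0 *: y + (fun _ => p phi i))) linearP.
  by case: limP => ->.
apply: (limit_solvable (i0 := [:: phi]) limP) => s phis.
by apply: yP => //; apply: phis; left.
Qed.

Lemma solvable_block N m n m' n' (D : 'M[R]_(m, n)) (D' : 'M[R]_(m', n')) (p : 'I_m -> N) p' :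
  solvable (block_mx D 0 0 D') (tuple_cat p p') <-> solvable D p /\ solvable D' p'.
Proof.
have blockE (y : 'I_n -> N) (y' : 'I_n' -> N) :
    mxact (block_mx D 0 0 D') (tuple_cat y y') = tuple_cat (mxact D y) (mxact D' y').
  by rewrite mxact_col !mxact_row !mxact0l addr0 add0r.
split=> [[y]|[[y <-] [y' <-]]]; last by exists (tuple_cat y y').
rewrite -[y]tuple_catK blockE => E; split.
  exists (y \o lshift n'); apply/funext => i; have := congr1 (@^~ (lshift m' i)) E.
  by rewrite /= !tuple_catl.
exists (y \o @rshift n n'); apply/funext => i; have := congr1 (@^~ (rshift m i)) E.
by rewrite /= !tuple_catr.
Qed.

Definition formula_and (phi psi : formula) : formula :=
  Formula (block_mx (fmx phi) 0 0 (fmx psi)) (col_mx (fvar phi) (fvar psi)).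

Definition param_cat (T : Type) m (p q : nat -> T) : nat -> T :=
  fun i => if (i < m)%N then p i else q (i - m)%N.

Lemma holds_and N phi psi (p q : nat -> N) x :
  holds (formula_and phi psi) (param_cat (frows phi) p q) x <->
  holds phi p x /\ holds psi q x.
Proof.
rewrite -solvable_block /holds; suff -> : (solvable (fmx (formula_and phi psi)) (fun i => fvar (formula_and phi psi) i 0 *: x + param_cat (frows phi) p q i)) = solvable (block_mx (fmx phi) 0 0 (fmx psi)) (tuple_cat (fun i => fvar phi i 0 *: x + p i) (fun i => fvar psi i 0 *: x + q i)) by [].
congr solvable; apply/funext => i; rewrite /param_cat /tuple_cat.
case: split_ordP => j -> /=.
  by rewrite col_mxEu.
by rewrite col_mxEd addKn.
Qed.

Lemma holds_exists N phi (p : nat -> N) :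
  solvable (row_mx (fmx phi) (- fvar phi)) (fun i => p i) <-> exists x, holds phi p x.
Proof.
split=> [[y]|[x [y yE]]].
  rewrite -[y]tuple_catK mxact_row => E; exists (y (rshift _ 0)), (y \o @lshift _ 1).
  apply/funext => i; have /= := congr1 (@^~ i) E; rewrite [(_ + _) i]/GRing.add /= => <-.
  have -> : mxact (- fvar phi) (y \o @rshift (fcols phi) 1) i = - (fvar phi i 0 *: y (rshift (fcols phi) 0)).
    by rewrite /mxact big_ord1 mxE scaleNr.
  by rewrite addrCA subrr addr0.
exists (tuple_cat y (fun _ => x)); rewrite mxact_row yE; apply/funext => i.
by rewrite [LHS]/GRing.add /= /mxact big_ord1 mxE scaleNr addrC addKr.
Qed.

Lemma holdsB N phi (p q : nat -> N) x :
  holds phi p x -> holds phi q x -> solvable (fmx phi) (fun i => p i - q i).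
Proof.
move=> hp hq; have := solvableB hp hq; congr solvable.
by apply/funext => i; rewrite [LHS]/GRing.add /= [X in _ + X]/GRing.opp /= opprD addrACA subrr add0r.
Qed.

Lemma holds_shift N phi (p q : nat -> N) x :
  holds phi q x -> solvable (fmx phi) (fun i => p i - q i) -> holds phi p x.
Proof.
move=> hq hp; have := solvableD hq hp; congr solvable.
by apply/funext => i; rewrite [LHS]/GRing.add /= -addrA (addrC (q i)) subrK.
Qed.

Lemma holds_lin N N' (h : {linear N -> N'}) phi (p : nat -> N) x :
  holds phi p x -> holds phi (h \o p) (h x).
Proof.
move=> /(solvable_lin h); congr solvable; apply/funext => i /=.
by rewrite linearP.
Qed.

Lemma holds_pure N N' (h : {linear N -> N'}) phi (p : nat -> N) x :
  pure h -> holds phi (h \o p) (h x) -> holds phi p x.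
Proof.
move=> ph hp; apply: ph; move: hp; congr solvable; apply/funext => i /=.
by rewrite linearP.
Qed.

(** The conjunction is uniform in the module N to which V is mapped; it is used with the two
    projections of a product, to carry a finite system from one factor to the other. *)
Lemma holds_conj (V : lmodType R) (G : set V) (dom : set formula) (P : formula -> nat -> V) (s : seq formula) :
  G 0 -> (forall phi i, dom phi -> G (P phi i)) ->
  exists psi q, (forall i, G (q i)) /\
    forall N (h : {linear V -> N}) x,
      holds psi (h \o q) x <-> forall phi, List.In phi s -> dom phi -> holds phi (h \o P phi) x.
Proof.
move=> G0 GP; elim: s => [|phi s [psi [q [Gq qP]]]].
  exists (Formula (0 : 'M_(0, 0)) 0), (fun _ => 0); split=> // N h x; split=> // _.
  by exists 0; apply/funext => -[].
have [dphi|ndphi] := pselect (dom phi); last first.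
  exists psi, q; split=> // N h x; rewrite qP; split=> H phi'; last by move=> ?; apply: H; right.
  by move=> [<- //|/H].
exists (formula_and phi psi), (param_cat (frows phi) (P phi) q); split.
  by move=> i; rewrite /param_cat; case: ifP => // _; apply: GP.
move=> N h x.
have -> : h \o param_cat (frows phi) (P phi) q = param_cat (frows phi) (h \o P phi) (h \o q).
  by apply/funext => i; rewrite /param_cat /=; case: ifP.
rewrite holds_and qP; split=> [[h1 h2] phi' [<- //|]|H]; first exact: h2.
by split=> [|phi' ?]; apply: H => //; [left|right].
Qed.

Section CompactExtension.
Variables (M B : lmodType R) (acM : algebraically_compact M).

(** The graphs of maps from a submodule of B to M that preserve solvability; that such
    a relation is a function is the case of systems without unknowns. *)
Definition pp_graph (G : set (B * M)) : Prop :=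
  is_submod G /\ forall m n (D : 'M[R]_(m, n)) (p : 'I_m -> B * M), (forall i, G (p i)) ->
    solvable D (fst \o p) -> solvable D (snd \o p).

Lemma pp_graph_bigcup (F : set (set (B * M))) :
  F `<=` pp_graph -> total_on F subset -> F !=set0 -> pp_graph (\bigcup_(X in F) X).
Proof.
move=> FG totF nF; split; first by apply: submod_bigcup => // X /FG[].
move=> m n D p Up; have [X FX Xp] := chain_tuple totF nF Up.
by have [_] := FG _ FX; apply.
Qed.

(** The image y of b has to satisfy the images of all formulas satisfied by b over the
    domain. Finitely many of them have a solution in M, as their existential closure is
    preserved; algebraic compactness gives a common solution. *)
Lemma pp_graph_step (G : set (B * M)) (b : B) : pp_graph G ->
  exists y G', [/\ pp_graph G', G `<=` G' & G' (b, y)].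
Proof.
move=> [subG ppG].
pose dom : set formula := [set phi | exists p : nat -> B * M,
  (forall i, G (p i)) /\ holds phi (fst \o p) b].
have /choice[P PP] : forall phi, exists p : nat -> B * M, dom phi ->
    (forall i, G (p i)) /\ holds phi (fst \o p) b.
  move=> phi; have [[p pP]|nd] := pselect (dom phi); first by exists p.
  by exists (fun _ => 0).
have [y yP] : exists y, forall phi, dom phi -> holds phi (snd \o P phi) y.
  apply: acM => s.
  have [|psi [q [Gq qP]]] := @holds_conj _ G dom P s (submod0 subG).
    by move=> phi i /PP[].
  have : exists x, holds psi (fst \o q) x.
    by exists b; apply/(qP _ (linear_fst B M)) => phi _ /PP[].
  move=> /holds_exists/(ppG _ _ _ (fun i => q i) (fun i => Gq i)) sol.
  have [x xP] := (holds_exists psi (snd \o q)).1 sol.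
  by exists x; apply/(qP _ (linear_snd B M)).
pose G' : set (B * M) := [set z | exists g r, G g /\ z = g + r *: (b, y)].
exists y, G'; split.
- split.
    split; first by exists 0, 0; split; [exact: submod0|rewrite scale0r addr0].
    move=> a _ _ [g [r [Gg ->]]] [g' [r' [Gg' ->]]].
    exists (a *: g + g'), (a * r + r'); split; first by case: subG => _; apply.
    by rewrite scalerDr addrACA scalerA -scalerDl.
  move=> m n D p Gp solp.
  have /choice[g /choice[r grP]] := Gp.
  pose phi := Formula D (\col_i r i).
  pose g' k := if insub k is Some i then g i else 0.
  have Gg' k : G (g' k).
    by rewrite /g'; case: insubP => [i _ _|_]; [case: (grP i)|apply: submod0].
  have g'E i : g' (nat_of_ord i) = g i by rewrite /g' valK.
  have hb : holds phi (fst \o g') b.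
    rewrite /holds /=; move: solp; congr solvable; apply/funext => i /=.
    have [_ ->] := grP i; by rewrite mxE g'E /= addrC.
  have dphi : dom phi by exists g'.
  have [GP hP] := PP _ dphi.
  have hy : holds phi (snd \o g') y.
    apply: holds_shift (yP _ dphi) _.
    have /ppG : solvable (fmx phi) (fst \o (fun i : 'I_m => g' i - P phi i)).
      exact: holdsB hb hP.
    by apply=> i; apply: submodB.
  move: hy; rewrite /holds /=; congr solvable; apply/funext => i /=.
  have [_ ->] := grP i; by rewrite mxE g'E /= addrC.
- by move=> g Gg; exists g, 0; rewrite scale0r addr0.
- exists 0, 1; split; first exact: submod0.
  by rewrite scale1r add0r.
Qed.

Lemma pp_graph_extension (G0 : set (B * M)) : pp_graph G0 ->
  exists h : {linear B -> M}, forall z, G0 z -> h z.1 = z.2.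
Proof.
move=> G0P; have [G [ppG G0G maxG]] := maximal_extension G0P pp_graph_bigcup.
have [subG Gpp] := ppG.
have /choice[h hP] : forall b, exists y, G (b, y).
  move=> b; have [y [G' [ppG' GG' G'by]]] := pp_graph_step b ppG.
  by exists y; rewrite -(maxG G').
have Gfun b y y' : G (b, y) -> G (b, y') -> y = y'.
  move=> Gy Gy'; pose p (_ : 'I_1) := (b, y) - (b, y').
  have sol : solvable (0 : 'M[R]_(1, 0)) (fst \o p).
    by exists 0; rewrite mxact0; apply/funext => i /=; rewrite subrr.
  have [w /(congr1 (@^~ 0)) /=] := Gpp _ _ _ p (fun _ => submodB subG Gy Gy') sol.
  by rewrite /mxact big_ord0 => /esym/eqP; rewrite subr_eq0 => /eqP.
have lh : linear h.
  move=> c x y; apply: (Gfun (c *: x + y)) => //.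
  by case: subG => _ SP; apply: (SP c _ _ (hP x) (hP y)).
by exists (linear_pack lh) => -[b y] /G0G /=; apply: Gfun.
Qed.

Lemma compact_extension (A : lmodType R) (f : {linear A -> B}) (g : {linear A -> M}) :
  pure f -> exists h : {linear B -> M}, forall a, h (f a) = g a.
Proof.
move=> pf.
pose G0 : set (B * M) := [set z | exists a, z = (f a, g a)].
have G0P : pp_graph G0.
  split.
    split; first by exists 0; rewrite !raddf0.
    move=> c _ _ [x ->] [y ->]; exists (c *: x + y).
    by rewrite -[LHS]/(c *: f x + f y, c *: g x + g y) !linearP.
  move=> m n D p /choice[a pa] sol.
  have -> : snd \o p = g \o a by apply/funext => i /=; rewrite pa.
  apply/solvable_lin/pf; move: sol; congr solvable.
  by apply/funext => i /=; rewrite pa.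
have [h hP] := pp_graph_extension G0P.
by exists h => a; apply: (hP (f a, g a)); exists a.
Qed.

End CompactExtension.

Lemma algebraically_compact_pure_injective M : algebraically_compact M -> pure_injective M.
Proof.
move=> acM A B f g /pure_embeddingP[f' f'E pf].
have [h hP] := compact_extension acM g pf.
by exists h => a; rewrite -f'E.
Qed.

Lemma pure_injective_compact M : pure_injective M -> algebraically_compact M.
Proof. by move=> /pure_injective_has_limits/has_limits_algebraically_compact. Qed.

Lemma pure_injective_extend M (A B : lmodType R) (f : {linear A -> B}) (g : {linear A -> M}) :
  pure_injective M -> pure f -> exists h : {linear B -> M}, forall a, h (f a) = g a.
Proof. by move=> piM pf; apply/piM/pure_embedding_pack. Qed.

Lemma pure_injective_retract M N (f : {linear N -> M}) (r : {linear M -> N}) :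
  cancel f r -> pure_injective M -> pure_injective N.
Proof.
move=> rf piM A B i g pi.
have [h hP] := piM A B i (f \o g : {linear A -> M}) pi.
by exists (r \o h : {linear B -> N}) => a /=; rewrite hP /= rf.
Qed.

(** ** The descending chain condition on pp subgroups *)
(** The descending chain condition fails: the intersections of the subgroups defined by
    psi 0, ..., psi n decrease strictly, as a n witnesses. *)
Definition unstable_chain M : Prop :=
  exists (psi : nat -> formula) (a : nat -> M),
    (forall m n, (m <= n)%N -> holds (psi m) (fun _ => 0) (a n)) /\
    (forall n, ~ holds (psi n.+1) (fun _ => 0) (a n)).

Lemma unstable_chain_pure M N (f : {linear N -> M}) : pure f -> unstable_chain N -> unstable_chain M.
Proof.
move=> pf [psi [a [a1 a2]]]; exists psi, (f \o a).
have E : (fun _ : nat => 0 : M) = f \o (fun _ => 0) by apply/funext => i /=; rewrite raddf0.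
split=> [m n mn|n]; rewrite E; first exact/holds_lin/a1.
by move=> /(holds_pure pf)/a2.
Qed.

(** By the chain condition a finite subsystem s defines a coset of the least possible
    subgroup. A solution x of s satisfies any other formula phi: it differs from a solution of
    s and phi by an element of that subgroup. *)
Lemma dcc_algebraically_compact M : ~ unstable_chain M -> algebraically_compact M.
Proof.
move=> dcc dom p fin.
pose V (s : seq formula) (x : M) := forall phi, List.In phi s -> dom phi -> holds phi (fun _ => 0) x.
have [s sP] : exists s, forall phi x, dom phi -> V s x -> holds phi (fun _ => 0) x.
  apply: contrapT => none; apply: dcc.
  have /choice[next nextP] : forall s, exists z : formula * M,
      [/\ dom z.1, V s z.2 & ~ holds z.1 (fun _ => 0) z.2].
    move=> s; apply: contrapT => nos; apply: none; exists s => phi x dphi Vx.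
    by apply: contrapT => nh; apply: nos; exists (phi, x).
  pose fix S n := if n is n'.+1 then (next (S n')).1 :: S n' else [::].
  have Sin m n : (m < n)%N -> List.In (next (S m)).1 (S n).
    elim: n => // n IH; rewrite ltnS leq_eqVlt => /orP[/eqP ->|/IH]; first by left.
    by right.
  exists (fun n => if n is n'.+1 then (next (S n')).1 else Formula (0 : 'M_(0, 0)) 0).
  exists (fun n => (next (S n)).2); split=> [[|m] n mn|n].
  - by exists 0; apply/funext => -[].
  - by have [_ Vn _] := nextP (S n); apply: Vn; [apply: Sin|have [] := nextP (S m)].
  - by have [] := nextP (S n).
have [x xP] := fin s; exists x => phi dphi.
have [y yP] := fin (phi :: s).
have Vyx : V s (x - y).
  move=> psi psis dpsi; have h1 := xP psi psis dpsi; have h2 := yP psi (or_intror psis) dpsi.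
  have := solvableB h1 h2; congr solvable; apply/funext => i.
  by rewrite [LHS]/GRing.add /= [X in _ + X]/GRing.opp /= opprD addrACA subrr addr0 -scalerBr addr0.
have hy := yP phi (or_introl erefl) dphi.
have := solvableD (sP phi _ dphi Vyx) hy; congr solvable; apply/funext => i.
by rewrite [LHS]/GRing.add /= addr0 addrA -scalerDr subrK.
Qed.

(** If the countable direct sum is pure injective, retracting the product onto
    it turns an infinite strictly descending chain into an element of infinite support. *)
Lemma sum_pure_injective_dcc M : pure_injective (direct_sum nat M) -> ~ unstable_chain M.
Proof.
move=> piS [psi [a [a1 a2]]].
have pf : pure (@ds_fun R nat M).
  move=> m n D p [y Dy].
  have /choice[ss ssP] : forall i, exists s, forall j, ds_coord j (p i) != 0 -> List.In j s.
    by move=> i; apply: ds_list.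
  pose S j := [exists i, ds_coord j (p i) != 0].
  have /choice[y' y'E] : forall k, exists g : direct_sum nat M, forall j,
      ds_coord j g = if S j then y k j else 0.
    move=> k; apply: (@ds_make_list _ _ _ _ (flatten (map ss (enum 'I_m)))) => j.
    case: ifP => [/existsP[i /ssP jin] _|_]; last by rewrite eqxx.
    exact: In_flatten jin.
  exists y'; apply/funext => i; apply: ds_ext => j.
  rewrite -[LHS]/((ds_coord j \o mxact D y') i) -mxact_lin.
  have pij : ds_coord j (p i) = \sum_k D i k *: y k j.
    by have := congr1 (fun g => g i j) Dy; rewrite /mxact fct_sumE => /esym.
  rewrite /mxact /=; case Sj : (S j).
    by rewrite pij; apply: eq_bigr => k _; rewrite y'E Sj.
  rewrite big1 => [|k _]; last by rewrite y'E Sj scaler0.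
  by apply/esym/eqP; have /existsPn/(_ i) := negbT Sj; rewrite negbK.
have [r rP] := @pure_injective_extend _ _ _ (@ds_fun R nat M : {linear _ -> _}) idfun piS pf.
pose x := r a.
have [s xs] := ds_list x.
(* the sequence a is cut after an index n beyond the support of r a *)
pose n := (\max_(i <- s) i).+1.
have xn : ds_coord n x = 0.
  by apply/eqP; case: eqP => // /eqP /xs /leq_max_list; rewrite ltnn.
case: (a2 n); have -> : a n = a n - ds_coord n x by rewrite xn subr0.
(* a - t satisfies psi n.+1 in the product, hence so does r a - t in the sum *)
pose t : direct_sum nat M := \sum_(i < n.+1) ds_delta (nat_of_ord i) (a i).
have tn : ds_coord n t = a n.
  rewrite raddf_sum big_ord_recr /= ds_delta_eq big1 ?add0r // => i _.
  by rewrite ds_delta_neq // => E; have := ltn_ord i; rewrite -E ltnn.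
have tj j : (j <= n)%N -> ds_coord j t = a j.
  move=> jn; rewrite raddf_sum (bigD1 (inord j)) //= inordK // ds_delta_eq big1 ?addr0 // => i ij.
  rewrite ds_delta_neq // => E; move: ij; rewrite -val_eqE /= inordK // E eqxx //.
have t0 j : (n < j)%N -> ds_coord j t = 0.
  move=> nj; rewrite raddf_sum big1 // => i _ /=; rewrite ds_delta_neq // => E.
  by have := ltn_ord i; rewrite -E ltnS leqNgt nj.
have : holds (psi n.+1) (fun _ => 0) (a - ds_fun t).
  have /choice[w wP] : forall j, exists w, mxact (fmx (psi n.+1)) w =
     (fun i => fvar (psi n.+1) i 0 *: (a - ds_fun t) j + 0).
    move=> j; have -> : (a - ds_fun t) j = a j - ds_coord j t by [].
    have [jn|nj] := leqP j n.
      rewrite tj // subrr; exists 0; rewrite mxact0; apply/funext => i.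
      by rewrite scaler0 addr0.
    rewrite t0 // subr0; exact: a1.
  exists (fun k j => w j k); apply/funext => i; apply/funext => j.
  by rewrite /mxact fct_sumE; have /= := congr1 (@^~ i) (wP j).
have rt : r (ds_fun t) = t := rP t.
move=> /(holds_lin r); rewrite raddfB /= rt.
move=> /(holds_lin (ds_coord n : {linear direct_sum nat M -> M})).
rewrite raddfB /= tn -/x => /solvableN; congr solvable; apply/funext => i.
by rewrite -[LHS]/(- (fvar (psi n.+1) i 0 *: (ds_coord n x - a n) + ds_coord n (r 0))) !raddf0 !addr0 -scalerN opprB.
Qed.

End PureInjective.


(** * Characters *)

Definition divisible (T : zmodType) : Prop := forall n (t : T), (0 < n)%N -> exists u, u *+ n = t.

Lemma subgroup_mulrn (V : zmodType) (S : set V) : is_subgroup S -> forall x n, S x -> S (x *+ n).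
Proof.
move=> subS x n Sx; elim: n => [|n IH]; first exact: subgroup0.
by rewrite mulrS; apply: subgroupD.
Qed.

Lemma subgroup_mulrz (V : zmodType) (S : set V) : is_subgroup S -> forall x (k : int), S x -> S (x *~ k).
Proof.
move=> subS x [n|n] Sx; first exact: subgroup_mulrn.
by apply: subgroupN => //; apply: subgroup_mulrn.
Qed.

Lemma int_division (k : int) n : (0 < n)%N ->
  exists q r, k = q * n%:Z + (r : nat)%:Z /\ (r < n)%N.
Proof.
move=> n_gt0; exists (k %/ n)%Z, `|(k %% n)%Z|%N.
have n0Z : n%:Z != 0 by rewrite -lt0n.
rewrite abszE ger0_norm ?modz_ge0 // -divz_eq; split=> //.
by rewrite -ltz_nat abszE ger0_norm ?modz_ge0 // ltz_mod.
Qed.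

Section DivisibleExtension.
Variables (B T : zmodType) (divT : divisible T).

Definition function_graph (G : set (B * T)) : Prop :=
  is_subgroup G /\ forall t, G (0, t) -> t = 0.

Lemma function_graph_bigcup (F : set (set (B * T))) :
  F `<=` function_graph -> total_on F subset -> F !=set0 -> function_graph (\bigcup_(X in F) X).
Proof.
move=> FG totF nF; split.
  split.
    by have [X FX] := nF; exists X => //; have [/subgroup0] := FG _ FX.
  move=> x y Ux Uy; have [X FX [Xx Xy]] := chain_pair totF Ux Uy.
  by exists X => //; have [subX _] := FG _ FX; apply: subgroupB.
by move=> t [X FX]; have [_] := FG _ FX; apply.
Qed.

Lemma pair_mulrz (b : B) (y : T) (k : int) : (b, y) *~ k = (b *~ k, y *~ k).
Proof.
have E n : (b, y) *+ n = (b *+ n, y *+ n) by elim: n => // n IH; rewrite !mulrS IH.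
by case: k => n; rewrite ?NegzE ?mulrNz -?pmulrn E.
Qed.

(** If no multiple of b is in the domain, the value at b is free. Otherwise the least multiple
    b *+ n in the domain generates all others, and any n-th part of its value will do. *)
Lemma function_graph_step (G : set (B * T)) (b : B) : function_graph G ->
  exists y G', [/\ function_graph G', G `<=` G' & G' (b, y)].
Proof.
move=> [subG funG].
have [y yP] : exists y, forall (k : int) s, G (b *~ k, s) -> s = y *~ k.
  pose P n := `[< (0 < n)%N /\ exists t, G (b *+ n, t) >].
  have [[n0 Pn0]|noP] := pselect (exists n, P n); last first.
    exists 0 => k s Gs; rewrite mul0rz; case: (eqVneq k 0) => [k0|k0].
      by apply: funG; move: Gs; rewrite k0 mulr0z.
    case: noP; exists `|k|%N; apply/asboolP; split; first by rewrite absz_gt0.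
    case: k k0 Gs => n _ Gs /=; first by exists s.
    exists (- s); rewrite -[b *+ _]opprK.
    have := subgroupN subG Gs; congr G; by rewrite -[LHS]/(- (- (b *+ n.+1)), - s).
  case: (ex_minnP (ex_intro P n0 Pn0)) => n /asboolP[n_gt0 [t Gt]] nmin.
  have [y yt] := divT t n_gt0.
  exists y => k s Gs.
  have [q [r [kE rn]]] := int_division k n_gt0.
  have Gtq : G ((b *+ n) *~ q, t *~ q) by rewrite -pair_mulrz; apply: subgroup_mulrz.
  have Gr : G (b *+ r, s - t *~ q).
    have := subgroupB subG Gs Gtq; congr G.
    rewrite -[LHS]/(b *~ k - (b *+ n) *~ q, s - t *~ q); congr pair.
    rewrite kE mulrzDr -[b *+ n]/(b *~ n%:Z) -mulrzA [n%:Z * _]mulrC.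
    by rewrite addrC addKr.
  have r0 : r = 0%N.
    apply/eqP; case: (posnP r) => // r_gt0.
    have /nmin : P r by apply/asboolP; split=> //; exists (s - t *~ q).
    by rewrite leqNgt rn.
  move: Gr; rewrite r0 mulr0n => /funG/eqP; rewrite subr_eq0 => /eqP ->.
  by rewrite kE r0 addr0 -yt -[y *+ n]/(y *~ n%:Z) -mulrzA mulrC.
pose G' : set (B * T) := [set z | exists g (k : int), G g /\ z = g + (b, y) *~ k].
exists y, G'; split.
- split.
    split; first by exists 0, 0; split; [exact: subgroup0|rewrite mulr0z addr0].
    move=> _ _ [g [k [Gg ->]]] [g' [k' [Gg' ->]]].
    exists (g - g'), (k - k'); split; first exact: subgroupB.
    by rewrite mulrzBr opprD addrACA.
  move=> t [[g1 g2] [k [Gg E]]].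
  have [E1 E2] : 0 = g1 + b *~ k /\ t = g2 + y *~ k.
    by move: E; rewrite pair_mulrz => -[].
  have : G (b *~ (- k), g2).
    by rewrite mulrNz; have /eqP := esym E1; rewrite addr_eq0 => /eqP <-.
  by move=> /yP g2E; rewrite E2 g2E mulrNz addNr.
- by move=> g Gg; exists g, 0; rewrite mulr0z addr0.
- by exists 0, 1; split; [exact: subgroup0|rewrite mulr1z add0r].
Qed.

Lemma divisible_extension (G0 : set (B * T)) : function_graph G0 ->
  exists h : {additive B -> T}, forall z, G0 z -> h z.1 = z.2.
Proof.
move=> G0P; have [G [fgG G0G maxG]] := maximal_extension G0P function_graph_bigcup.
have [subG funG] := fgG.
have /choice[h hP] : forall b, exists y, G (b, y).
  move=> b; have [y [G' [fgG' GG' G'by]]] := function_graph_step b fgG.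
  by exists y; rewrite -(maxG G').
have Gfun b y y' : G (b, y) -> G (b, y') -> y = y'.
  move=> Gy Gy'; apply/eqP; rewrite -subr_eq0; apply/eqP/funG.
  by have := subgroupB subG Gy Gy'; congr G; rewrite -[LHS]/(b - b, y - y') subrr.
have ah : zmod_morphism h.
  move=> x y; apply: (Gfun (x - y)) => //.
  exact: (subgroupB subG (hP x) (hP y)).
by exists (additive_pack ah) => -[b y] /G0G /=; apply: Gfun.
Qed.

End DivisibleExtension.

Lemma divisible_limit (T : zmodType) (I : Type) (le : I -> I -> Prop) : divisible T -> directed le ->
  exists lim : {additive (I -> T) -> T}, (forall c, lim (fun _ => c) = c) /\
    (forall f i0, (forall i, le i0 i -> f i = 0) -> lim f = 0).
Proof.
move=> divT [[i0] rle tle ub].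
pose G0 : set ((I -> T) * T) := [set z | exists i0, forall i, le i0 i -> z.1 i = z.2].
have [|lim limP] := @divisible_extension _ _ divT G0.
  split.
    split; first by exists i0.
    move=> [f c] [g d] [i fc] [j gd]; have [k [ik jk]] := ub i j.
    exists k => l kl.
    have /= fl := fc l (tle _ _ _ ik kl); have /= gl := gd l (tle _ _ _ jk kl).
    by rewrite -[LHS]/(f l - g l) -[RHS]/(c - d) fl gl.
  by move=> t [i it]; have /= <- := it i (rle i).
exists lim; split=> [c|f i f0].
  by apply: (limP ((fun _ => c), c)); exists i0.
by apply: (limP (f, 0)); exists i.
Qed.

(** The group is Q / Z, with the classes of 1 / n as torsion elements. *)
Lemma rational_circle : exists T : zmodType, divisible T /\
  forall n, (1 < n)%N -> exists2 t : T, t != 0 & t *+ n = 0.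
Proof.
pose S : set rat := [set x | x \is a Num.int].
have subS : is_subgroup S.
  by split; [rewrite /S /= rpred0|move=> x y Sx Sy; rewrite /S /= rpredB].
have [T [pi [pisurj piker]]] := quotient_group subS.
exists T; split=> [n t n0|n n1].
  have [x <-] := pisurj t; exists (pi (x / n%:R)).
  by rewrite -raddfMn -[_ / _ *+ n]mulr_natr divfK // pnatr_eq0 -lt0n.
exists (pi n%:R^-1).
  apply/eqP => /piker; rewrite /S /= => /intrP[m mE].
  have n0 : (n%:R : rat) != 0 by rewrite pnatr_eq0 -lt0n ltnW.
  have : (m * n%:Z)%:~R = 1%:~R :> rat by rewrite intrM -mE -[n%:Z%:~R]/(n%:R) mulVf.
  move=> /intr_inj /(congr1 absz); rewrite abszM absz_nat => /eqP.
  by rewrite muln_eq1 => /andP[_ /eqP n1E]; rewrite n1E in n1.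
rewrite -raddfMn -[_^-1 *+ n]mulr_natr mulVf ?pnatr_eq0 -?lt0n 1?ltnW //.
by apply/piker; rewrite /S /= rpred1.
Qed.

(** The value t at p is chosen so that it is killed by the multiples of the order of p
    modulo S. *)
Lemma character_separates (T V : zmodType) (S : set V) p :
  divisible T -> (forall n, (1 < n)%N -> exists2 t : T, t != 0 & t *+ n = 0) ->
  is_subgroup S -> ~ S p ->
  exists chi : {additive V -> T}, (forall x, S x -> chi x = 0) /\ chi p <> 0.
Proof.
move=> divT torT subS Sp.
have [t t0 tP] : exists2 t : T, t != 0 & forall k : int, S (p *~ k) -> t *~ k = 0.
  pose P n := `[< (0 < n)%N /\ S (p *+ n) >].
  have SE (k : int) : S (p *~ k) -> S (p *+ `|k|%N).
    by case: k => n //; rewrite NegzE mulrNz => /(subgroupN subS); rewrite opprK.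
  have [[n0 Pn0]|noP] := pselect (exists n, P n); last first.
    have [t t0 _] := torT 2%N isT; exists t => // k Sk.
    have [->|k0] := eqVneq k 0; first by rewrite mulr0z.
    by case: noP; exists `|k|%N; apply/asboolP; rewrite absz_gt0 k0; split=> //; apply: SE.
  case: (ex_minnP (ex_intro P n0 Pn0)) => n /asboolP[n_gt0 Sn] nmin.
  have n1 : (1 < n)%N.
    by case: n n_gt0 Sn {nmin} => [//|[|//]] _; rewrite mulr1n.
  have [t t0 tn] := torT n n1; exists t => // k Sk.
  have [q [r [kE rn]]] := int_division k n_gt0.
  have Sr : S (p *+ r).
    have := subgroupB subS Sk (subgroup_mulrz subS q Sn); congr S.
    rewrite kE mulrzDr -[p *+ n]/(p *~ n%:Z) -mulrzA [n%:Z * _]mulrC.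
    by rewrite addrC addKr.
  have r0 : r = 0%N.
    apply/eqP; case: (posnP r) => // r_gt0.
    have /nmin : P r by apply/asboolP.
    by rewrite leqNgt rn.
  by rewrite kE r0 addr0 mulrC mulrzA -[t *~ n%:Z]/(t *+ n) tn mul0rz.
pose G0 : set (V * T) := [set z | exists s (k : int), S s /\ z = (s + p *~ k, t *~ k)].
have [|chi chiP] := @divisible_extension _ _ divT G0.
  split.
    split; first by exists 0, 0; split; [exact: subgroup0|rewrite !mulr0z addr0].
    move=> _ _ [s [k [Ss ->]]] [s' [k' [Ss' ->]]].
    exists (s - s'), (k - k'); split; first exact: subgroupB.
    by rewrite -[LHS]/(s + p *~ k - (s' + p *~ k'), t *~ k - t *~ k') !mulrzBr opprD addrACA.
  move=> u [s [k [Ss [E ->]]]]; apply: tP.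
  have /eqP := esym E; rewrite addrC addr_eq0 => /eqP ->.
  exact: subgroupN.
exists chi; split=> [x Sx|].
  by apply: (chiP (x, 0)); exists x, 0; rewrite !mulr0z addr0.
have -> : chi p = t.
  by apply: (chiP (p, t)); exists 0, 1; rewrite !mulr1z add0r; split=> //; exact: subgroup0.
exact/eqP.
Qed.

Section HomGroup.
Variables V T : zmodType.
Definition hom_pred : {pred V -> T} := fun f => `[< zmod_morphism f >].
Fact hom_pred_closed : zmod_closed hom_pred.
Proof.
split=> [|f g /asboolP fP /asboolP gP]; apply/asboolP => x y.
  by rewrite -[LHS]/0 -[RHS]/(0 - 0) subr0.
by rewrite -[LHS]/(f (x - y) - g (x - y)) -[RHS]/(f x - g x - (f y - g y)) fP gP !opprD addrACA.
Qed.
HB.instance Definition _ := GRing.isZmodClosed.Build (V -> T) hom_pred hom_pred_closed.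
Definition hom_group : Type := {f : V -> T | f \in hom_pred}.
HB.instance Definition _ := SubType.on hom_group.
HB.instance Definition _ := [Choice of hom_group by <:].
HB.instance Definition _ := [SubChoice_isSubZmodule of hom_group by <:].

Lemma hom_additive (f : hom_group) : zmod_morphism (val f).
Proof. exact: (asboolW (valP f)). Qed.
Definition hom_fun (f : hom_group) : {additive V -> T} := additive_pack (hom_additive f).
Definition hom_make (f : {additive V -> T}) : hom_group :=
  exist _ (f : V -> T) (asboolT (raddfB f)).
End HomGroup.

Section Bidual.
Variables (R : nzRingType) (M : lmodType R) (T : zmodType).
Local Notation C := (hom_group M T).

(** The characters of M form a right module, whose scalar action is only needed to define
    the one on the second dual. *)
Definition character_act (r : R) (chi : C) : C :=
  hom_make (hom_fun chi \o ( *:%R r : M -> M) : {additive M -> T}).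

Lemma hom_ext (V U : zmodType) (f g : hom_group V U) : hom_fun f =1 hom_fun g -> f = g.
Proof. by move=> fg; apply/val_inj/funext/fg. Qed.

Definition bidual : Type := hom_group C T.
HB.instance Definition _ := GRing.Zmodule.on bidual.

Fact bidual_scale_additive (r : R) (xi : bidual) :
  zmod_morphism (fun chi => hom_fun xi (character_act r chi)).
Proof.
move=> x y; rewrite -raddfB; congr (hom_fun xi _).
exact: hom_ext.
Qed.
Definition bidual_scale (r : R) (xi : bidual) : bidual :=
  hom_make (additive_pack (bidual_scale_additive r xi)).

Fact bidual_scaleA a b (v : bidual) : bidual_scale a (bidual_scale b v) = bidual_scale (a * b) v.
Proof.
apply: hom_ext => chi.
rewrite -[LHS]/(hom_fun v (character_act b (character_act a chi))).
rewrite -[RHS]/(hom_fun v (character_act (a * b) chi)).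
by congr (hom_fun v _); apply: hom_ext => x /=; rewrite scalerA.
Qed.
Fact bidual_scale1 : left_id 1 bidual_scale.
Proof.
move=> v; apply: hom_ext => chi; rewrite -[LHS]/(hom_fun v (character_act 1 chi)).
by congr (hom_fun v _); apply: hom_ext => x /=; rewrite scale1r.
Qed.
Fact bidual_scaleDr : right_distributive bidual_scale +%R.
Proof. by move=> a u v; apply: hom_ext => chi. Qed.
Fact bidual_scaleDl v : {morph bidual_scale^~ v : a b / a + b}.
Proof.
move=> a b; apply: hom_ext => chi.
rewrite -[LHS]/(hom_fun v (character_act (a + b) chi)).
rewrite -[RHS]/(hom_fun v (character_act a chi) + hom_fun v (character_act b chi)) -raddfD.
congr (hom_fun v _); apply: hom_ext => x /=.
by rewrite -[RHS]/(hom_fun chi (a *: x) + hom_fun chi (b *: x)) -raddfD -scalerDl.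
Qed.
HB.instance Definition _ := GRing.Zmodule_isLmodule.Build R bidual
  bidual_scaleA bidual_scale1 bidual_scaleDr bidual_scaleDl.

Fact bidual_ev_additive (x : M) : zmod_morphism (fun chi : C => hom_fun chi x).
Proof. by []. Qed.
Definition bidual_ev (x : M) : bidual := hom_make (additive_pack (bidual_ev_additive x)).

Lemma bidual_ev_linear : linear bidual_ev.
Proof.
move=> a x y; apply: hom_ext => chi.
rewrite -[RHS]/(hom_fun chi (a *: x) + hom_fun chi y).
by rewrite -raddfD.
Qed.

(** Limits are taken in T, character by character. *)
Lemma bidual_has_limits : divisible T -> has_limits (bidual : lmodType R).
Proof.
move=> divT I le dle; have [lim [limc lim0]] := divisible_limit divT dle.
have H (f : I -> bidual) : zmod_morphism (fun chi : C => lim (fun i => hom_fun (f i) chi)).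
  move=> x y; rewrite -raddfB; congr (lim _); apply/funext => i; exact: raddfB.
pose L (f : I -> bidual) : bidual := hom_make (additive_pack (H f)).
have lL : linear L.
  move=> a f g; apply: hom_ext => chi.
  rewrite -[RHS]/(lim (fun i => hom_fun (f i) (character_act a chi)) + lim (fun i => hom_fun (g i) chi)).
  by rewrite -raddfD.
exists (linear_pack lL); split=> [c|f i0 f0]; apply: hom_ext => chi; rewrite -[LHS]/(lim _).
  exact: limc.
by apply: (lim0 _ i0) => i /f0 ->.
Qed.

(** If D y = p has no solution in M, some character of M^m vanishes on the solvable
    right-hand sides but not at p. Its components c_i satisfy that the sum of the c_i D_ij is
    0 for all j, so that a solution in the second dual would make it vanish at p. *)
Lemma bidual_ev_pure : divisible T ->
  (forall n, (1 < n)%N -> exists2 t : T, t != 0 & t *+ n = 0) ->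
  pure (bidual_ev : M -> (bidual : lmodType R)).
Proof.
move=> divT torT m n D p [y yE]; apply: contrapT => nsol.
pose S : set ('I_m -> M) := [set q | solvable D q].
have subS : is_subgroup S by split; [exact: solvable0|move=> *; apply: solvableB].
have [chi [chi0 chip]] := character_separates divT torT subS nsol.
pose dl (i : 'I_m) (x : M) : 'I_m -> M := fun k => if k == i then x else 0.
have dlB i : zmod_morphism (fun x => chi (dl i x)).
  move=> u v; rewrite -raddfB; congr (chi _); apply/funext => k.
  rewrite -[RHS]/(dl i u k - dl i v k) /dl; by case: ifP => // _; rewrite subr0.
pose c i : C := hom_make (additive_pack (dlB i)).
have dl_sum (q : 'I_m -> M) : q = \sum_i dl i (q i).
  apply/funext => k; rewrite fct_sumE (bigD1 k) //= big1 ?addr0 /dl ?eqxx //.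
  by move=> i ik; rewrite eq_sym (negbTE ik).
apply: chip; rewrite [p]dl_sum raddf_sum.
transitivity (\sum_i hom_fun (bidual_ev (p i)) (c i)); first by [].
transitivity (\sum_i \sum_j hom_fun (y j) (character_act (D i j) (c i))).
  apply: eq_bigr => i _; have <- : mxact D y i = bidual_ev (p i) by rewrite yE.
  rewrite /mxact; elim/big_ind2: _ => // _ a _ b <- <-; by [].
rewrite exchange_big /= big1 // => j _.
rewrite -[LHS](raddf_sum (hom_fun (y j))).
rewrite (_ : \sum_i _ = 0) ?raddf0 //; apply: hom_ext => x.
have E : hom_fun (\sum_i character_act (D i j) (c i)) x = \sum_i chi (dl i (D i j *: x)).
  elim/big_ind2: _ => // a b a' b' Ea Eb.
  by rewrite -Ea -Eb.
rewrite E -raddf_sum; apply: chi0.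
exists (fun k => if k == j then x else 0); apply/funext => i.
have := congr1 (@^~ i) (dl_sum (fun i => D i j *: x)) => <- /=.
rewrite /mxact (bigD1 j) //= eqxx big1 ?addr0 // => k kj.
by rewrite (negbTE kj) scaler0.
Qed.

End Bidual.

Lemma pure_injective_extension (R : nzRingType) (M : lmodType R) :
  exists (N : lmodType R) (f : {linear M -> N}), pure_injective N /\ pure f.
Proof.
have [T [divT torT]] := rational_circle.
exists (bidual M T), (linear_pack (@bidual_ev_linear R M T)); split.
  exact/algebraically_compact_pure_injective/has_limits_algebraically_compact/bidual_has_limits.
exact: bidual_ev_pure.
Qed.

(** * Pure-injective envelopes *)
Section Envelope.
Variables (R : nzRingType) (M N : lmodType R) (e0 : {linear M -> N}).
Hypotheses (piN : pure_injective N) (pe0 : pure e0).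

Let fixes (B : set N) (f : {linear N -> N}) : Prop := forall b, B b -> f b = b.

(** The submodules on which no endomorphism of N over M makes new systems solvable. The
    envelope of M will be a maximal one. *)
Let rigid (B : set N) : Prop :=
  is_submod B /\ forall f : {linear N -> N}, fixes (range e0) f ->
    forall m n (D : 'M[R]_(m, n)) p, (forall i, B (p i)) -> solvable D (f \o p) -> solvable D p.

Let rigid_bigcup (F : set (set N)) :
  F `<=` rigid -> total_on F subset -> F !=set0 -> rigid (\bigcup_(X in F) X).
Proof.
move=> FG totF nF; split; first by apply: submod_bigcup => // X /FG[].
move=> f ff m n D p Up; have [X FX Xp] := chain_tuple totF nF Up.
by have [_ /(_ f ff)] := FG _ FX; apply.
Qed.

Let rigid_base : rigid (range e0).
Proof.
split; first exact: range_submod.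
move=> f ff m n D p pM; congr solvable.
by apply/funext => i /=; apply: ff.
Qed.

(** Zorn's lemma for endomorphisms over B ordered by the systems that they make solvable;
    a chain is bounded by its limit, which exists since N is pure injective. *)
Let maximal_endo (B : set N) : exists2 f : {linear N -> N}, fixes B f &
  forall g : {linear N -> N}, fixes B g ->
  (forall m n (D : 'M[R]_(m, n)) p, solvable D (f \o p) -> solvable D (g \o p)) ->
  forall m n (D : 'M[R]_(m, n)) p, solvable D (g \o p) -> solvable D (f \o p).
Proof.
pose X := {f : {linear N -> N} | fixes B f}.
pose le (f g : X) : Prop := forall m n (D : 'M[R]_(m, n)) p,
  solvable D (sval f \o p) -> solvable D (sval g \o p).
pose leb (f g : X) := `[< le f g >].
have id0 : X by exists (idfun : {linear N -> N}).
have [|||f fmax] := @ZL_preorder X id0 leb.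
- by move=> f; apply/asboolP.
- by move=> g f h /asboolP fg /asboolP gh; apply/asboolP => m n D p /fg/gh.
- move=> A totA; have [[a0 Aa0]|noA] := pselect (exists a, A a); last first.
    by exists id0 => s As; case: noA; exists s.
  pose I := {a : X | A a}.
  have dle : directed (fun i j : I => le (sval i) (sval j)).
    split=> [|i m n D p //|i j k ij jk m n D p /ij/jk //|i j].
      by exists; exists a0.
    have [/asboolP ij|/asboolP ji] := totA _ _ (svalP i) (svalP j).
      by exists j; split.
    by exists i; split.
  have [lim limP] := pure_injective_has_limits piN dle.
  pose u x := lim (fun i : I => sval (sval i) x).
  have lu : linear u.
    move=> a x y; rewrite /u -linearP; congr (lim _); apply/funext => i.
    by rewrite linearP.
  have fu : fixes B (linear_pack lu).
    move=> b Bb /=; rewrite /u.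
    have -> : (fun i : I => sval (sval i) b) = (fun _ => b).
      by apply/funext => i; apply: (svalP (sval i)).
    by case: limP.
  exists (exist _ (linear_pack lu) fu) => s As; apply/asboolP => m n D p sp.
  apply: (limit_solvable (i0 := exist _ s As) limP (p := fun j i => sval (sval i) (p j))).
  by move=> i si; apply: si.
exists (sval f); first exact: (svalP f).
move=> g fg fgle m n D p sg; have /asboolP := fmax (exist _ g fg) (asboolT fgle).
by apply.
Qed.

(** Let B be a maximal rigid submodule and f an endomorphism over B as in
    [maximal_endo]. If g is an endomorphism over M, then g reflects solvability
    on B, so k (g b) = b on B for some endomorphism k, and maximality of f makes
    g reflect solvability on f(N). So f(N) is rigid, hence equal to B, and f is a
    retraction of N onto B. Rigidity then makes the comparison maps to other
    pure-injective extensions pure. *)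
Lemma envelope_in : exists (E : lmodType R) (e : {linear M -> E}), is_pure_injective_envelope e.
Proof.
have [B [[subB rigB] MB maxB]] := maximal_extension rigid_base rigid_bigcup.
have [f fB fmax] := maximal_endo B.
have rigf : rigid (range f).
  split; first exact: range_submod.
  move=> g gM m n D p pf sg.
  have [k kP] : exists k : {linear N -> N}, forall b, B b -> k (g b) = b.
    pose G0 : set (N * N) := [set z | exists2 b, B b & z = (g b, b)].
    have [|k kP] := @pp_graph_extension _ N N (pure_injective_compact piN) G0.
      split.
        split; first by exists 0; [exact: submod0|rewrite !raddf0].
        move=> a _ _ [x Bx ->] [y By ->]; exists (a *: x + y); first by case: subB => _; apply.
        by rewrite -[LHS]/(a *: g x + g y, a *: x + y) linearP.
      move=> m' n' D' q Gq sq.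
      have qE : fst \o q = g \o (snd \o q).
        by apply/funext => i /=; have [b _ ->] := Gq i.
      by apply: (rigB g gM) => [i|]; [have [b Bb /= ->] := Gq i|rewrite -qE].
    by exists k => b Bb; apply: (kP (g b, b)); exists b.
  have fixk : fixes B (k \o g \o f : {linear N -> N}) by move=> b Bb /=; rewrite fB // kP.
  have /choice[q qE] : forall i, exists q, f q = p i by move=> i; have [q _ <-] := pf i; exists q.
  have fq : f \o q = p by apply/funext.
  rewrite -fq; apply: (fmax _ fixk) => [m' n' D' p' sp|].
    exact: (solvable_lin (k \o g : {linear N -> N}) sp).
  have := solvable_lin k sg; rewrite -fq; by [].
have fE : range f = B.
  by apply: maxB => // b Bb; exists b => //; apply: fB.
have [E [i [inji iB]]] := submod_of_set_incl subB.
have [|r rP] := linear_factor (t := f) inji.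
  by move=> x; apply/iB; rewrite -fE; exists x.
have ri : cancel i r.
  by move=> y; apply: inji; rewrite rP fB //; apply/iB; exists y.
have [|e pe eP] := pure_factor inji pe0.
  by move=> x; apply/iB/MB; exists x.
exists E, e; split.
- exact: pure_injective_retract ri piN.
- exact: pure_embedding_pack.
move=> N' g0 piN' /pure_embeddingP[g <- pg].
have [h hP] := pure_injective_extend g piN' pe.
have [k kP] := pure_injective_extend e0 piN pg.
exists h => //; apply: pure_embedding_pack => m n D p sp.
pose F : {linear N -> N} := k \o h \o r.
have FM : fixes (range e0) F.
  by move=> _ [x _ <-]; rewrite /F /= -eP ri hP kP eP.
have iF : F \o (i \o p) = k \o (h \o p).
  by apply/funext => j; rewrite /F /= ri.
have : solvable D (i \o p).
  apply: (rigB F FM) => [j|]; first by apply/iB; exists (p j).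
  by rewrite iF; apply: solvable_lin.
move=> /(solvable_lin r); congr solvable.
by apply/funext => j; rewrite /= ri.
Qed.

End Envelope.

Theorem envelope_exists (R : nzRingType) (M : lmodType R) :
  exists (E : lmodType R) (e : {linear M -> E}), is_pure_injective_envelope e.
Proof.
have [N [f [piN pf]]] := pure_injective_extension M.
exact: envelope_in piN pf.
Qed.


(** * Cardinal arithmetic *)

Lemma sval_inj (A : Type) (P : A -> Prop) : injective (@proj1_sig A P).
Proof. by move=> [x Px] [y Py] /= xy; subst y; rewrite (Prop_irrelevance Px Py). Qed.

Definition embeds (A B : Type) : Prop := exists f : A -> B, injective f.

Lemma cleP (A B : cardinal) : cle A B <-> embeds A B.
Proof.
split=> [/card_leP[f]|[f injf]].
  exists (fun x => val (f (exist _ x (in_setT x)))) => x y /val_inj.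
  by move=> /(@inj _ _ _ f _ _ (in_setT _) (in_setT _)) [].
have /card_eqPle[_ /card_le_trans] : f @` [set: A] #= [set: A] by apply: inj_card_eq => x y _ _ /injf.
by apply; apply: card_leT.
Qed.

Lemma ceqP (A B : cardinal) : ceq A B <-> embeds A B /\ embeds B A.
Proof.
rewrite -!cleP; split=> [/card_eqPle//|H]; exact/card_eqPle.
Qed.

Lemma cinfiniteP (A : cardinal) : cinfinite A <-> embeds nat A.
Proof. by rewrite -cleP; apply: infiniteP. Qed.

Lemma embeds_refl A : embeds A A.
Proof. by exists id. Qed.

Lemma embeds_trans B A C : embeds A B -> embeds B C -> embeds A C.
Proof. by move=> [f fi] [g gi]; exists (g \o f); apply: inj_comp. Qed.

Lemma embeds_prod A B A' B' : embeds A A' -> embeds B B' -> embeds (A * B) (A' * B').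
Proof.
move=> [f fi] [g gi]; exists (fun z => (f z.1, g z.2)).
by move=> [a b] [a' b'] /= [/fi -> /gi ->].
Qed.

Lemma embeds_sig (A : Type) (P : A -> Prop) : embeds {x | P x} A.
Proof. by exists sval; apply: sval_inj. Qed.

Lemma embeds_set A : embeds A (set A).
Proof. by exists (fun x => [set x]) => x y E; have : [set y] y by []; rewrite -E => ->. Qed.

Lemma surjection_embeds A B (f : A -> B) : (forall y, exists x, f x = y) -> embeds B A.
Proof. by move=> /choice[s sP]; exists s; apply: can_inj sP. Qed.

Lemma embeds_surjection A B : inhabited B -> embeds B A ->
  exists g : A -> B, forall y, exists x, g x = y.
Proof.
move=> [b0] [f fi].
have /choice[g gP] : forall a, exists b, forall y, f y = a -> b = y.
  move=> a; have [[y ya]|ny] := pselect (exists y, f y = a); last first.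
    by exists b0 => y ya; case: ny; exists y.
  by exists y => z za; apply: fi; rewrite ya.
by exists g => y; exists (f y); apply: gP.
Qed.

Lemma not_embeds_set A : ~ embeds (set A) A.
Proof.
move=> [f fi]; pose X : set A := [set x | exists2 Y, f Y = x & ~ Y x].
have [XX|nXX] := pselect (X (f X)).
  by have [Y /fi YX nY] := XX; apply: nY; rewrite YX.
by apply: (nXX); exists X.
Qed.

(** A maximal partial injection is defined everywhere or onto. *)
Lemma embeds_total A B : embeds A B \/ embeds B A.
Proof.
pose K (G : set (A * B)) := forall z z', G z -> G z' -> (z.1 = z'.1 <-> z.2 = z'.2).
have [|F FK totF nF|G [KG _ maxG]] := @maximal_extension _ K set0; first by [].
  move=> z z' Uz Uz'.
  have [X FX [Xz Xz']] := chain_pair totF Uz Uz'; exact: FK FX _ _ Xz Xz'.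
have [domG|/existsNP[a na]] := pselect (forall a, exists b, G (a, b)).
  left; have /choice[f fG] := domG; exists f => x y E.
  exact/(KG _ _ (fG x) (fG y)).
have [ranG|/existsNP[b nb]] := pselect (forall b, exists a, G (a, b)).
  right; have /choice[f fG] := ranG; exists f => x y E.
  by have [H _] := KG _ _ (fG x) (fG y); apply: H.
case: (na); exists b; rewrite -(maxG (G `|` [set (a, b)])); [by right| |by move=> z; left].
move=> [x y] [x' y'] [Gz|[-> ->]] [Gz'|[-> ->]] /=.
- exact: (KG _ _ Gz Gz').
- split=> E; first by case: na; exists y; rewrite -E.
  by case: nb; exists x; rewrite -E.
- split=> E; first by case: na; exists y'; rewrite E.
  by case: nb; exists x'; rewrite E.
- by [].
Qed.

Lemma not_embeds A B : ~ embeds A B -> embeds B A.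
Proof. by case: (embeds_total A B). Qed.

(** Zorn's lemma is applied to the graphs G of injections A * A -> A, where the subset A of
    X is recovered from G as [side G]. If the complement of A embeds in A for a maximal G,
    then X embeds in A. Otherwise A embeds in its complement, with image B say,
    and G extends to the union of A and B, against maximality. *)
Section Square.
Variables (X : Type) (natX : embeds nat X).

Let side (G : set ((X * X) * X)) : set X := [set x | exists y, G ((x, x), y)].

Let square_graph (G : set ((X * X) * X)) : Prop :=
  [/\ forall x y, side G x -> side G y -> exists z, G ((x, y), z),
      forall x y z, G ((x, y), z) -> [/\ side G x, side G y & side G z] &
      forall u v, G u -> G v -> (u.1 = v.1 <-> u.2 = v.2)].

Let square_graph_bigcup (F : set (set ((X * X) * X))) :
  F `<=` square_graph -> total_on F subset -> F !=set0 -> square_graph (\bigcup_(G in F) G).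
Proof.
move=> FK totF nF.
split.
- move=> x y [x' Ux] [y' Uy]; have [G FG [Gx Gy]] := chain_pair totF Ux Uy.
  have [H _ _] := FK _ FG; have [||z Gz] := H x y; [by exists x'|by exists y'|].
  by exists z, G.
- move=> x y z [G FG Gz]; have [_ H _] := FK _ FG.
  have [[x' Gx] [y' Gy] [z' Gz']] := H _ _ _ Gz.
  by split; [exists x'|exists y'|exists z']; exists G.
- move=> u v Uu Uv; have [G FG [Gu Gv]] := chain_pair totF Uu Uv.
  by have [_ _] := FK _ FG; apply.
Qed.

Lemma embeds_square : embeds (X * X) X.
Proof.
have [i0 i0_inj] := natX.
have [p p_inj] : embeds (nat * nat) nat.
  by exists pickle; apply: (pcan_inj pickleK).
pose G0 : set ((X * X) * X) :=
  [set z | exists a b, z = ((i0 a, i0 b), i0 (p (a, b)))].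
have sideG0 a : side G0 (i0 a) by exists (i0 (p (a, a))), a, a.
have sideG0P x : side G0 x -> exists a, x = i0 a.
  by move=> [y [a [b [-> _ _]]]]; exists a.
have [||G [[Gtot Gside Ginj] G0G maxG]] := @maximal_extension _ square_graph G0.
- split.
  + by move=> x y /sideG0P[a ->] /sideG0P[b ->]; exists (i0 (p (a, b))), a, b.
  + by move=> x y z [a [b [-> -> ->]]].
  + move=> _ _ [a [b ->]] [a' [b' ->]] /=.
    by split=> [[/i0_inj -> /i0_inj ->]|/i0_inj/p_inj[-> ->]].
- exact: square_graph_bigcup.
have subside x : side G0 x -> side G x by move=> [y G0y]; exists y; apply: G0G.
pose a0 := i0 0; pose a1 := i0 1%N.
have A0 : side G a0 by apply/subside/sideG0.
have A1 : side G a1 by apply/subside/sideG0.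
have a01 : a0 <> a1 by move=> /i0_inj.
have /choice[f fP] : forall u : X * X, exists z, side G u.1 -> side G u.2 -> G (u, z).
  move=> [x y]; have [Ax|nA] := pselect (side G x); last by exists a0.
  have [Ay|nA] := pselect (side G y); last by exists a0.
  by have [z Gz] := Gtot x y Ax Ay; exists z.
have fA x y : side G x -> side G y -> side G (f (x, y)).
  by move=> Ax Ay; have /Gside[] := fP (x, y) Ax Ay.
have f_inj x y x' y' : side G x -> side G y -> side G x' -> side G y' ->
    f (x, y) = f (x', y') -> x = x' /\ y = y'.
  move=> Ax Ay Ax' Ay' E.
  have [_ H] := Ginj _ _ (fP (x, y) Ax Ay) (fP (x', y') Ax' Ay').
  by have [] := H E.
have glue (S : set X) (k : X -> X) : (forall x, S x -> ~ side G x) ->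
    (forall x, S x -> side G (k x)) ->
    (forall x y, S x -> S y -> k x = k y -> x = y) ->
    exists v : X -> X, (forall x, side G x \/ S x -> side G (v x)) /\
      (forall x y, side G x \/ S x -> side G y \/ S y -> v x = v y -> x = y).
  move=> SA kA k_inj; pose v x := if `[< side G x >] then f (a0, x) else f (a1, k x).
  exists v; split=> [x [Ax|Sx]|x y].
  - by rewrite /v asboolT //; apply: fA.
  - by rewrite /v asboolF; [apply: fA => //; apply: kA|apply: SA].
  case=> [Ax|Sx] [Ay|Sy]; rewrite /v.
  - by rewrite !asboolT // => /f_inj[].
  - rewrite (asboolT Ax) (asboolF (SA _ Sy)) => /f_inj[] // *; exact: kA.
  - rewrite (asboolT Ay) (asboolF (SA _ Sx)) => /f_inj[] //; first exact: kA.
    by move=> /esym.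
  - rewrite (asboolF (SA _ Sx)) (asboolF (SA _ Sy)) => /f_inj[] //; try exact: kA.
    by move=> _; apply: k_inj.
have [[k k_inj]|/not_embeds[j j_inj]] := pselect (embeds {x | ~ side G x} {x | side G x}).
  pose k' x := if pselect (~ side G x) is left nA then sval (k (exist _ x nA)) else x.
  have k'P x (nA : ~ side G x) : k' x = sval (k (exist _ x nA)).
    by rewrite /k'; case: pselect => // nA'; rewrite (Prop_irrelevance nA' nA).
  have [|||v [vA v_inj]] := glue [set x | ~ side G x] k'.
  - by [].
  - by move=> x nA; rewrite (k'P _ nA); apply: svalP.
  - move=> x y nx ny; rewrite (k'P _ nx) (k'P _ ny) => E.
    have /k_inj[] // : k (exist _ x nx) = k (exist _ y ny) by exact: sval_inj.
  have all x : side G x \/ ~ side G x by apply: EM.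
  exists (fun u => f (v u.1, v u.2)) => -[x y] [x' y'] /= /f_inj[]; try exact: vA.
  by move=> /v_inj -> // /v_inj -> //.
exfalso.
pose j' x := if pselect (side G x) is left A then sval (j (exist _ x A)) else x.
have j'P x (Ax : side G x) : j' x = sval (j (exist _ x Ax)).
  by rewrite /j'; case: pselect => // A'; rewrite (Prop_irrelevance A' Ax).
have j'A x : side G x -> ~ side G (j' x).
  by move=> Ax; rewrite (j'P _ Ax); exact: (proj2_sig (j (exist _ x Ax))).
have j'_inj x y : side G x -> side G y -> j' x = j' y -> x = y.
  move=> Ax Ay; rewrite (j'P _ Ax) (j'P _ Ay) => E.
  have /j_inj[] // : j (exist _ x Ax) = j (exist _ y Ay) by exact: sval_inj.
pose B : set X := [set x | exists2 y, side G y & j' y = x].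
have /choice[w wP] : forall x, exists y, B x -> side G y /\ j' y = x.
  move=> x; have [[y Ay yx]|nB] := pselect (B x); first by exists y.
  by exists x.
have [|||v [vA v_inj]] := glue B w.
- by move=> _ [y Ay <-]; apply: j'A.
- by move=> x /wP[].
- by move=> x y /wP[_ {2}<-] /wP[_ {2}<-] ->.
pose A' x := side G x \/ B x.
pose G' : set ((X * X) * X) := G `|` [set u | exists x y,
  [/\ A' x, A' y, ~ (side G x /\ side G y) & u = ((x, y), j' (f (v x, v y)))]].
have A'side x : A' x -> side G' x.
  move=> [[z Gz]|Bx]; first by exists z; left.
  exists (j' (f (v x, v x))); right; exists x, x; split=> //; try by right.
  by move=> [Ax _]; have [y Ay yx] := Bx; case: (j'A _ Ay); rewrite yx.
have sideA' x : side G' x -> A' x.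
  by move=> [z [/Gside[Ax _ _]|[x' [y' [A'x _ _ [-> _ _]]]]]] //; left.
have vfA x y : A' x -> A' y -> side G (f (v x, v y)).
  by move=> Ax Ay; apply: fA; apply: vA.
have [y Ay] : exists y, B y by exists (j' a0), a0.
case: (j'A (w y)); first by case: (wP y Ay).
have [_ ->] := wP y Ay; rewrite -(maxG G'); last by move=> z; left.
  by apply: A'side; right.
split.
- move=> x x' /sideA' Ax /sideA' Ax'.
  have [[Gx Gx']|nG] := pselect (side G x /\ side G x').
    by have [z Gz] := Gtot _ _ Gx Gx'; exists z; left.
  by exists (j' (f (v x, v x'))); right; exists x, x'.
- move=> x x' z [/Gside[Ax Ax' Az]|[x0 [y0 [Ax Ay0 _ [-> -> ->]]]]].
    by split; apply: A'side; left.
  split; [exact: A'side|exact: A'side|].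
  by apply: A'side; right; exists (f (v x0, v y0)) => //; apply: vfA.
have mixed u a b : G u -> A' a -> A' b -> ~ (side G a /\ side G b) ->
   (u.1 = (a, b) <-> u.2 = j' (f (v a, v b))).
  case: u => [[u1 u2] u3] /Gside[Au1 Au2 Au3] Ax Ay' nxy; split=> /= [[E1 E2]|E].
    by case: nxy; rewrite -E1 -E2.
  by case: (j'A (f (v a, v b))); [apply: vfA|rewrite -E].
move=> u u' [Gu|[x1 [w1 [A1x A1y nA1 uE]]]] [Gu'|[x2 [w2 [A2x A2y nA2 uE']]]]; rewrite ?uE ?uE'.
- exact: Ginj.
- exact: mixed.
- by have [H1 H2] := mixed u' x1 w1 Gu' A1x A1y nA1; split=> /esym E; apply/esym; [apply: H1|apply: H2].
split=> /= [[-> ->]//|/j'_inj E].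
have /f_inj[||||] : f (v x1, v w1) = f (v x2, v w2) by apply: E; apply: vfA.
1-4: by apply: vA.
by move=> /v_inj -> // /v_inj -> //.
Qed.
End Square.

Section InfiniteArithmetic.
Variables (k : Type) (natk : embeds nat k).

Lemma infinite_point : inhabited k.
Proof. by have [f _] := natk; exists; exact: (f 0%N). Qed.

Lemma embeds_prod_le A B : embeds A k -> embeds B k -> embeds (A * B) k.
Proof. by move=> Ak Bk; apply: embeds_trans (embeds_square natk); apply: embeds_prod. Qed.

Lemma embeds_sum_le A B : embeds A k -> embeds B k -> embeds (A + B) k.
Proof.
move=> [f fi] [g gi]; have [n ni] := natk.
apply: embeds_trans (embeds_square natk).
exists (fun z => match z with inl a => (n 0%N, f a) | inr b => (n 1%N, g b) end).
by move=> [a|b] [a'|b'] // [] => [/fi ->|/ni|/ni|/gi ->].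
Qed.

Lemma embeds_bool : embeds bool k.
Proof.
have [n ni] := natk; exists (n \o nat_of_bool) => a b /ni.
by case: a b => [] [].
Qed.

Lemma embeds_seq_le A : embeds A k -> embeds (seq A) k.
Proof.
move=> [f fi]; have [h hi] := embeds_square natk; have [n ni] := natk.
apply: embeds_trans (embeds_prod_le natk (embeds_refl k)).
pose code := foldr (fun a c => h (f a, c)) (n 0%N).
exists (fun s => (size s, code s)) => s t [].
elim: s t => [|a s IH] [|b t] //= [st] /hi[/fi -> /IH ->] //.
Qed.

End InfiniteArithmetic.

Lemma embeds_set_set A B : embeds A B -> embeds (set A) (set B).
Proof.
move=> [f fi]; exists (fun X => f @` X) => X Y E; apply/seteqP; split=> x Hx.
  have : (f @` Y) (f x) by rewrite -E; exists x.
  by move=> [y Yy /fi <-].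
have : (f @` X) (f x) by rewrite E; exists x.
by move=> [y Xy /fi <-].
Qed.

Lemma embeds_fun_set k A B : embeds (A * B) k -> embeds (A -> set B) (set k).
Proof.
move=> /embeds_set_set; apply: embeds_trans.
exists (fun F => [set z | F z.1 z.2]) => F G E.
by apply/funext => a; apply/funext => b; apply: (congr1 (@^~ (a, b)) E).
Qed.

Lemma embeds_fun A A' B B' : inhabited B' -> embeds A A' -> embeds B B' -> embeds (A -> B) (A' -> B').
Proof.
move=> [b0] [f fi] [g gi].
exists (fun F a' => if pselect (exists a, f a = a') is left ex then g (F (projT1 (cid ex))) else b0).
move=> F G E; apply/funext => a; have := congr1 (@^~ (f a)) E.
case: pselect => [ex /gi|[]]; last by exists a.
by rewrite (fi _ _ (projT2 (cid ex))).
Qed.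

(** ** Small sets *)

(** The elements of X are at most k in number. The injection is defined on all of U, which
    avoids subtypes. *)
Definition small (k U : Type) (X : set U) : Prop :=
  exists f : U -> k, forall x y, X x -> X y -> f x = f y -> x = y.

Section Small.
Variables (k : Type) (natk : embeds nat k).
Implicit Types U V : Type.

Lemma small_embeds U (X : set U) : small k X <-> embeds {x | X x} k.
Proof.
split=> [[f fi]|[f fi]].
  by exists (f \o sval) => -[x Xx] [y Xy] /= E; apply: sval_inj; apply: fi.
have [k0] := infinite_point natk.
exists (fun x => if pselect (X x) is left Xx then f (exist _ x Xx) else k0) => x y Xx Xy.
by case: pselect => // Xx'; case: pselect => // Xy' /fi[].
Qed.

Lemma small_sub U (X Y : set U) : X `<=` Y -> small k Y -> small k X.
Proof. by move=> XY [f fi]; exists f => x y /XY Yx /XY Yy; apply: fi. Qed.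

Lemma small_setT U : embeds U k -> small k [set: U].
Proof. by move=> [f fi]; exists f => x y _ _ /fi. Qed.

Lemma small_image U V (g : U -> V) (X : set U) : small k X -> small k (g @` X).
Proof.
move=> [f fi]; have [k0] := infinite_point natk.
have /choice[s sP] : forall y, exists z : k, (g @` X) y -> exists2 x, X x /\ g x = y & z = f x.
  move=> y; have [[x Xx xy]|ny] := pselect ((g @` X) y); last by exists k0.
  by exists (f x) => _; exists x.
exists s => y y' /sP[x [Xx <-] ->] /sP[x' [Xx' <-] ->] E.
by congr g; apply: fi.
Qed.

Lemma small_range U V (g : U -> V) : embeds U k -> small k (range g).
Proof. by move=> Uk; apply/small_image/small_setT. Qed.

Lemma small_set1 U (x : U) : small k [set x].
Proof. by have [k0] := infinite_point natk; exists (fun _ => k0) => y z -> ->. Qed.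

Lemma small_bigcup I U (X : I -> set U) : embeds I k -> (forall i, small k (X i)) ->
  small k [set x | exists i, X i x].
Proof.
move=> Ik /choice[f fi]; have [h hi] := embeds_prod_le natk Ik (embeds_refl k).
have [k0] := infinite_point natk.
have /choice[s sP] : forall y, exists z : k, (exists i, X i y) -> exists2 i, X i y & z = h (i, f i y).
  move=> y; have [[i Xi]|ny] := pselect (exists i, X i y); last by exists k0.
  by exists (h (i, f i y)) => _; exists i.
exists s => x y /sP[i Xx ->] /sP[j Xy ->] /hi[ij]; rewrite -ij in Xy *.
exact: fi.
Qed.

Lemma small_setU U (X Y : set U) : small k X -> small k Y -> small k (X `|` Y).
Proof.
move=> sX sY; have := @small_bigcup bool U (fun b => if b then X else Y).
move=> H; apply: (small_sub (Y := [set x | exists b : bool, (if b then X else Y) x])).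
  by move=> x [Xx|Yx]; [exists true|exists false].
by apply: H => [|[]//]; apply: embeds_bool.
Qed.

End Small.

Lemma small_trans k k' U (X : set U) : embeds k k' -> small k X -> small k' X.
Proof. by move=> [g gi] [f fi]; exists (g \o f) => x y Xx Xy /gi; apply: fi. Qed.

(** ** Well-orders *)

Section WellOrders.
Variables (A : Type) (le : rel A).

Definition strict (i j : A) : Prop := ~~ le j i.
Definition segment (i : A) : Type := {j | strict j i}.

Hypothesis wo : well_order le.

Lemma wo_refl i : le i i.
Proof. exact: (@wo_chain_reflexive {classic A} le predT (fun X _ => @wo X) i isT). Qed.
Lemma wo_anti i j : le i j -> le j i -> i = j.
Proof.
move=> ij ji; have H := @wo_chain_antisymmetric {classic A} le predT (fun X _ => @wo X) i j isT isT.
by apply: H; rewrite ij.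
Qed.
Lemma wo_total i j : le i j \/ le j i.
Proof.
have H := @wo_chainW {classic A} le predT (fun X _ => @wo X) i j isT isT.
exact/orP.
Qed.

Lemma wo_min (P : A -> Prop) : (exists i, P i) -> exists2 i, P i & forall j, P j -> le i j.
Proof.
move=> [i Pi]; have [|z [[/asboolP Pz lb] _]] := @wo (fun x => `[< P x >]).
  by exists i; apply/asboolP.
by exists z => // j Pj; apply/lb/asboolP.
Qed.

Lemma wo_trans i j k : le i j -> le j k -> le i k.
Proof.
move=> ij jk; have [m mP mmin] := @wo_min (fun x => [\/ x = i, x = j | x = k]) (ex_intro _ i (Or31 _ _ erefl)).
have mi := mmin i (Or31 _ _ erefl); have mj := mmin j (Or32 _ _ erefl); have mk := mmin k (Or33 _ _ erefl).
case: mP => mE; rewrite mE in mi mj mk; first by [].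
- by rewrite (wo_anti ij mi).
- by rewrite -(wo_anti jk mj).
Qed.

Lemma strictNle i j : ~ strict i j <-> le j i.
Proof. by rewrite /strict; split=> [/negP|H]; [rewrite negbK|apply/negP; rewrite negbK]. Qed.
Lemma strict_le i j : strict i j -> le i j.
Proof. by move=> ij; case: (wo_total i j) => // ji; rewrite /strict ji in ij. Qed.
Lemma strict_le_trans i j l : strict i j -> le j l -> strict i l.
Proof. by rewrite /strict => ij jl; apply: contra ij => li; apply: wo_trans jl li. Qed.
Lemma le_eqVstrict i j : le i j -> i = j \/ strict i j.
Proof.
move=> ij; have [ji|nji] := boolP (le j i); last by right.
by left; apply: wo_anti.
Qed.

Lemma strict_wf : well_founded strict.
Proof.
move=> i; apply: contrapT => nacc.
have [m mN mmin] := @wo_min (fun x => ~ Acc strict x) (ex_intro _ i nacc).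
apply: mN; constructor => j jm; apply: contrapT => /mmin mj.
by rewrite /strict mj in jm.
Qed.

Lemma wo_ind (P : A -> Prop) : (forall i, (forall j, strict j i -> P j) -> P i) -> forall i, P i.
Proof. by move=> H; apply: (well_founded_ind strict_wf). Qed.

Lemma wo_rec B (F : forall i : A, (forall j, strict j i -> B) -> B) :
  exists f : A -> B, forall i, f i = F i (fun j _ => f j).
Proof.
exists (Fix strict_wf (fun _ => B) F) => i; apply: Fix_eq => x f g fg.
by congr (F x); apply: functional_extensionality_dep => j; apply: functional_extensionality_dep => ji; apply: fg.
Qed.

Lemma segment_embeds i j : le i j -> embeds (segment i) (segment j).
Proof.
move=> ij; exists (fun x : segment i => exist (fun z => strict z j) (sval x) (strict_le_trans (proj2_sig x) ij) : segment j).
by move=> [x xi] [y yi] /= [] xy; apply: sval_inj.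
Qed.

(** By recursion an element of k is chosen outside the values already taken, of which there
    are at most k'. *)
Lemma segments_embed k k' : (forall i, embeds (segment i) k') -> ~ embeds k k' -> embeds A k.
Proof.
move=> segk' nk.
have k0 : inhabited k.
  apply: contrapT => nok; apply: nk; exists (fun x => False_rect k' (nok (inhabits x))).
  by move=> x; case: nok.
have [d] := k0.
have /choice[pick pickP] : forall X : set k, exists m, small k' X -> ~ X m.
  move=> X; have [sX|nsX] := pselect (small k' X); last by exists d.
  apply: contrapT => /forallNP allX; apply: nk; have [f fi] := sX.
  exists f => x y; apply: fi; apply: contrapT => nX.
    by apply: (allX x).
  by apply: (allX y).
have [f fE] := @wo_rec k (fun i f => pick [set z | exists j (ji : strict j i), z = f j ji]).
have fnew i j : strict j i -> f j <> f i.
  move=> ji; rewrite [f i]fE; set X := (X in pick X).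
  have sX : small k' X.
    have [g gi] := segk' i.
    have [d'] : inhabited k' by exists; exact: (g (exist _ j ji)).
    have /choice[s sP] : forall z, exists c : k', X z -> exists l (li : strict l i), z = f l /\ c = g (exist _ l li).
      move=> z; have [[l [li ->]]|nX] := pselect (X z); last by exists d'.
      by exists (g (exist _ l li)) => _; exists l, li.
    exists s => x y /sP[l [li [-> ->]]] /sP[l' [li' [-> ->]]] /gi[].
    by move=> ->.
  by move=> E; apply: (pickP X sX); rewrite -E; exists j, ji.
exists f => i j E; case: (wo_total i j) => [/le_eqVstrict[//|ij]|/le_eqVstrict[//|ji]].
  by case: (fnew _ _ ij).
by case: (fnew _ _ ji).
Qed.

End WellOrders.

Lemma wo_exists (A : Type) : exists le : rel A, well_order le.
Proof. by have [le lewo] := @well_ordering_principle {classic A}; exists le. Qed.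

Lemma wo_pullback (A B : Type) (f : A -> B) (le : rel B) :
  injective f -> well_order le -> well_order (fun x y => le (f x) (f y)).
Proof.
move=> fi wo; apply: antisymmetric_well_order.
  by move=> x y /andP[xy yx]; apply/fi/(wo_anti wo).
move=> X [x0 Xx0].
have [|z [x Xx <-] zmin] := @wo_min _ _ wo (fun z => exists2 x, x \in X & f x = z).
  by exists (f x0), x0.
exists x; split=> // y Xy; apply: zmin; by exists y.
Qed.

Lemma segment_pullback (A B : Type) (f : A -> B) (le : rel B) i :
  injective f -> embeds (segment (fun x y => le (f x) (f y)) i) (segment le (f i)).
Proof.
move=> fi; exists (fun x : segment (fun x y => le (f x) (f y)) i =>
  exist (fun z => strict le z (f i)) (f (sval x)) (proj2_sig x) : segment le (f i)).
by move=> [x xi] [y yi] /= [] /fi xy; apply: sval_inj.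
Qed.

(** A well-order of [set k] is too long; cut it at the first segment that does not embed
    in k. *)
Lemma hartogs (k : Type) : exists (W : Type) (le : rel W),
  [/\ well_order le, forall i, embeds (segment le i) k & ~ embeds W k].
Proof.
have [le wo] := wo_exists (set k).
have [all|/existsNP ex] := pselect (forall i, embeds (segment le i) k).
  by exists (set k), le; split=> //; apply: not_embeds_set.
have [s sN smin] := wo_min wo ex.
exists (segment le s), (fun x y => le (sval x) (sval y)); split=> //.
  by apply: wo_pullback wo => -[x xs] [y ys] /= xy; apply: sval_inj.
move=> i.
have [H|/smin si] := pselect (embeds (segment le (sval i)) k).
  apply: embeds_trans H; apply: (@segment_pullback _ _ sval).
  by move=> [x xs] [y ys] /= xy; apply: sval_inj.
by have := svalP i; rewrite /strict si.
Qed.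

Lemma succ_cardinal_exists (k : cardinal) : exists k' : cardinal, is_succ_cardinal k k'.
Proof.
have [W [le [wo segW nW]]] := hartogs k.
exists W; split; first by split; [apply/cleP/not_embeds|move=> /cleP].
move=> mu [_ nmu]; apply/cleP/(segments_embed wo segW) => muk; exact/nmu/cleP.
Qed.

Lemma initial_wo (A : Type) : exists le : rel A, well_order le /\ forall i, ~ embeds A (segment le i).
Proof.
have [le wo] := wo_exists A.
have [all|/existsNP [i /contrapT]] := pselect (forall i, ~ embeds A (segment le i)).
  by exists le.
move=> H; have [s [f fi] smin] := wo_min wo (P := fun i => embeds A (segment le i)) (ex_intro _ i H).
have gi : injective (sval \o f).
  by move=> x y /= E; apply: fi; case: (f x) (f y) E => [a pa] [b pb] /= ab; apply: sval_inj.
exists (fun x y => le ((sval \o f) x) ((sval \o f) y)); split; first exact: wo_pullback.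
move=> x /embeds_trans /(_ (segment_pullback _ _ gi)) /smin.
by apply/negP; apply: (svalP (f x)).
Qed.

Lemma below_succ (A k : cardinal) : embeds A k -> below_succ_cardinal A k.
Proof.
move=> Ak; have [k' sk] := succ_cardinal_exists k; exists k'; split=> //.
have [[kk' nkk'] _] := sk; split.
  by apply/cleP; apply: embeds_trans Ak _; apply/cleP.
move=> /cleP k'A; apply: nkk'; apply/cleP; exact: embeds_trans k'A Ak.
Qed.


(** * Transfinite towers of sets *)

Section Tower.
Variables (A : Type) (le : rel A) (wo : well_order le) (T : Type).
Variables (X0 : set T) (step : A -> set T -> set T).

(** As steps enlarge, this single equation contains the three clauses of the usual
    definition: X0 at the start, step at successors, unions at limits. *)
Definition is_tower (X : A -> set T) : Prop :=
  forall i, X i = X0 `|` [set x | exists j, strict le j i /\ step j (X j) x].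

Lemma tower_exists : exists X, is_tower X.
Proof.
have [X XE] := @wo_rec A le wo (set T) (fun i X => X0 `|` [set x | exists j (ji : strict le j i), step j (X j ji) x]).
exists X => i; rewrite [LHS]XE; congr (_ `|` _); apply/seteqP.
by split=> x [j [ji H]]; exists j; [split|exists ji].
Qed.

Variables (X : A -> set T) (XE : is_tower X).
Hypothesis step_sub : forall j Y, Y `<=` step j Y.

Lemma tower_base i : X0 `<=` X i.
Proof. by rewrite XE => x; left. Qed.

Lemma tower_step i j : strict le j i -> step j (X j) `<=` X i.
Proof. by move=> ji x Sx; rewrite XE; right; exists j. Qed.

Lemma tower_mono i j : le j i -> X j `<=` X i.
Proof.
move=> /(le_eqVstrict wo)[->//|ji] x Xx.
exact/(tower_step ji)/step_sub.
Qed.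

Lemma tower_total : total_on (range X) subset.
Proof.
move=> _ _ [i _ <-] [j _ <-]; have [ij|ji] := wo_total wo i j.
  by left; apply: tower_mono.
by right; apply: tower_mono.
Qed.

Lemma is_next_strict i j : is_next le j i -> strict le j i.
Proof. by case. Qed.

Lemma next_le i j l : is_next le j i -> strict le l i -> le l j.
Proof.
move=> [_ lb] li; apply/(strictNle le) => jl; have := lb l jl.
by apply/negP.
Qed.

Lemma tower_next i j : is_next le j i -> X i = step j (X j).
Proof.
move=> ji; apply/seteqP; split; last exact/tower_step/is_next_strict.
rewrite XE => x [X0x|[l [li Sx]]]; first exact/step_sub/tower_base.
have /(le_eqVstrict wo)[<-//|lj] := next_le ji li.
by apply/step_sub/(tower_step lj).
Qed.

Lemma next_exists i j : strict le j i -> exists2 l, is_next le j l & le l i.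
Proof.
move=> ji; have [l jl lmin] := wo_min wo (ex_intro (strict le j) i ji).
by exists l; [split=> // z jz; apply: lmin|apply: lmin].
Qed.

Lemma tower_limit i : (exists j, strict le j i) -> (forall j, ~ is_next le j i) ->
  forall x, X i x -> exists j, strict le j i /\ X j x.
Proof.
move=> [j0 j0i] nonext x; rewrite XE => -[X0x|[j [ji Sx]]].
  by exists j0; split=> //; apply: tower_base.
have [l jl li] := next_exists ji.
exists l; split; last exact: (tower_step (is_next_strict jl)).
have [E|//] := le_eqVstrict wo li.
by case: (nonext j); rewrite -E.
Qed.

Lemma tower_ind (P : set (set T)) : P X0 -> (forall j, P (X j) -> P (step j (X j))) ->
  (forall F : set (set T), F `<=` P -> total_on F subset -> F !=set0 -> P (\bigcup_(Y in F) Y)) ->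
  forall i, P (X i).
Proof.
move=> P0 PS PU; apply: (wo_ind wo) => i IH.
have [[j ji]|nonext] := pselect (exists j, is_next le j i).
  by rewrite (tower_next ji); apply/PS/IH/is_next_strict.
have [ex|noj] := pselect (exists j, strict le j i); last first.
  rewrite XE (_ : [set x | _] = set0) ?setU0 //.
  by apply/seteqP; split=> // x [j [ji _]]; case: noj; exists j.
rewrite (_ : X i = \bigcup_(Y in [set X j | j in strict le ^~ i]) Y).
  apply: PU.
  - by move=> _ [j ji <-]; apply: IH.
  - by move=> _ _ [j _ <-] [l _ <-]; apply: tower_total; [exists j|exists l].
  - by have [j ji] := ex; exists (X j); exists j.
apply/seteqP; split=> x.
  move=> Xx; have [j [ji Xj]] := tower_limit ex (fun j ji => nonext (ex_intro _ j ji)) Xx.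
  by exists (X j) => //; exists j.
by move=> [_ [j ji <-]]; apply/tower_mono/(strict_le wo).
Qed.

Lemma tower_small k : embeds nat k -> small k X0 -> (forall i, embeds (segment le i) k) ->
  (forall j, small k (X j) -> small k (step j (X j))) -> forall i, small k (X i).
Proof.
move=> natk s0 segk sS; apply: (wo_ind wo) => i IH; rewrite XE.
apply: small_setU => //.
have := @small_bigcup k natk (segment le i) T (fun j => step (sval j) (X (sval j))) (segk i).
move=> /(_ (fun j => sS _ (IH _ (proj2_sig j)))); apply: small_sub.
by move=> x [j [ji Sx]]; exists (exist _ j ji).
Qed.

End Tower.

(** * Cardinalities of modules and pure submodules *)

Section Sizes.
Variable R : nzRingType.

Lemma nat_ring_card : embeds nat (ring_card R). Proof. by exists inr => x y []. Qed.
Lemma ring_ring_card : embeds R (ring_card R). Proof. by exists inl => x y []. Qed.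

Lemma embeds_formula k : embeds nat k -> embeds (ring_card R) k -> embeds (formula R) k.
Proof.
move=> natk Rk; apply: embeds_trans (embeds_seq_le natk Rk).
pose entries m n (D : 'M[R]_(m, n)) : seq (ring_card R) := [seq inl (D z.1 z.2) | z <- enum {: 'I_m * 'I_n}].
exists (fun phi => inr (frows phi) :: inr (fcols phi) ::
  entries _ _ (row_mx (fmx phi) (fvar phi))).
move=> [m n D e] [m' n' D' e'] /= [mm nn]; subst m' n' => /eq_in_map E.
have /eq_row_mx[-> ->//] : row_mx D e = row_mx D' e'.
by apply/matrixP => i j; have [] := E (i, j) (mem_enum _ _).
Qed.

Lemma embeds_direct_sum k (I : Type) (M : lmodType R) :
  embeds nat k -> embeds I k -> embeds M k -> embeds (direct_sum I M) k.
Proof.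
move=> natk Ik Mk; apply: embeds_trans (embeds_seq_le natk (embeds_prod_le natk Ik Mk)).
have /choice[s sP] := @ds_list R I M.
exists (fun f => map (fun i => (i, ds_coord i f)) (s f)) => f g E.
have half (f1 f2 : direct_sum I M) : [seq (i, ds_coord i f1) | i <- s f1] = [seq (i, ds_coord i f2) | i <- s f2] ->
    forall i, ds_coord i f1 != 0 -> ds_coord i f1 = ds_coord i f2.
  move=> E12 i /sP; elim: (s f1) (s f2) E12 => // j l IH [|j' l'] //= [-> E0 El] [<-|/(IH _ El)] //.
apply: ds_ext => i; have [fi0|] := eqVneq (ds_coord i f) 0; last exact: half.
have [gi0|/(half _ _ (esym E))->//] := eqVneq (ds_coord i g) 0.
by rewrite fi0 gi0.
Qed.

Lemma embeds_free_sum k : embeds nat k -> embeds (ring_card R) k ->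
  embeds (direct_sum k (R^o : lmodType R)) k.
Proof.
move=> natk Rk; apply: embeds_direct_sum => //; first exact: embeds_refl.
exact: embeds_trans ring_ring_card Rk.
Qed.

Lemma embeds_free_basis (k : Type) : embeds k (direct_sum k (R^o : lmodType R)).
Proof.
exists (fun l => ds_delta l (1 : R^o)) => l l' /(congr1 (ds_coord l)).
rewrite ds_delta_eq ds_deltaE; case: asboolP => // _ /eqP.
by rewrite oner_eq0.
Qed.

Variable U : lmodType R.

(** Purity of the inclusion, with the solution taken inside U. *)
Definition pure_submod (S : set U) : Prop :=
  is_submod S /\ forall m n (D : 'M[R]_(m, n)) (p : 'I_m -> U), (forall i, S (p i)) ->
    solvable D p -> exists2 y, (forall j, S (y j)) & mxact D y = p.

Lemma pure_submod_bigcup (F : set (set U)) :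
  F `<=` pure_submod -> total_on F subset -> F !=set0 -> pure_submod (\bigcup_(X in F) X).
Proof.
move=> FG totF nF; split; first by apply: submod_bigcup => // X /FG[].
move=> m n D p Up sp; have [X FX Xp] := chain_tuple totF nF Up.
have [_ XP] := FG _ FX; have [y Xy yE] := XP _ _ _ _ Xp sp.
by exists y => // j; exists X.
Qed.

Lemma tower_pure (A : Type) (le : rel A) (X0 : set U) step X :
  well_order le -> is_tower le X0 step X -> (forall j Y, Y `<=` step j Y) -> inhabited A ->
  pure_submod X0 -> (forall j Y, pure_submod Y -> pure_submod (step j Y)) ->
  (forall i, pure_submod (X i)) /\ pure_submod [set x | exists i, X i x].
Proof.
move=> wo XE step_sub [a0] p0 pS.
have pX : forall i, pure_submod (X i).
  apply: (tower_ind wo XE step_sub) => [|j|] //; [exact: pS|exact: pure_submod_bigcup].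
split=> //; rewrite (_ : [set x | _] = \bigcup_(Y in range X) Y).
  apply: pure_submod_bigcup; [by move=> _ [i _ <-]|exact: (tower_total wo XE step_sub)|].
  by exists (X a0), a0.
apply/seteqP; split=> x; first by move=> [i Xx]; exists (X i) => //; exists i.
by move=> [_ [i _ <-] Xx]; exists i.
Qed.

Lemma pure_submod_module (S : set U) : pure_submod S ->
  exists (N : lmodType R) (i : {linear N -> U}), pure i /\ forall x, S x <-> exists n, i n = x.
Proof.
move=> [subS pS]; have [N [i [inji iS]]] := submod_of_set_incl subS.
exists N, i; split=> // m n D p sp.
have [|y Sy yE] := pS _ _ _ _ _ sp; first by move=> j; apply/iS; exists (p j).
have /choice[z zE] : forall j, exists z, i z = y j by move=> j; apply/iS.
exists z; apply: (solvable_comp_inj inji); rewrite -yE; congr mxact.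
exact/funext.
Qed.

Lemma pure_range (N : lmodType R) (i : {linear N -> U}) : pure i -> pure_submod (range i).
Proof.
move=> pi; split; first exact: range_submod.
move=> m n D p pr sp.
have /choice[z zE] : forall j, exists z, i z = p j.
  by move=> j; have [z _ <-] := pr j; exists z.
have zp : i \o z = p by apply/funext.
have [y yE] : solvable D z by apply: pi; rewrite zp.
by exists (i \o y) => [j|]; [exists (y j)|rewrite mxact_lin yE].
Qed.

Lemma small_module k (N : lmodType R) (i : {linear N -> U}) (S : set U) :
  injective i -> (forall n, S (i n)) -> small k S -> embeds N k.
Proof.
by move=> inji iS [f fi]; exists (f \o i) => x y E; apply: inji; apply: fi E; apply: iS.
Qed.

(** The downward Loewenheim-Skolem argument: a chosen solution of each solvable system over
    the set is added, together with linear combinations, and this is iterated omega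
    times. *)
Lemma pure_closure k (X0 : set U) : embeds nat k -> embeds (ring_card R) k -> small k X0 ->
  exists S, [/\ X0 `<=` S, pure_submod S & small k S].
Proof.
move=> natk Rk s0.
have Rk' : embeds R k := embeds_trans ring_ring_card Rk.
have /choice[w wP] : forall z : formula R * seq U, exists w : nat -> U,
    solvable (fmx z.1) (fun i => nth 0 z.2 i) ->
    mxact (fmx z.1) (fun j => w j) = fun i => nth 0 z.2 i.
  move=> [phi s] /=; have [[y yE]|ns] := pselect (solvable (fmx phi) (fun i => nth 0 s i)); last by exists 0.
  exists (fun k => if insub k is Some j then y j else 0) => _; rewrite -yE; congr mxact.
  by apply/funext => j; rewrite valK.
pose L := (R + formula R * nat)%type.
have Lk : embeds L k.
  apply: embeds_sum_le => //; apply: embeds_prod_le => //; exact: embeds_formula.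
pose op (l : L) (s : seq U) : U := match l with
  | inl a => a *: nth 0 s 0 + nth 0 s 1 | inr (phi, j) => w (phi, s) j end.
pose stage (X : set U) : set U := X `|` [set x | exists l s, (forall y, List.In y s -> X y) /\ x = op l s].
have stage_small X : small k X -> small k (stage X).
  move=> sX; apply: small_setU => //; have [f fi] := sX.
  have [h hi] := embeds_prod_le natk Lk (embeds_seq_le natk (embeds_refl k)).
  have [k0] := infinite_point natk.
  have /choice[c cP] : forall x, exists c : k, (exists l s, (forall y, List.In y s -> X y) /\ x = op l s) ->
      exists l s, [/\ forall y, List.In y s -> X y, x = op l s & c = h (l, map f s)].
    move=> x; have [[l [s [Xs xE]]]|nx] := pselect (exists l s, (forall y, List.In y s -> X y) /\ x = op l s); last by exists k0.
    by exists (h (l, map f s)) => _; exists l, s.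
  exists c => x y /cP[l [s [Xs -> ->]]] /cP[l' [s' [Xs' -> ->]]] /hi[<- E].
  congr (op l); elim: s s' E Xs Xs' => [|a s IH] [|b s'] //= [ab ss] Xs Xs'.
  congr (_ :: _); first by apply: fi ab; [apply: Xs; left|apply: Xs'; left].
  by apply: IH => // z zs; [apply: Xs; right|apply: Xs'; right].
pose St n := iter n stage X0.
have St_mono m n : (m <= n)%N -> St m `<=` St n.
  move=> /subnK <-; elim: (n - m)%N => [|d IH] x // /IH Sx; by left.
have St_list (s : seq U) : (forall x, List.In x s -> exists n, St n x) ->
    exists n, forall x, List.In x s -> St n x.
  elim: s => [|a s IH] H; first by exists 0%N.
  have [|n nP] := IH; first by move=> x xs; apply: H; right.
  have [m mP] := H a (or_introl erefl).
  exists (maxn m n) => x [<-|xs]; first by apply: St_mono mP; apply: leq_maxl.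
  by apply: St_mono (nP _ xs); apply: leq_maxr.
pose S : set U := [set x | exists n, St n x].
have S_op l s : (forall x, List.In x s -> S x) -> S (op l s).
  by move=> /St_list[n nP]; exists n.+1; right; exists l, s.
exists S; split.
- by move=> x Xx; exists 0%N.
- split.
    split; first by have := S_op (inl 0) [::]; rewrite /= scale0r addr0; apply.
    by move=> a x y Sx Sy; apply: (S_op (inl a) [:: x; y]) => z [<-|[<-|]].
  move=> m n D p Sp sol; pose phi := Formula D 0; pose s := [seq p i | i <- enum 'I_m].
  have sE (i : 'I_m) : nth 0 s i = p i.
    by rewrite (nth_map i) ?size_enum_ord // nth_ord_enum.
  have pE : (fun i : 'I_m => nth 0 s i) = p by apply/funext.
  exists (fun j => w (phi, s) j).
    move=> j; apply: (S_op (inr (phi, nat_of_ord j))) => x.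
    rewrite /s; elim: (enum 'I_m) => //= i l IH [<-|/IH//]; exact: Sp.
  by have /= := wP (phi, s); rewrite pE; apply.
- apply: small_bigcup => //; elim=> [|n IH] //; exact: stage_small.
Qed.

End Sizes.


Section Splitting.
Variable R : nzRingType.
Implicit Types M N F Q K : lmodType R.

(** * Perfect rings and pure injectivity of flat modules *)

Definition flats_pure_injective : Prop := forall M : lmodType R, flat M -> pure_injective M.

Lemma quotient_by_pure M N (f : {linear N -> M}) : pure f -> flat M ->
  exists Q (p : {linear M -> Q}), [/\ flat Q, forall q, exists x, p x = q &
     forall x, p x = 0 <-> exists y, f y = x].
Proof.
move=> pf FM.
have [subr _] := pure_range pf.
have [Q [p [psurj pker]]] := quotient_module subr.
have pker' x : p x = 0 <-> exists y, f y = x.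
  by rewrite pker; split=> [[y _ yx]|[y yx]]; exists y.
by exists Q, p; split=> //; apply: flat_pure_quotient pf FM psurj pker'.
Qed.

Lemma kernel_module M N (p : {linear M -> N}) :
  exists K (f : {linear K -> M}), injective f /\ forall x, p x = 0 <-> exists y, f y = x.
Proof.
have [K [f [injf fK]]] := submod_of_set_incl (kernel_submod p).
by exists K, f.
Qed.

Lemma section_retraction M N Q (f : {linear N -> M}) (p : {linear M -> Q}) (s : {linear Q -> M}) :
  injective f -> (forall x, p x = 0 <-> exists y, f y = x) -> cancel s p ->
  exists r : {linear M -> N}, cancel f r.
Proof.
move=> injf pker sp.
have /choice[r rP] : forall x, exists y, f y = x - s (p x).
  by move=> x; apply/pker; rewrite linearB /= sp subrr.
have lr : linear r.
  move=> a x y; apply: injf; rewrite (linearP f) !rP (linearP p) (linearP s) scalerBr opprD addrACA.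
  by [].
exists (linear_pack lr) => y /=; apply: injf; rewrite rP.
by have /pker -> : exists z, f z = f y by [exists y]; rewrite raddf0 subr0.
Qed.

(** The quotient of the envelope of M by M is flat, hence projective, and the envelope
    splits. *)
Lemma perfect_pure_injective :
  (forall (M E : lmodType R) (e : M -> E), flat M -> is_pure_injective_envelope e -> flat E) ->
  left_perfect R -> flats_pure_injective.
Proof.
move=> env perf M FM.
have [E [e envE]] := envelope_exists M.
have FE := env M E e FM envE.
have [piE /pure_embeddingP[e' e'E pe] _] := envE.
have [Q [p [FQ psurj pker]]] := quotient_by_pure pe FE.
have [s sp] := perf Q FQ _ _ p (idfun : {linear Q -> Q}) psurj.
have [r re] := section_retraction (pure_inj pe) pker sp.
exact: pure_injective_retract re piE.
Qed.

Lemma free_lift (I : Type) (M : lmodType R) (g : I -> M) :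
  exists h : {linear direct_sum I (R^o : lmodType R) -> M}, forall i a, h (ds_delta i a) = a *: g i.
Proof.
have lg i : linear (fun a : R^o => (a : R) *: g i).
  by move=> a x y; rewrite scalerDl scalerA.
have [h hP] := ds_lift (fun i => linear_pack (lg i)).
by exists h => i a; rewrite hP.
Qed.

Lemma free_projective (I : Type) : projective (direct_sum I (R^o : lmodType R)).
Proof.
move=> A B p g psurj.
have /choice[a aP] : forall i, exists a, p a = g (ds_delta i 1) by move=> i.
have [h hP] := free_lift a.
exists h => m; apply: (ds_lin_ext (h := p \o h)) => i r /=.
rewrite hP linearZ /= aP -linearZ /=; congr (g _).
apply: ds_ext => j; rewrite linearZ /= !ds_deltaE; case: asboolP => _; last by rewrite scaler0.
exact: mulr1.
Qed.

Lemma flat_free (I : Type) : flat (direct_sum I (R^o : lmodType R)).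
Proof. exact/flat_direct_sum/flat_regular. Qed.

Lemma free_cover (I : Type) M (g : I -> M) : (forall x, exists i, g i = x) ->
  exists p : {linear direct_sum I (R^o : lmodType R) -> M}, forall x, exists y, p y = x.
Proof.
move=> gsurj; have [p pP] := free_lift g; exists p => x.
by have [i <-] := gsurj x; exists (ds_delta i 1); rewrite pP scale1r.
Qed.

(** The kernel K of a free cover of F is pure, hence flat and pure injective. So K is a
    summand of the cover, and maps from F lift. *)
Lemma pure_injective_perfect : flats_pure_injective -> left_perfect R.
Proof.
move=> fpi F FF A B p g psurj.
have [c csurj] := @free_cover F F id (fun x => ex_intro _ x erefl).
have [K [f [injf fK]]] := kernel_module c.
have pf := kernel_pure FF csurj injf fK.
have piK : pure_injective K by apply/fpi/(flat_pure_sub pf)/flat_free.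
have [r rP] := pure_injective_extend idfun piK pf.
have [h hP] := @free_projective F A B p (g \o c : {linear _ -> _}) psurj.
have /choice[s sP] := csurj.
pose t x := s x - f (r (s x)).
have tE x y : c y = x -> t x = y - f (r y).
  move=> cy; have /fK[z zE] : c (s x - y) = 0 by rewrite linearB /= sP cy subrr.
  have := rP z; rewrite zE linearB /= => rz.
  have E : s x - y = f (r (s x)) - f (r y) by rewrite -linearB rz zE.
  rewrite /t -[X in X - _](subrK y) E [in LHS]addrAC [_ - f (r y) - _]addrAC subrr sub0r.
  exact: addrC.
have lt : linear t.
  move=> a x y; rewrite (tE _ (a *: s x + s y)); last by rewrite linearP !sP.
  by rewrite /t (linearP r) (linearP f) scalerBr opprD addrACA.
exists (h \o linear_pack lt) => x /=; rewrite hP /= /t linearB /= sP.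
by have /fK -> : exists z, f z = f (r (s x)) by [exists (r (s x))]; rewrite subr0.
Qed.

(** * Embedding an extension of X into a module containing X *)

(** A system over V that becomes solvable in Z differs from a solvable one by a system over X,
    where u \o e reflects solvability. *)
Lemma pure_glue (X V U Z : lmodType R) (e : {linear X -> V}) (u : {linear V -> U}) (q : V -> Z)
   m n (D : 'M[R]_(m, n)) (v : 'I_m -> V) :
  pure (u \o e) ->
  (solvable D (q \o v) -> exists x, solvable D (v - (e \o x : 'I_m -> V))) ->
  solvable D (u \o v) -> solvable D (q \o v) -> solvable D v.
Proof.
move=> pue qP su sq; have [x sx] := qP sq.
have sue : solvable D ((u \o e) \o x).
  have := solvableB su (solvable_lin u sx); congr solvable.
  apply/funext => i; rewrite [LHS]/GRing.add /= [X in _ + X]/GRing.opp /= raddfB opprB addrC subrK.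
  by [].
have := solvableD sx (solvable_lin e (pue _ _ _ _ sue)); congr solvable.
by rewrite subrK.
Qed.

Lemma quotient_solvable (X V Q : lmodType R) (e : {linear X -> V}) (p : {linear V -> Q})
   m n (D : 'M[R]_(m, n)) (v : 'I_m -> V) :
  (forall y, exists x, p x = y) -> (forall x, p x = 0 <-> exists y, e y = x) ->
  solvable D (p \o v) -> exists x, solvable D (v - (e \o x : 'I_m -> V)).
Proof.
move=> psurj pker [y yE].
have /choice[w wP] : forall j, exists w, p w = y j by move=> j; apply: psurj.
have pw : p \o w = y by apply/funext.
have /choice[x xP] : forall i, exists x, e x = v i - mxact D w i.
  move=> i; apply/pker; rewrite linearB /= -[p (mxact _ _ _)]/((p \o _) i) -mxact_lin pw yE.
  by rewrite subrr.
exists x, w; apply/funext => i; rewrite [RHS]/GRing.add /= [X in _ + X]/GRing.opp /= xP.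
by rewrite opprB addrC subrK.
Qed.

(** Let u : V -> U extend h and let c_j : V -> U go through V / X and the j-th copy of Z. The
    map u + c_j extends h as well. By [pure_glue] it is pure unless j is bad for some
    system, that is, the system becomes solvable under u + c_j but not modulo X. A
    system has at most one bad j: the difference of two bad instances is solvable in the
    direct sum, hence in the j-th coordinate. There are at most k systems over V, and more
    than k indices j. *)
Lemma pure_embed_over (X V U Z : lmodType R) (J : Type) (k : Type)
    (iota : {linear direct_sum J Z -> U}) (e : {linear X -> V}) (h : {linear X -> U}) :
  embeds nat k -> embeds (ring_card R) k -> embeds V k -> ~ embeds J k ->
  pure_injective U -> pure iota -> pure e -> pure h -> flat V ->
  (forall Q (p : {linear V -> Q}), flat Q -> (forall y, exists x, p x = y) ->
     (forall x, p x = 0 <-> exists y, e y = x) -> exists q : {linear Q -> Z}, pure q) ->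
  exists2 f : {linear V -> U}, pure f & forall x, f (e x) = h x.
Proof.
move=> natk Rk Vk nJ piU piota pe ph FV emb.
have [u uP] := pure_injective_extend h piU pe.
have [Q [p [FQ psurj pker]]] := quotient_by_pure pe FV.
have [q pq] := emb Q p FQ psurj pker.
pose c j : {linear V -> U} := iota \o ds_delta j \o q \o p.
pose bad (z : formula R * seq V) j :=
  solvable (fmx z.1) (fun i => u (nth 0 z.2 i) + c j (nth 0 z.2 i)) /\
  ~ solvable (fmx z.1) (fun i => q (p (nth 0 z.2 i))).
have bad_unique z j j' : bad z j -> bad z j' -> j = j'.
  move=> [s1 ns] [s2 _]; apply: contrapT => jj'; apply: ns.
  have : solvable (fmx z.1) (iota \o (fun i => ds_delta j (q (p (nth 0 z.2 i))) - ds_delta j' (q (p (nth 0 z.2 i))))).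
    have := solvableB s1 s2; congr solvable; apply/funext => i.
    rewrite [LHS]/GRing.add /= [X in _ + X]/GRing.opp /= opprD addrACA subrr add0r.
    by rewrite -raddfB.
  move=> /piota/(solvable_lin (ds_coord j)); congr solvable.
  apply/funext => i /=; rewrite raddfB /= ds_delta_eq ds_delta_neq //.
  by rewrite subr0.
have [j jgood] : exists j, forall z, ~ bad z j.
  apply: contrapT => nogood; apply: nJ.
  have /choice[b bP] : forall j, exists z, bad z j.
    by move=> j; apply: contrapT => nb; apply: nogood; exists j => z bz; apply: nb; exists z.
  apply: (@embeds_trans (formula R * seq V)%type).
    by exists b => j j' E; apply: (@bad_unique (b j)); rewrite // E.
  by apply: embeds_prod_le => //; [apply: embeds_formula|apply: embeds_seq_le].
have lf : linear (fun v => u v + c j v).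
  by move=> a x y; rewrite !linearP scalerDr addrACA.
exists (linear_pack lf); last first.
  move=> x /=; rewrite uP.
  have /pker -> : exists y, e y = e x by exists x.
  by rewrite !raddf0 addr0.
move=> m n D v sol.
have ntE : (fun i : 'I_m => nth 0 [seq v i | i <- enum 'I_m] i) = v.
  by apply/funext => i; rewrite (nth_map i) ?size_enum_ord // nth_ord_enum.
have sq : solvable D ((q \o p) \o v).
  apply: contrapT => nsq; apply: (jgood (Formula D 0, [seq v i | i <- enum 'I_m])).
  have E (W : lmodType R) (g : V -> W) : (fun i : 'I_m => g (nth 0 [seq v i | i <- enum 'I_m] i)) = g \o v.
    by apply/funext => i /=; congr g; apply: (congr1 (@^~ i) ntE).
  split=> /=; last by rewrite (E _ (q \o p)).
  by rewrite (E _ (fun w => u w + c j w)).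
have sc : solvable D (c j \o v).
  exact: (solvable_lin (iota \o ds_delta j : {linear Z -> U}) sq).
apply: (@pure_glue X V U Z e u (q \o p)) => //.
- by rewrite (_ : u \o e = h) //; apply/funext => x /=; rewrite uP.
- by move=> /pq; apply: quotient_solvable.
- have := solvableB sol sc; congr solvable; apply/funext => i.
  by rewrite [LHS]/GRing.add /= [X in _ + X]/GRing.opp /= addrK.
Qed.

End Splitting.


(** * Limit models *)

Section LimitModels.
Variable R : nzRingType.
Implicit Types M N W C : lmodType R.

Fact submodule_val_linear M (S : submodClosed M) : linear (fun x : submodule_type S => val x).
Proof. by []. Qed.
Definition submodule_val M (S : submodClosed M) : {linear submodule_type S -> M} :=
  linear_pack (@submodule_val_linear M S).
Lemma submodule_val_inj M (S : submodClosed M) : injective (@submodule_val M S).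
Proof. exact: val_inj. Qed.

Lemma submodule_incl_linear M (S T : submodClosed M) (ST : {subset S <= T}) :
  linear (submodule_incl ST).
Proof. by move=> a x y; apply: val_inj. Qed.

Lemma submodule_val_range M (S : submodClosed M) x : x \in S -> exists y, submodule_val S y = x.
Proof. by move=> xS; exists (exist _ x xS). Qed.

Lemma pure_submod_closed M (S : set M) : pure_submod S ->
  exists T : submodClosed M, (forall x, x \in T <-> S x) /\ pure (submodule_val T).
Proof.
move=> [subS pS]; have [T TS] := submod_of_set subS; exists T; split=> // m n D p sp.
have [|y Sy yE] := pS _ _ _ _ _ sp; first by move=> i; apply/TS/valP.
have /choice[z zE] : forall j, exists z, submodule_val T z = y j.
  by move=> j; apply/submodule_val_range/TS.
exists z; apply: (solvable_comp_inj (@submodule_val_inj _ T)); rewrite -yE; congr mxact.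
exact/funext.
Qed.

Lemma submodule_incl_pure M (S T : submodClosed M) (ST : {subset S <= T}) :
  pure (submodule_val S) -> pure_embedding (submodule_incl ST).
Proof.
move=> pS; apply: (@pure_embedding_pack _ _ _ (linear_pack (submodule_incl_linear ST))).
exact: (@pure_compl _ _ _ _ (submodule_incl ST) (submodule_val T) pS).
Qed.

Definition is_universal_for (k : Type) W : Prop :=
  forall C, flat C -> embeds C k -> exists f : {linear C -> W}, pure f.

(** The extension of N by the direct summand C has the size of N. *)
Lemma universal_over_universal (lam : cardinal) N M (iota : N -> M) :
  embeds nat lam -> flat N -> embeds lam N -> universal_over iota -> is_universal_for lam M.
Proof.
move=> natl FN lN [_ univ] C FC Cl.
have natN := embeds_trans natl lN.
have [|||f /pure_embeddingP[g _ pg] _] := univ (N * C)%type (linear_inl N C).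
- exact: flat_prod.
- apply/cleP; apply: (embeds_prod_le natN (embeds_refl N)); exact: embeds_trans lN.
- by apply: pure_embedding_pack; apply: (@pure_retract _ _ _ _ (linear_fst _ _)).
exists (g \o linear_inr N C : {linear C -> M}).
apply: (@pure_comp _ _ _ _ (linear_inr N C) g) => //.
by apply: (@pure_retract _ _ _ _ (linear_snd _ _)).
Qed.

Section Chain.
Variables (lam : cardinal) (M : lmodType R) (A : cardinal) (le : rel A) (X : A -> submodClosed M).
Hypotheses (lim : is_limit_ordinal le) (chainX : is_limit_model_chain lam le X).

Let wo : well_order le. Proof. by case: lim. Qed.

Lemma chain_sub i j : le i j -> {subset X i <= X j}.
Proof. by case: chainX => _ H _ _ _ /H[]. Qed.

Lemma chain_cover n (x : 'I_n -> M) : exists i, forall j, x j \in X i.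
Proof.
have [_ _ _ _ cov] := chainX; have [_ [i0] _] := lim.
elim: n x => [|n IH] x; first by exists i0 => -[].
have [i iP] := IH (fun j => x (lift ord0 j)); have [i' i'P] := cov (x ord0).
have [ii'|i'i] := wo_total wo i i'.
  exists i' => j; case: (unliftP ord0 j) => [j' ->|->//]; exact: chain_sub ii' _ (iP j').
exists i => j; case: (unliftP ord0 j) => [j' ->|->]; first exact: iP.
exact: chain_sub i'i _ i'P.
Qed.

Lemma chain_pure i : pure (submodule_val (X i)).
Proof.
move=> m n D p [y yE]; have [j jP] := chain_cover y.
have [j' [jj' ij']] : exists j', le j j' /\ le i j'.
  by have [ij|ji] := wo_total wo i j; [exists j|exists i]; split=> //; apply: wo_refl.
have [_ /(_ i j' ij')[Xij /pure_embeddingP[g gE pg]] _ _ _] := chainX.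
apply: pg; have /choice[z zE] : forall l, exists z, submodule_val (X j') z = y l.
  by move=> l; apply: submodule_val_range; apply: chain_sub jj' _ (jP l).
exists z; apply: (solvable_comp_inj (@submodule_val_inj _ (X j'))).
rewrite (_ : _ \o z = y); last exact/funext.
by rewrite yE gE.
Qed.

Lemma chain_flat : flat M.
Proof.
apply: flat_locally => n x; have [i iP] := chain_cover x.
exists (submodule_type (X i)), (submodule_val (X i)); split.
- by have [fX _ _ _ _] := chainX; case: (fX i).
- exact: submodule_val_inj.
- have /choice[y yE] : forall l, exists z, submodule_val (X i) z = x l.
    by move=> l; apply: submodule_val_range.
  by exists y; apply/funext => l; rewrite -(yE l).
Qed.

Lemma chain_card i : embeds (submodule_type (X i)) lam /\ embeds lam (submodule_type (X i)).
Proof. by have [fX _ _ _ _] := chainX; case: (fX i) => _ /ceqP. Qed.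

Lemma chain_universal : embeds nat lam -> is_universal_for lam M.
Proof.
move=> natl; have [_ [i] /(_ i)[j ij]] := lim.
have [fl _ _ un _] := chainX.
have [Xij univ] := un i j ij; have [Xl lX] := chain_card i.
move=> C FC Cl; have [f pf] := universal_over_universal natl (fl i).1 lX univ FC Cl.
by exists (submodule_val (X j) \o f); apply: pure_comp pf _; apply: chain_pure.
Qed.

End Chain.

Lemma limit_model_flat lam M : is_lambda_limit_model lam M -> flat M.
Proof. by move=> [_ [A [le [X [lim _ ch]]]]]; apply: chain_flat lim ch. Qed.

Lemma below_succ_embeds (A k : cardinal) : below_succ_cardinal A k -> embeds A k.
Proof.
move=> [k' [[_ kmin] [_ nk'A]]]; apply: contrapT => nA; apply: nk'A; apply: kmin.
by split; [apply/cleP/not_embeds|move=> /cleP].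
Qed.

Lemma limit_model_card lam M : is_lambda_limit_model lam M -> embeds M lam.
Proof.
move=> [/cinfiniteP natl [A [le [X [lim /below_succ_embeds Al ch]]]]].
suff /(@small_module _ M lam M idfun) : small lam [set: M] by apply.
have := @small_bigcup lam natl A M (fun i => [set x | x \in X i]) Al.
move=> H; apply: small_sub (H _) => [x _|i]; first by have [_ _ _ _] := ch; apply.
have [[f fi] _] := chain_card ch i; apply/(small_embeds natl).
exists (fun z : {x | x \in X i} => f z) => z z' /fi; by [].
Qed.

Lemma limit_model_universal lam M : is_lambda_limit_model lam M -> is_universal_for lam M.
Proof.
by move=> [/cinfiniteP natl [A [le [X [lim _ ch]]]]]; apply: chain_universal lim ch natl.
Qed.

(** ** A limit model of countable cofinality *)

Lemma nat_well_order : well_order leq.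
Proof.
apply: antisymmetric_well_order => [m n|P [n0 Pn0]]; first by rewrite -eqn_leq => /eqP.
have [n Pn nmin] := ex_minnP (ex_intro (fun n => n \in P) n0 Pn0).
by exists n; split=> // m; apply: nmin.
Qed.

Lemma nat_next (m n : nat) : is_next leq m n <-> n = m.+1.
Proof.
split=> [[]|->].
  rewrite inE /= -ltnNge => mn lb; apply/eqP; rewrite eqn_leq mn andbT.
  by apply: lb; rewrite inE /= -ltnNge.
by split=> [|l]; rewrite inE /= -ltnNge.
Qed.

Lemma nat_limit_ordinal : is_limit_ordinal leq.
Proof.
split; [exact: nat_well_order|by exists; exact: 0%N|].
by move=> n; exists n.+1; apply/nat_next.
Qed.

Lemma nat_not_limit_point n : ~ is_limit_point leq n.
Proof.
case=> [[j]]; rewrite -ltnNge; case: n => // n _ /(_ n); apply; exact/nat_next.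
Qed.

Section OmegaLimit.
Variables (lam : cardinal) (W : lmodType R).
Hypotheses (natl : embeds nat lam) (FW : flat W) (piW : pure_injective W).
Hypotheses (Wl : embeds W lam) (lW : embeds lam W) (univW : is_universal_for lam W).
Local Notation S := (direct_sum nat W).

Let initial (n : nat) : set S := [set f | forall i, (n < i)%N -> ds_coord i f = 0].

Let truncate (n : nat) : exists t : {linear S -> S},
  forall f i, ds_coord i (t f) = if (i <= n)%N then ds_coord i f else 0.
Proof.
have [t tP] := ds_lift (fun i => if (i <= n)%N then (ds_delta i : {linear W -> S}) else (\0 : {linear W -> S})).
exists t => f i; elim/ds_ind: f => [|j w f IH].
  by rewrite !raddf0 if_same.
rewrite !linearD /= IH tP; case: ifP => // jn.
  rewrite !ds_deltaE; case: asboolP => [->|_]; rewrite ?jn //.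
  by case: ifP => // _; rewrite !add0r.
rewrite raddf0 add0r; case: ifP => // iN; rewrite ds_delta_neq ?add0r // => ij.
by rewrite -ij iN in jn.
Qed.

Let initial_pure n : pure_submod (initial n).
Proof.
have [t tP] := truncate n; split.
  split; first by move=> i _; rewrite raddf0.
  by move=> a f g fn gn i ni; rewrite linearP /= fn // gn // scaler0 addr0.
move=> m k D p pn [y yE]; exists (t \o y).
  by move=> j i ni; rewrite /= tP leqNgt ni.
rewrite mxact_lin yE; apply/funext => j /=; apply: ds_ext => i; rewrite tP.
by case: leqP => // /pn ->.
Qed.

Let initial_card n (N : lmodType R) (f : {linear N -> S}) : injective f ->
  (forall x, initial n x <-> exists y, f y = x) -> embeds N lam /\ embeds lam N.
Proof.
move=> injf fN; split.
  apply: (@embeds_trans S); first by exists f.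
  exact: embeds_direct_sum.
apply: embeds_trans lW _.
have /choice[g gP] : forall w, exists y, f y = ds_delta 0%N w.
  by move=> w; apply/fN => i; case: i => // i _; rewrite ds_delta_neq.
by exists g => x y E; have := gP x; rewrite E gP => /(congr1 (ds_coord 0%N)); rewrite !ds_delta_eq.
Qed.

(** A finite power of W is pure injective: limits are taken coordinatewise. *)
Let initial_pure_injective n (N : lmodType R) (f : {linear N -> S}) : injective f ->
  (forall x, initial n x <-> exists y, f y = x) -> pure_injective N.
Proof.
move=> injf fN; apply/algebraically_compact_pure_injective/has_limits_algebraically_compact.
move=> I le dle; have [lim [limc lim0]] := pure_injective_has_limits piW dle.
have mk (F : I -> N) : exists y, forall i, (i <= n)%N -> ds_coord i (f y) = lim (fun j => ds_coord i (f (F j))).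
  have [g gP] : exists g : S, forall i, ds_coord i g = if (i <= n)%N then lim (fun j => ds_coord i (f (F j))) else 0.
    apply: (@ds_make_list _ _ _ _ (iota 0 n.+1)) => i; case: ifP => [|_]; last by rewrite eqxx.
    rewrite -ltnS => iN _; have : i \in iota 0 n.+1 by rewrite mem_iota.
    elim: (iota 0 n.+1) => //= j l IH; rewrite inE => /orP[/eqP ->|/IH]; by [left|right].
  have /fN[y yg] : initial n g by move=> i ni; rewrite gP leqNgt ni.
  by exists y => i iN; rewrite yg gP iN.
have /choice[L LP] := mk.
have fext y y' : (forall i, (i <= n)%N -> ds_coord i (f y) = ds_coord i (f y')) -> y = y'.
  move=> E; apply: injf; apply: ds_ext => i; have [/E//|ni] := leqP i n.
  have H z : ds_coord i (f z) = 0.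
    by have /fN : exists z', f z' = f z; [exists z|apply].
  by rewrite !H.
have lL : linear L.
  move=> a F G; apply: fext => i iN; rewrite linearP /= linearP /= !LP // -linearP.
  by congr (lim _); apply/funext => j; rewrite linearP /= linearP.
exists (linear_pack lL); split=> [c|F i0 F0]; apply: fext => i iN; rewrite /= LP //.
rewrite !raddf0; apply: (lim0 _ i0) => j /F0 ->; by rewrite !raddf0.
Qed.

(** Since N = W^(n+1) is pure injective, r retracts its extension N' onto it. The quotient Q of
    N' by N is flat and embeds purely in W, that is, in the next copy. The sum of r and
    this embedding goes to W^(n+2). *)
Let initial_universal n (N P N' : lmodType R) (f : {linear N -> S}) (g : {linear P -> S})
    (inc : {linear N -> P}) (e : {linear N -> N'}) :
  pure f -> pure g ->
  (forall x, initial n x <-> exists y, f y = x) -> (forall x, initial n.+1 x <-> exists y, g y = x) ->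
  (forall x, g (inc x) = f x) -> flat N' -> embeds N' lam -> pure e ->
  exists2 h : {linear N' -> P}, pure h & forall x, h (e x) = inc x.
Proof.
move=> pf pg fN gP incP FN' N'l pe.
have piN := initial_pure_injective (pure_inj pf) fN.
have [r rP] := pure_injective_extend idfun piN pe.
have [Q [p [FQ psurj pker]]] := quotient_by_pure pe FN'.
have Ql : embeds Q lam.
  exact: embeds_trans (surjection_embeds psurj) N'l.
have [q pq] := univW FQ Ql.
pose c : {linear N' -> S} := ds_delta n.+1 \o q \o p.
have /choice[h hE] : forall x, exists y, g y = f (r x) + c x.
  move=> x; apply/gP => i ni; rewrite linearD /=.
  have /fN -> : exists y, f y = f (r x) by exists (r x).
    by rewrite ds_delta_neq ?addr0 // => E; rewrite E ltnn in ni.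
  exact: ltnW.
have lh : linear h.
  move=> a x y; apply: (pure_inj pg); rewrite linearP !hE !linearP scalerDr addrACA.
  by [].
have ce x : c (e x) = 0.
  by rewrite /c /=; have /pker -> : exists y, e y = e x; [exists x|rewrite !raddf0].
exists (linear_pack lh) => [m k D v sol|x]; last first.
  by apply: (pure_inj pg); rewrite /= hE ce addr0 incP rP.
have gsol : solvable D (fun i => f (r (v i)) + c (v i)).
  by have := solvable_lin g sol; congr solvable; apply/funext => i /=; rewrite hE.
have [t tP] := truncate n.
have sr : solvable D (r \o v).
  apply: pf; have := solvable_lin t gsol; congr solvable; apply/funext => i /=.
  rewrite linearD /=; apply: ds_ext => j; rewrite linearD /= !tP; case: leqP => [jn|nj].
    by rewrite ds_delta_neq ?addr0 // => E; rewrite E ltnn in jn.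
  by rewrite add0r; have /fN -> : exists y, f y = f (r (v i)) by [exists (r (v i))].
have sq : solvable D ((q \o p) \o v).
  have := solvable_lin (ds_coord n.+1) gsol; congr solvable; apply/funext => i /=.
  rewrite linearD /=.
  have /fN -> // : exists y, f y = f (r (v i)) by exists (r (v i)).
  by rewrite add0r ds_delta_eq.
apply: (@pure_glue R N N' N W e r (q \o p)) => //.
- rewrite (_ : r \o e = idfun); first exact: pure_id.
  by apply/funext => x /=; rewrite rP.
- by move=> /pq; apply: quotient_solvable.
Qed.

(** The chain of the finite partial sums of W^(N). *)
Lemma omega_limit_model : is_lambda_limit_model lam S.
Proof.
split; first exact/cinfiniteP.
have /choice[X XP] : forall n, exists T : submodClosed S,
    (forall x, x \in T <-> initial n x) /\ pure (submodule_val T).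
  by move=> n; apply/pure_submod_closed/initial_pure.
have XN n x : initial n x <-> exists y, submodule_val (X n) y = x.
  have [XE _] := XP n; rewrite -XE; split=> [|[y <-]]; [exact: submodule_val_range|exact: valP].
have Xsub m n : (m <= n)%N -> {subset X m <= X n}.
  move=> mn x; have [XEm _] := XP m; have [XEn _] := XP n.
  by move=> /XEm xm; apply/XEn => i ni; apply: xm; apply: leq_ltn_trans ni.
exists nat, leq, X; split; [exact: nat_limit_ordinal|exact: below_succ|split].
- move=> n; have [_ pX] := XP n; split.
    by apply: flat_pure_sub pX _; apply: flat_direct_sum.
  by apply/ceqP; apply: (initial_card (@submodule_val_inj _ (X n)) (@XN n)).
- move=> m n mn; exists (Xsub m n mn); apply: submodule_incl_pure.
  by have [] := XP m.
- by move=> n /nat_not_limit_point.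
- move=> m n /nat_next ->; exists (Xsub m m.+1 (leqnSn m)); split.
    have [Xm mX] := initial_card (@submodule_val_inj _ (X m)) (@XN m).
    have [Xm' mX'] := initial_card (@submodule_val_inj _ (X m.+1)) (@XN m.+1).
    by apply/ceqP; split; [apply: embeds_trans mX|apply: embeds_trans mX'].
  move=> N' e0 FN' /cleP N'X /pure_embeddingP[e eE pe].
  have [Xm _] := initial_card (@submodule_val_inj _ (X m)) (@XN m).
  have [_ pXm] := XP m; have [_ pXm'] := XP m.+1.
  have [h ph hP] := @initial_universal m _ _ N' (submodule_val (X m)) (submodule_val (X m.+1))
    (linear_pack (submodule_incl_linear (Xsub m m.+1 (leqnSn m)))) e pXm pXm' (@XN m) (@XN m.+1)
    (fun x => erefl) FN' (embeds_trans N'X Xm) pe.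
  by exists h; [apply: pure_embedding_pack|rewrite -eE].
- move=> f; have [s sP] := ds_list f; exists (\max_(i <- s) i)%N.
  have [XE _] := XP (\max_(i <- s) i)%N; apply/XE => i ni.
  by apply/eqP; case: eqP => // /eqP /sP /leq_max_list; rewrite leqNgt ni.
Qed.

End OmegaLimit.

End LimitModels.


(** * Uniqueness of limit models when flat modules are pure injective *)

Lemma ceq_bijection (A B : Type) : embeds A B -> embeds B A -> exists f : A -> B, bijective f.
Proof.
move=> AB BA; have /card_bijP[f [g fg gf]] : ceq A B by apply/ceqP.
exists (fun x => val (f (exist _ x (in_setT x)))), (fun y => val (g (exist _ y (in_setT y)))).
  move=> x; rewrite (_ : exist _ _ _ = f (exist _ x (in_setT x))) ?fg //.
  exact: val_inj.
move=> x; rewrite (_ : exist _ _ _ = g (exist _ x (in_setT x))) ?gf //.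
exact: val_inj.
Qed.

Section Isomorphisms.
Variable R : nzRingType.
Implicit Types M N P Q D : lmodType R.

Lemma iso_make M N (f : {linear M -> N}) (g : {linear N -> M}) :
  cancel f g -> cancel g f -> isomorphic M N.
Proof. by move=> fg gf; exists f, g. Qed.

Lemma iso_inverse M N : isomorphic M N ->
  exists (f : {linear M -> N}) (g : {linear N -> M}), cancel f g /\ cancel g f.
Proof.
move=> [f [g fg gf]]; have lg : linear g.
  by move=> a x y; apply: (can_inj fg); rewrite gf linearP /= !gf.
by exists f, (linear_pack lg).
Qed.

Lemma iso_sym M N : isomorphic M N -> isomorphic N M.
Proof. by move=> /iso_inverse[f [g [fg gf]]]; apply: iso_make gf fg. Qed.

Lemma iso_trans N M P : isomorphic M N -> isomorphic N P -> isomorphic M P.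
Proof.
move=> [f bf] [g bg]; exists (g \o f : {linear M -> P}); exact: bij_comp.
Qed.

Lemma iso_prod M M' N N' : isomorphic M M' -> isomorphic N N' -> isomorphic (M * N)%type (M' * N')%type.
Proof.
move=> /iso_inverse[f [f' [ff' f'f]]] /iso_inverse[g [g' [gg' g'g]]].
have l1 : linear (fun z : M * N => (f z.1, g z.2)).
  by move=> a x y; rewrite -[RHS]/(a *: f x.1 + f y.1, a *: g x.2 + g y.2) -!linearP.
have l2 : linear (fun z : M' * N' => (f' z.1, g' z.2)).
  by move=> a x y; rewrite -[RHS]/(a *: f' x.1 + f' y.1, a *: g' x.2 + g' y.2) -!linearP.
apply: (iso_make (f := linear_pack l1) (g := linear_pack l2)) => -[x y] /=.
  by rewrite ff' gg'.
by rewrite f'f g'g.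
Qed.

Lemma iso_refl M : isomorphic M M.
Proof. by exists idfun; exists idfun. Qed.

Lemma iso_prodA M N P : isomorphic (M * (N * P))%type ((M * N) * P)%type.
Proof.
have l1 : linear (fun z : (M * (N * P))%type => ((z.1, z.2.1), z.2.2)) by [].
have l2 : linear (fun z : ((M * N) * P)%type => (z.1.1, (z.1.2, z.2))) by [].
by apply: (iso_make (f := linear_pack l1) (g := linear_pack l2)); [move=> [x [y z]]|move=> [[x y] z]].
Qed.

Lemma iso_split M N (i : {linear N -> M}) (r : {linear M -> N}) : cancel i r ->
  exists D (j : {linear D -> M}) (s : {linear M -> D}), cancel j s /\ isomorphic M (N * D)%type.
Proof.
move=> ir; have [D [j [injj jP]]] := kernel_module r.
have /choice[s sP] : forall x, exists d, j d = x - i (r x).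
  by move=> x; apply/jP; rewrite linearB /= ir subrr.
have ls : linear s.
  by move=> a x y; apply: injj; rewrite (linearP j) !sP (linearP r) (linearP i) scalerBr opprD addrACA.
have rj d : r (j d) = 0 by apply/jP; exists d.
have js : cancel j (linear_pack ls).
  by move=> d; apply: injj; rewrite /= sP rj raddf0 subr0.
exists D, j, (linear_pack ls); split=> //.
have l1 : linear (fun x => (r x, s x)).
  by move=> a x y; rewrite -[RHS]/(a *: r x + r y, a *: s x + s y) (linearP r) ls.
have l2 : linear (fun z : (N * D)%type => i z.1 + j z.2).
  by move=> a x y; rewrite /= (linearP i) (linearP j) scalerDr addrACA.
apply: (iso_make (f := linear_pack l1) (g := linear_pack l2)) => [x|[x d]] /=.
  by rewrite sP addrC subrK.
have E : r (i x + j d) = x by rewrite linearD /= ir rj addr0.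
by rewrite E; congr pair; apply: injj; rewrite sP E addrC addKr.
Qed.

Lemma ds_map I M N (h : {linear M -> N}) :
  exists H : {linear direct_sum I M -> direct_sum I N}, forall i f, ds_coord i (H f) = h (ds_coord i f).
Proof.
have [H HP] := ds_lift (fun i => ds_delta i \o h : {linear M -> direct_sum I N}).
exists H => i; apply: (ds_lin_ext (h := ds_coord i \o H) (h' := h \o ds_coord i)) => j m.
rewrite -[LHS]/(ds_coord i (H (ds_delta j m))) -[RHS]/(h (ds_coord i (ds_delta j m))) HP.
rewrite -[X in ds_coord i X]/(ds_delta j (h m)) !ds_deltaE.
by case: asboolP => // _; rewrite raddf0.
Qed.

Lemma iso_ds I M N : isomorphic M N -> isomorphic (direct_sum I M) (direct_sum I N).
Proof.
move=> /iso_inverse[f [g [fg gf]]].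
have [F FP] := ds_map I f; have [G GP] := ds_map I g.
apply: (iso_make (f := F) (g := G)) => x; apply: ds_ext => i.
  by rewrite GP FP fg.
by rewrite FP GP gf.
Qed.

Lemma iso_ds_prod I M N :
  isomorphic (direct_sum I (M * N)%type) (direct_sum I M * direct_sum I N)%type.
Proof.
have [p1 p1P] := ds_map I (linear_fst M N); have [p2 p2P] := ds_map I (linear_snd M N).
have [i1 i1P] := ds_map I (linear_inl M N); have [i2 i2P] := ds_map I (linear_inr M N).
have l2 : linear (fun z : (direct_sum I M * direct_sum I N)%type => i1 z.1 + i2 z.2).
  by move=> a x y; rewrite /= (linearP i1) (linearP i2) scalerDr addrACA.
have E (a b : direct_sum I M * direct_sum I N) : a.1 = b.1 -> a.2 = b.2 -> a = b.
  by case: a b => [? ?] [? ?] /= -> ->.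
apply: (iso_make (f := linear_pair p1 p2) (g := linear_pack l2)) => [f|[f g]].
  apply: ds_ext => i; rewrite -[LHS]/(ds_coord i (i1 (p1 f) + i2 (p2 f))).
  rewrite ds_coordD i1P i2P p1P p2P.
  rewrite -[LHS]/((ds_coord i f).1 + 0, 0 + (ds_coord i f).2) addr0 add0r.
  by case: (ds_coord i f).
apply: E => /=; apply: ds_ext => i; rewrite ?p1P ?p2P ds_coordD i1P i2P.
  by rewrite -[LHS]/(ds_coord i f + 0) addr0.
by rewrite -[LHS]/(0 + ds_coord i g) add0r.
Qed.

Lemma ds_push (I J : Type) M (g : J -> I) : injective g ->
  exists H : {linear direct_sum J M -> direct_sum I M},
    (forall j f, ds_coord (g j) (H f) = ds_coord j f) /\
    (forall i f, (forall j, g j <> i) -> ds_coord i (H f) = 0).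
Proof.
move=> gi; have [H HP] := ds_lift (fun j => ds_delta (g j) : {linear M -> direct_sum I M}).
exists H; split=> [j f|i f ng]; elim/ds_ind: f => [|j' m f IH]; rewrite ?raddf0 //.
  rewrite (linearD H) !ds_coordD IH HP; congr (_ + _); rewrite !ds_deltaE.
  by congr (if _ then _ else _); apply/asboolP/asboolP => [/gi|->].
by rewrite (linearD H) ds_coordD IH HP ds_delta_neq ?addr0 // => /esym; apply: ng.
Qed.

Lemma iso_ds_reindex (I J : Type) M : embeds I J -> embeds J I ->
  isomorphic (direct_sum I M) (direct_sum J M).
Proof.
move=> IJ JI; have [g [h gh hg]] := ceq_bijection IJ JI.
have [G [GP _]] := ds_push M (can_inj gh); have [H [HP _]] := ds_push M (can_inj hg).
apply: (iso_make (f := G) (g := H)) => f; apply: ds_ext => i.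
  by rewrite -{1}(gh i) HP GP.
by rewrite -{1}(hg i) GP HP.
Qed.

Lemma iso_ds_nat M : isomorphic (M * direct_sum nat M)%type (direct_sum nat M).
Proof.
have [H [HS H0]] := ds_push M (succn_inj : injective S).
have /choice[T TP] : forall f : direct_sum nat M, exists g : direct_sum nat M, forall n, ds_coord n g = ds_coord n.+1 f.
  move=> f; apply: ds_make; have := ds_finite f; have := @finite_preimage nat nat.
  move=> fp; apply: (fp [set i | ds_coord i f != 0] S) => //.
  by move=> x y _ _ [].
have lT : linear T.
  by move=> a f g; apply: ds_ext => n; rewrite linearP /= !TP linearP.
have l1 : linear (fun z : (M * direct_sum nat M)%type => ds_delta 0%N z.1 + H z.2).
  by move=> a x y; rewrite !linearP /= scalerDr addrACA.
have l2 : linear (fun f : direct_sum nat M => (ds_coord 0%N f, T f)).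
  by move=> a f g; rewrite -[RHS]/(a *: ds_coord 0%N f + ds_coord 0%N g, a *: T f + T g) lT linearP.
apply: (iso_make (f := linear_pack l1) (g := linear_pack l2)) => [[m f]|f] /=.
  congr pair.
    by rewrite ds_coordD ds_delta_eq H0 ?addr0.
  by apply: ds_ext => n; rewrite TP ds_coordD ds_delta_neq // add0r HS.
apply: ds_ext => -[|n]; rewrite ds_coordD; first by rewrite ds_delta_eq H0 ?addr0.
by rewrite ds_delta_neq // add0r HS TP.
Qed.

Lemma iso_ds_ds (I J : Type) M :
  isomorphic (direct_sum I (direct_sum J M)) (direct_sum (I * J)%type M).
Proof.
have /choice[h hP] : forall i, exists h : {linear direct_sum J M -> direct_sum (I * J)%type M},
    forall j m, h (ds_delta j m) = ds_delta (i, j) m.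
  by move=> i; apply: (ds_lift (fun j => ds_delta (i, j) : {linear M -> direct_sum (I * J)%type M})).
have [F FP] := ds_lift h.
have [G GP] := ds_lift (fun z : (I * J)%type => ds_delta z.1 \o ds_delta z.2 : {linear M -> direct_sum I (direct_sum J M)}).
have FG : cancel G F.
  move=> f; apply: (ds_lin_ext (h := F \o G) (h' := idfun)) => -[i j] m /=.
  by rewrite GP /= FP hP.
apply: iso_make FG.
suff H i : (G \o F \o ds_delta i : {linear _ -> _}) =1 (ds_delta i : {linear direct_sum J M -> _}).
  by move=> f; apply: (ds_lin_ext (h := G \o F) (h' := idfun)) => i m; apply: H.
by apply: ds_lin_ext => j m /=; rewrite FP hP GP.
Qed.

(** Eilenberg's swindle: if F = D + Q, then F = D^(N) + Q^(N), and D^(N) absorbs another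
    copy of D. *)
Lemma free_absorbs (lam : Type) D (j : {linear D -> direct_sum lam (R^o : lmodType R)})
   (s : {linear direct_sum lam (R^o : lmodType R) -> D}) : embeds nat lam -> cancel j s ->
  isomorphic (direct_sum lam (R^o : lmodType R) * D)%type (direct_sum lam (R^o : lmodType R)).
Proof.
set F := direct_sum lam _ => natl js.
have [Q [_ [_ [_ FDQ]]]] := iso_split js.
have FFn : isomorphic F (direct_sum nat D * direct_sum nat Q)%type.
  apply: iso_trans (iso_ds_prod nat D Q); apply: iso_trans (iso_ds nat FDQ).
  apply: iso_trans (iso_sym (iso_ds_ds nat lam _)); apply: iso_ds_reindex.
    by have [f fi] := natl; exists (fun x => (0%N, x)) => x y [].
  by apply: embeds_prod_le => //; apply: embeds_refl.
have swap : isomorphic (F * D)%type (D * F)%type.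
  have l1 : linear (fun z : (F * D)%type => (z.2, z.1)) by [].
  have l2 : linear (fun z : (D * F)%type => (z.2, z.1)) by [].
  by apply: (iso_make (f := linear_pack l1) (g := linear_pack l2)) => -[].
apply: iso_trans swap _; apply: iso_trans (iso_prod (iso_refl D) FFn) _.
apply: iso_trans (iso_prodA _ _ _) _; apply: iso_trans (iso_sym FFn).
exact: iso_prod (iso_ds_nat D) (iso_refl _).
Qed.

Lemma projective_retract (lam : Type) M : embeds M lam -> projective M ->
  exists (j : {linear M -> direct_sum lam (R^o : lmodType R)}) (s : {linear direct_sum lam (R^o : lmodType R) -> M}),
    cancel j s.
Proof.
move=> Ml pM; have [g gsurj] := embeds_surjection (inhabits 0) Ml.
have [s ssurj] := free_cover gsurj.
have [j jP] := pM _ _ s idfun ssurj.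
by exists j, s.
Qed.

Section PureInjectiveFlats.
Hypothesis fpi : flats_pure_injective R.
Variable lam : cardinal.
Hypotheses (natl : embeds nat lam) (Rl : embeds (ring_card R) lam).
Local Notation F := (direct_sum lam (R^o : lmodType R)).

(** The free module F embeds purely in M by universality, hence M = F + D. As flat modules
    are projective, D is a summand of F and is absorbed. *)
Lemma limit_model_free M : is_lambda_limit_model lam M -> isomorphic M F.
Proof.
move=> limM; have FM := limit_model_flat limM.
have [i pi] := limit_model_universal limM (@flat_free R lam) (embeds_free_sum natl Rl).
have [r ri] := pure_injective_extend idfun (fpi (@flat_free R lam)) pi.
have [D [j [s [js MFD]]]] := iso_split ri.
have FD : flat D := flat_pure_sub (pure_retract js) FM.
have Dl : embeds D lam.
  apply: embeds_trans (limit_model_card limM).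
  by exists j; apply: can_inj js.
have [j' [s' js']] := projective_retract Dl (pure_injective_perfect fpi FD).
exact: iso_trans MFD (free_absorbs natl js').
Qed.

Lemma pure_injective_uniqueness : uniqueness_of_limit_models R lam.
Proof.
split=> [|M N lM lN].
  exists (direct_sum nat F); apply: omega_limit_model => //.
  - exact: flat_free.
  - exact/fpi/flat_free.
  - exact: embeds_free_sum.
  - exact: embeds_free_basis.
  move=> C FC Cl; have [j [s js]] := projective_retract Cl (pure_injective_perfect fpi FC).
  by exists j; apply: pure_retract js.
exact: iso_trans (limit_model_free lM) (iso_sym (limit_model_free lN)).
Qed.

End PureInjectiveFlats.

Lemma pure_injective_sigma M : flats_pure_injective R -> is_limit_model M -> sigma_pure_injective M.
Proof.
by move=> fpi [lam /limit_model_flat FM] I; apply/fpi/flat_direct_sum.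
Qed.

(** An infinite descending chain in a flat module N has countably many witnesses, which lie
    in a pure submodule of size at most |R| + aleph_0; this submodule embeds in M. *)
Lemma dcc_flats_pure_injective M :
  is_universal_for (ring_card R) M -> ~ unstable_chain M -> flats_pure_injective R.
Proof.
move=> univ dcc N FN.
apply/algebraically_compact_pure_injective/dcc_algebraically_compact => -[psi [a [a1 a2]]].
have natR := nat_ring_card R.
have [|S [aS pS smS]] := @pure_closure R N (ring_card R) (range a) natR (embeds_refl _).
  exact: small_range.
have [P [i [pi iS]]] := pure_submod_module pS.
have Pl : embeds P (ring_card R).
  by apply: (small_module (pure_inj pi) _ smS) => x; apply/iS; exists x.
have [f pf] := univ P (flat_pure_sub pi FN) Pl.
apply: dcc; apply: (unstable_chain_pure pf).
have /choice[b bP] : forall n, exists b, i b = a n by move=> n; apply/iS/aS; exists n.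
have E : (fun _ : nat => 0 : N) = i \o (fun _ => 0) by apply/funext => j /=; rewrite raddf0.
exists psi, b; split=> [m n mn|n].
  by apply: (holds_pure pi); rewrite -E bP; apply: a1.
by move=> /(holds_lin i); rewrite -E bP; apply: a2.
Qed.

End Isomorphisms.


(** * Long towers are pure injective *)

Section LongTower.
Variables (k A : Type) (le : rel A).
Hypotheses (natk : embeds nat k) (wo : well_order le) (segk : forall i, embeds (segment le i) k).
Hypothesis (nAk : ~ embeds A k).

(** A is a regular cardinal, being the successor of k: few segments of size k do not cover it. *)
Lemma long_bounded (B : Type) (g : B -> A) : embeds B k -> exists i, forall b, le (g b) i.
Proof.
move=> Bk; apply: contrapT => unb; apply: nAk.
have cov i : exists b, strict le i (g b).
  apply: contrapT => nb; apply: unb; exists i => b; apply/(strictNle le) => H.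
  by apply: nb; exists b.
suff [f fi] : small k [set: A] by exists f => x y; apply: fi.
have := @small_bigcup k natk B A (fun b => [set i | strict le i (g b)]) Bk.
move=> H; apply: small_sub (H _) => [i _|b]; first exact: cov.
by apply/(small_embeds natk); apply: segk.
Qed.

Lemma long_limit_ordinal : is_limit_ordinal le.
Proof.
have inh : inhabited A.
  apply: contrapT => noA; apply: nAk; exists (fun a => False_rect k (noA (inhabits a))).
  by move=> a; case: noA.
split=> // i; have [j ij] : exists j, strict le i j.
  apply: contrapT => nj; apply: nAk.
  suff [f fi] : small k [set: A] by exists f => x y; apply: fi.
  apply: (@small_sub _ _ _ ([set j | strict le j i] `|` [set i])).
    move=> j _; have [/(le_eqVstrict wo)[->|]|ij] := wo_total wo j i; [by right|by left|].
    by have [->|ij'] := le_eqVstrict wo ij; [right|case: nj; exists j].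
  apply: small_setU => //; first by apply/(small_embeds natk); apply: segk.
  by have [k0] := infinite_point natk; exists (fun _ => k0) => x y -> ->.
by have [l jl _] := next_exists wo ij; exists l.
Qed.

Variables (R : nzRingType) (U : lmodType R) (X : A -> set U).
Hypotheses (Rk : embeds (ring_card R) k) (piU : pure_injective U).
Hypothesis Xmono : forall i j, le j i -> X j `<=` X i.
Hypothesis Xsolves : forall i (dom : set (formula R)) (p : formula R -> nat -> U),
  (forall phi n, X i (p phi n)) -> (exists x, forall phi, dom phi -> holds phi (p phi) x) ->
  exists j x, X j x /\ forall phi, dom phi -> holds phi (p phi) x.

(** The system has at most k parameters, as there are at most k formulas, so they all lie at
    one stage; a solution in U exists by compactness and is copied into a later
    stage. *)
Lemma long_tower_pure_injective (N : lmodType R) (f : {linear N -> U}) :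
  pure f -> (forall x, (exists i, X i x) <-> exists y, f y = x) -> pure_injective N.
Proof.
move=> pf fX; apply: algebraically_compact_pure_injective => dom p fin.
have [|x xP] := pure_injective_compact piU (p := fun phi => f \o p phi) (dom := dom).
  move=> s; have [x xP] := fin s; exists (f x) => phi phis dphi.
  exact/holds_lin/xP.
have /choice[g gP] : forall z : formula R * nat, exists i, X i (f (p z.1 z.2)).
  by move=> z; apply/fX; exists (p z.1 z.2).
have [|i iP] := @long_bounded (formula R * nat)%type g.
  by apply: embeds_prod_le => //; apply: embeds_formula.
have [||j [x' [Xx' x'P]]] := @Xsolves i dom (fun phi => f \o p phi).
- by move=> phi n; apply: Xmono (iP (phi, n)) _ (gP (phi, n)).
- by exists x.
have /fX[y yx] : exists i, X i x' by exists j.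
by exists y => phi dphi; apply: (holds_pure pf); rewrite yx; apply: x'P.
Qed.

End LongTower.

(** * Uniqueness of limit models implies that flat modules are pure injective *)

Section Uniqueness.
Variables (R : nzRingType) (lam : cardinal) (U Z V : lmodType R) (c : {linear Z -> V}).
Variable iota : {linear direct_sum (set lam) Z -> U}.
Hypotheses (natl : embeds nat lam) (Rl : embeds (ring_card R) lam).
Hypotheses (piU : pure_injective U) (FU : flat U) (piota : pure iota).
Hypotheses (Zl : embeds Z lam) (lZ : embeds lam Z) (univZ : is_universal_for lam Z).
Hypotheses (FV : flat V) (Vl : embeds V lam) (pc : pure c) (univc : universal_over c).

Let embed_over (X Y : lmodType R) (e : {linear X -> Y}) (h : {linear X -> U}) :
  pure e -> pure h -> flat Y -> embeds Y lam ->
  exists2 f : {linear Y -> U}, pure f & forall x, f (e x) = h x.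
Proof.
move=> pe ph FY Yl; apply: (pure_embed_over natl Rl Yl (@not_embeds_set lam) piU piota pe ph FY).
move=> Q p FQ psurj _; exact: univZ FQ (embeds_trans (surjection_embeds psurj) Yl).
Qed.

Definition universal_in (S S' : set U) : Prop :=
  forall (N N' : lmodType R) (i : {linear N -> U}) (e : {linear N -> N'}),
    pure i -> (forall x, S x <-> exists n, i n = x) -> flat N' -> embeds N' lam -> pure e ->
    exists g : {linear N' -> U}, [/\ pure g, forall y, S' (g y) & forall x, g (e x) = i x].

(** N' is an extension of N rather than of Z. It is amalgamated with Z inside U, in a small
    pure submodule, to which the universality of V over Z applies. *)
Let universal_copy (N N' : lmodType R) (h : {linear N -> Z}) (e : {linear N -> N'}) :
  pure h -> flat N' -> embeds N' lam -> pure e ->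
  exists2 g : {linear N' -> V}, pure g & forall x, g (e x) = c (h x).
Proof.
move=> ph FN' N'l pe; pose e1 : {linear Z -> U} := iota \o ds_delta set0.
have pe1 : pure e1 by apply: (pure_comp (@ds_delta_pure _ _ _ _)).
have [g1 pg1 g1P] := embed_over (h := e1 \o h) pe (pure_comp ph pe1) FN' N'l.
have [|S [XS pS smS]] := @pure_closure R U lam (range e1 `|` range g1) natl Rl.
  by apply: small_setU => //; apply: small_range.
have [Q [i [pi iS]]] := pure_submod_module pS.
have Ql : embeds Q lam by apply: (small_module (pure_inj pi) _ smS) => x; apply/iS; exists x.
have [|e1' pe1' e1'P] := pure_factor (pure_inj pi) pe1.
  by move=> y; apply/iS/XS; left; exists y.
have [|g1' pg1' g1'P] := pure_factor (pure_inj pi) pg1.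
  by move=> y; apply/iS/XS; right; exists y.
have [_ univ] := univc.
have [|||m0 /pure_embeddingP[m mE pm] mP] := univ Q e1'.
- exact: flat_pure_sub pi FU.
- by apply/cleP; apply: embeds_trans Ql lZ.
- exact: pure_embedding_pack.
exists (m \o g1') => [|x]; first exact: pure_comp pg1' pm.
rewrite /= mE -mP; congr m0; apply: (pure_inj pi).
by rewrite g1'P e1'P g1P.
Qed.

(** Embed S in Z; the extension V of Z, seen as an extension of S, embeds in U over S. *)
Lemma universal_step (S : set U) : pure_submod S -> small lam S ->
  exists S', [/\ S `<=` S', pure_submod S', small lam S' & universal_in S S'].
Proof.
move=> pS smS; have [N [i [pi iS]]] := pure_submod_module pS.
have FN := flat_pure_sub pi FU.
have Nl : embeds N lam by apply: (small_module (pure_inj pi) _ smS) => x; apply/iS; exists x.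
have [h ph] := univZ FN Nl.
have [f0 pf0 f0P] := embed_over (e := c \o h) (h := i) (pure_comp ph pc) pi FV Vl.
exists (range f0); split.
- by move=> x /iS[n <-]; exists (c (h n)) => //; apply: f0P.
- exact: pure_range.
- exact: small_range.
move=> N1 N' i1 e pi1 i1S FN' N'l pe.
have [|t pt tP] := pure_factor (pure_inj pi1) pi.
  by move=> n; apply/i1S/iS; exists n.
have [g pg gP] := universal_copy ph FN' N'l (pure_comp pt pe : pure (e \o t)).
exists (f0 \o g); split=> [|y|x]; [exact: pure_comp pg pf0|by exists (g y)|].
have /iS[n nx] : S (i1 x) by apply/i1S; exists x.
have -> : x = t n by apply: (pure_inj pi1); rewrite tP nx.
by rewrite -[LHS]/(f0 (g ((e \o t) n))) gP f0P tP.
Qed.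

(** A solution x in U of a system with parameters in X i lies in a small pure extension of X i
    inside U, which embeds over X i in the next stage, by universality. *)
Lemma long_limit_model :
  (forall A : Type, (exists le : rel A, well_order le /\ forall i, embeds (segment le i) (ring_card R)) -> embeds A lam) ->
  exists N : lmodType R, [/\ is_lambda_limit_model lam N, pure_injective N & embeds lam N].
Proof.
move=> succl.
have natR := nat_ring_card R.
have [A [le [wo segR nAR]]] := hartogs (ring_card R).
have Al : embeds A lam by apply: succl; exists le.
pose e1 : {linear Z -> U} := iota \o ds_delta set0.
have pe1 : pure e1 by apply: (pure_comp (@ds_delta_pure _ _ _ _)).
have /choice[step0 step0P] : forall S, exists S', [/\ S `<=` S',
    (pure_submod S -> pure_submod S'), (small lam S -> small lam S') &
    (pure_submod S -> small lam S -> universal_in S S')].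
  move=> S; have [[pS smS]|nS] := pselect (pure_submod S /\ small lam S).
    by have [S' [SS' pS' smS' uS']] := universal_step pS smS; exists S'.
  by exists S; split=> // pS smS; case: nS.
pose step (j : A) := step0.
have step_sub j Y : Y `<=` step j Y by have [] := step0P Y.
have [X XE] := tower_exists wo (range e1) step.
have mono := tower_mono wo XE step_sub.
have base i := tower_base XE i.
have smX : forall i, small lam (X i).
  apply: (tower_small wo XE natl) => [|i|j]; first exact: small_range.
    exact: embeds_trans (embeds_sig _) Al.
  by have [_ _ H _] := step0P (X j).
have lim : is_limit_ordinal le := long_limit_ordinal natR wo segR nAR.
have [_ [a0] nextA] := lim.
have [|pX pU] := tower_pure wo XE step_sub (inhabits a0) (pure_range pe1).
  by move=> j Y pY; have [_ H _ _] := step0P Y; apply: H.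
have uX i : universal_in (X i) (step i (X i)).
  by have [_ _ _ H] := step0P (X i); apply: H.
have [N [f [pf fX]]] := pure_submod_module pU.
have fN i x : X i x -> exists y, f y = x by move=> Xx; apply/fX; exists i.
have /choice[Y YP] : forall i, exists T : submodClosed N,
    (forall x, x \in T <-> X i (f x)) /\ pure (submodule_val T).
  move=> i; apply: (@pure_submod_closed _ N (fun x => X i (f x))).
  have [subX sX] := pX i; split.
    split; first by rewrite raddf0; exact: submod0.
    by move=> a x y Xx Xy; rewrite linearP; case: subX => _; apply.
  move=> m n D p Xp sp.
  have [y Xy yE] := sX _ _ _ (f \o p) Xp (solvable_lin f sp).
  have /choice[z zE] : forall j, exists z, f z = y j by move=> j; apply: (fN i).
  exists z; first by move=> j; rewrite zE.
  apply: (solvable_comp_inj (pure_inj pf)); rewrite -yE; congr mxact; exact/funext.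
pose v i : {linear submodule_type (Y i) -> U} := f \o submodule_val (Y i).
have pv i : pure (v i) by apply: pure_comp pf; case: (YP i).
have vX i x : X i x <-> exists n, v i n = x.
  split=> [Xx|[n <-]]; last by apply/(YP i).1/valP.
  have [y yx] := fN i x Xx.
  have [n nE] : exists n, submodule_val (Y i) n = y.
    by apply: submodule_val_range; apply/(YP i).1; rewrite yx.
  by exists n; rewrite -yx -nE.
have Yl i : embeds (submodule_type (Y i)) lam.
  by apply: (small_module (pure_inj (pv i)) _ (smX i)) => n; apply/vX; exists n.
have lY i : embeds lam (submodule_type (Y i)).
  apply: embeds_trans lZ _.
  have /choice[g gP] : forall z, exists n, v i n = e1 z by move=> z; apply/vX/base; exists z.
  by exists g => x y E; apply: (pure_inj pe1); rewrite -!gP E.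
have YY i j : le j i -> {subset Y j <= Y i}.
  by move=> ji x /(YP j).1 Xx; apply/(YP i).1/(mono _ _ ji).
have Ysucc i j : is_next le i j -> forall (N' : lmodType R) (e : {linear submodule_type (Y i) -> N'}),
    flat N' -> embeds N' lam -> pure e ->
    exists2 h : {linear N' -> submodule_type (Y j)}, pure h & forall x, v j (h (e x)) = v i x.
  move=> ij N' e FN' N'l pe.
  have [g [pg gX gP]] := uX i _ _ (v i) e (pv i) (vX i) FN' N'l pe.
  have Xj : step i (X i) = X j by rewrite (tower_next wo XE step_sub ij).
  have [|h ph hP] := pure_factor (pure_inj (pv j)) pg.
    by move=> y; apply/vX; rewrite -Xj.
  by exists h => // x; rewrite hP gP.
have limN : is_lambda_limit_model lam N.
  split; first exact/cinfiniteP.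
  exists A, le, Y; split=> //; first exact: below_succ.
  split.
  - move=> i; split; first exact: flat_pure_sub (pv i) FU.
    by apply/ceqP; split; [apply: Yl|apply: lY].
  - move=> i j ij; exists (YY j i ij); apply: submodule_incl_pure.
    by case: (YP i).
  - move=> i [ex nonext] x /(YP i).1 Xx.
    have [j [ji Xj]] := tower_limit wo XE ex nonext Xx.
    by exists j; split=> //; apply/(YP j).1.
  - move=> i j ij; exists (YY j i (strict_le wo (is_next_strict ij))).
    split; first by apply/ceqP; split; [apply: embeds_trans (Yl j) (lY i)|apply: embeds_trans (Yl i) (lY j)].
    move=> N' e0 FN' /cleP N'Y /pure_embeddingP[e eE pe].
    have [h ph hP] := Ysucc i j ij N' e FN' (embeds_trans N'Y (Yl i)) pe.
    exists h; first exact: pure_embedding_pack.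
    by move=> x; apply: (pure_inj (pv j)); rewrite -eE hP.
  - move=> x; have /fX[i Xx] : exists y, f y = f x by exists x.
    by exists i; apply/(YP i).1.
exists N; split=> //.
  refine (long_tower_pure_injective natR segR nAR (embeds_refl _) piU mono _ pf fX).
  move=> i dom p Xp [x xP].
  have [|S [XS pS smS]] := @pure_closure R U lam (X i `|` [set x]) natl Rl.
    by apply: small_setU => //; apply: small_set1.
  have [Q [q [pq qS]]] := pure_submod_module pS.
  have Ql : embeds Q lam by apply: (small_module (pure_inj pq) _ smS) => y; apply/qS; exists y.
  have [|e pe eP] := pure_factor (pure_inj pq) (pv i).
    by move=> n; apply/qS/XS; left; apply/vX; exists n.
  have [j ij] := nextA i.
  have [h ph hP] := Ysucc i j ij Q e (flat_pure_sub pq FU) Ql pe.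
  have /qS[x' x'x] : S x by apply: XS; right.
  exists j, (v j (h x')); split; first by apply/vX; exists (h x').
  move=> phi dphi.
  have /choice[n nP] : forall l, exists n, v i n = p phi l by move=> l; apply/vX.
  have : holds phi (e \o n) x'.
    apply: (holds_pure pq); rewrite x'x; have := xP phi dphi.
    rewrite (_ : q \o _ = p phi) //; by apply/funext => l /=; rewrite eP nP.
  move=> /(holds_lin (v j \o h : {linear _ -> _})).
  rewrite (_ : (v j \o h) \o _ = p phi) //; apply/funext => l.
  by rewrite -nP -hP.
apply: embeds_trans (lY a0) _.
by exists (submodule_val (Y a0)); apply: submodule_val_inj.
Qed.

End Uniqueness.

Section UniquenessPureInjective.
Variable R : nzRingType.
Hypothesis env : forall (M E : lmodType R) (e : M -> E), flat M -> is_pure_injective_envelope e -> flat E.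

Lemma flat_pure_injective_extension (M : lmodType R) : flat M ->
  exists (U : lmodType R) (f : {linear M -> U}), [/\ flat U, pure_injective U & pure f].
Proof.
move=> FM; have [E [e envE]] := envelope_exists M.
have [piE /pure_embeddingP[e' _ pe] _] := envE.
by exists E, e'; split=> //; apply: env FM envE.
Qed.

(** The inclusion of the second stage of a given limit model in the third provides the universal
    extension Z -> V; the first stage makes Z universal for flat modules of size
    lambda. *)
Lemma uniqueness_flats_pure_injective (kappa lam : cardinal) :
  is_succ_cardinal (ring_card R) kappa -> cle kappa lam -> uniqueness_of_limit_models R lam ->
  flats_pure_injective R.
Proof.
move=> [[Rk nkR] kmin] /cleP kl [[M limM] uniq].
have Rl : embeds (ring_card R) lam by apply: embeds_trans kl; apply/cleP.
have natl : embeds nat lam := embeds_trans (nat_ring_card R) Rl.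
have succl (A : Type) : (exists le : rel A, well_order le /\ forall i, embeds (segment le i) (ring_card R)) ->
    embeds A lam.
  move=> [le [wo segR]]; apply: embeds_trans kl; apply: (segments_embed wo segR).
  by move=> /cleP.
have [_ [A [le [X [lim Al ch]]]]] := limM.
have [_ [i0] nextA] := lim; have [i1 i01] := nextA i0; have [i2 i12] := nextA i1.
have [fl _ _ un _] := ch.
have [X01 univ01] := un _ _ i01; have [X12 univ12] := un _ _ i12.
have [X0l lX0] := chain_card ch i0; have [X1l lX1] := chain_card ch i1; have [X2l lX2] := chain_card ch i2.
have univZ := universal_over_universal natl (fl i0).1 lX0 univ01.
have [U [iota [FU piU piota]]] := flat_pure_injective_extension (@flat_direct_sum R (set lam) _ (fl i1).1).
have pc : pure (linear_pack (submodule_incl_linear X12)).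
  exact: (@pure_compl _ _ _ _ (submodule_incl X12) (submodule_val (X i2)) (chain_pure lim ch (i := i1))).
have [N [limN piN lN]] := @long_limit_model R lam U _ _ (linear_pack (submodule_incl_linear X12)) iota
  natl Rl piU FU piota X1l lX1 univZ (fl i2).1 X2l
  pc univ12 succl.
have univN := limit_model_universal limN.
have limS := omega_limit_model natl (limit_model_flat limN) piN (limit_model_card limN) lN univN.
have /iso_inverse[f [g [fg gf]]] := uniq _ _ limN limS.
have piS := pure_injective_retract gf piN.
apply: (dcc_flats_pure_injective (M := N)).
  by move=> C FC CR; apply: univN FC (embeds_trans CR Rl).
exact: sum_pure_injective_dcc.
Qed.

End UniquenessPureInjective.


(** * A limit model of cardinality 2^(|R| + aleph_0) *)

Section SmallFlats.
Variable R : nzRingType.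
Local Notation mu := (ring_card R).
Local Notation lam := (set mu).
Local Notation F := (direct_sum mu (R^o : lmodType R)).

Lemma nat_set_ring_card : embeds nat lam.
Proof. exact: embeds_trans (nat_ring_card R) (embeds_set _). Qed.

(** Z is the direct sum of all flat quotients of the free module F of rank mu, realized as
    a quotient of a direct sum of copies of F indexed by the kernels. *)
Lemma small_flats_universal : exists Z : lmodType R, [/\ flat Z, embeds Z lam & is_universal_for mu Z].
Proof.
have natmu := nat_ring_card R.
have Fmu : embeds F mu by apply: embeds_free_sum => //; apply: embeds_refl.
pose I := {K : set F | is_submod K /\ flat_modulo K}.
have Il : embeds I lam.
  apply: embeds_trans (embeds_sig _) _.
  exact: embeds_set_set.
pose DS := direct_sum I F.
pose S : set DS := [set f | forall i, sval i (ds_coord i f)].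
have subS : is_submod S.
  split=> [i|a f g Sf Sg i]; first by rewrite raddf0; apply: submod0; case: (svalP i).
  by rewrite linearP; have [[_ H] _] := svalP i; apply: H.
have [Z [p [psurj pker]]] := quotient_module subS.
exists Z; split.
- apply: (@flat_direct_sum_modulo R I F (fun i => sval i) Z p) => //.
    by move=> i; case: (svalP i).
  by move=> i; case: (svalP i).
- apply: embeds_trans (surjection_embeds psurj) _.
  apply: embeds_direct_sum => //; first exact: nat_set_ring_card.
  exact: embeds_trans Fmu (embeds_set _).
move=> C FC Cmu; have [g gsurj] := embeds_surjection (inhabits 0) Cmu.
have [c csurj] := free_cover gsurj.
pose K : set F := [set x | c x = 0].
have subK : is_submod K := kernel_submod c.
have KI : is_submod K /\ flat_modulo K.
  by split=> //; apply: flat_modulo_quotient FC csurj _.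
pose i : I := exist _ K KI.
have /choice[s sP] := csurj; have /choice[t tP] := psurj.
have cE x y : c x = c y -> p (ds_delta i x) = p (ds_delta i y).
  move=> E; apply/eqP; rewrite -subr_eq0 -!linearB; apply/eqP/pker => j.
  rewrite ds_deltaE; case: asboolP => [->|_].
    by rewrite /= /K /= linearB /= E subrr.
  by apply: submod0; case: (svalP j).
have lq : linear (fun x => p (ds_delta i (s x))).
  move=> a x y; rewrite -!linearP; apply: cE.
  by rewrite linearP !sP.
have lr : linear (fun z => c (ds_coord i (t z))).
  move=> a x y; rewrite -!linearP; apply/eqP; rewrite -subr_eq0 -!linearB.
  have /pker/(_ i) : p (t (a *: x + y) - (a *: t x + t y)) = 0.
    by rewrite linearB linearP /= !tP subrr.
  by move=> /eqP.
exists (linear_pack lq); apply: (@pure_retract _ _ _ _ (linear_pack lr)) => x /=.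
have /pker/(_ i) : p (t (p (ds_delta i (s x))) - ds_delta i (s x)) = 0.
  by rewrite linearB /= tP subrr.
by rewrite linearB /= ds_delta_eq /= /K /= linearB /= sP => /eqP; rewrite subr_eq0 => /eqP.
Qed.

End SmallFlats.

(** * Embedding modules by a filtration with small factors *)
Section Filtration.
Variables (R : nzRingType) (lam : Type) (W Z Y : lmodType R).
Variable iota : {linear direct_sum lam Z -> W}.
Local Notation mu := (ring_card R).
Hypotheses (piW : pure_injective W) (piota : pure iota) (univZ : is_universal_for mu Z).
Hypotheses (FY : flat Y) (Yl : embeds Y lam) (nlmu : ~ embeds lam mu).

Let T := (Y * W)%type.

(** The graphs of isomorphisms between a pure submodule of Y and a pure submodule of W. *)
Definition partial_iso (G : set T) : Prop :=
  is_submod G /\ forall m n (D : 'M[R]_(m, n)) (p : 'I_m -> T), (forall i, G (p i)) ->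
    solvable D (fst \o p) \/ solvable D (snd \o p) ->
    exists2 w, (forall j, G (w j)) & mxact D w = p.

Lemma partial_iso_bigcup (F : set (set T)) :
  F `<=` partial_iso -> total_on F subset -> F !=set0 -> partial_iso (\bigcup_(X in F) X).
Proof.
move=> FG totF nF; split; first by apply: submod_bigcup => // X /FG[].
move=> m n D p Up sp; have [X FX Xp] := chain_tuple totF nF Up.
have [_ XP] := FG _ FX; have [y Xy yE] := XP _ _ _ _ Xp sp.
by exists y => // j; exists X.
Qed.

(** The domain N of G is enlarged to the preimage V of a small pure submodule of Y / N that
    contains the class of y. The factor V / N has size at most mu, so it embeds in Z; as V
    has fewer than lambda elements, [pure_embed_over] applies. *)
Lemma partial_iso_step (k : Type) (G : set T) (y : Y) :
  partial_iso G -> embeds mu k -> small k G -> ~ embeds lam k ->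
  exists G', [/\ G `<=` G', partial_iso G', exists w, G' (y, w) &
    forall k', embeds mu k' -> small k' G -> small k' G'].
Proof.
move=> [subG GP] muk smG nlk.
have [N [i [inji iG]]] := submod_of_set_incl subG.
have pN m n (D : 'M[R]_(m, n)) (x : 'I_m -> N) :
    solvable D (fst \o (i \o x)) \/ solvable D (snd \o (i \o x)) -> solvable D x.
  move=> sx; have [j|w Gw wE] := GP m n D (i \o x) _ sx; first by apply/iG; exists (x j).
  have /choice[z zE] : forall j, exists z, i z = w j by move=> j; apply/iG.
  exists z; apply: (solvable_comp_inj inji); rewrite -wE; congr mxact; exact/funext.
pose e : {linear N -> Y} := linear_fst Y W \o i.
pose h : {linear N -> W} := linear_snd Y W \o i.
have pe : pure e by move=> m n D x sx; apply: pN; left.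
have ph : pure h by move=> m n D x sx; apply: pN; right.
have [Q0 [p [FQ0 psurj pker]]] := quotient_by_pure pe FY.
have natmu := nat_ring_card R.
have [|S0 [S0y pS0 smS0]] := @pure_closure R Q0 mu [set p y] natmu (embeds_refl _).
  exact: small_set1.
pose V0 : set Y := [set v | S0 (p v)].
have pV0 : pure_submod V0.
  have [subS0 S0P] := pS0; split.
    split; first by rewrite /V0 /= raddf0; apply: submod0.
    by move=> a x z Sx Sz; rewrite /V0 /= linearP; case: subS0 => _; apply.
  move=> m n D x Vx sx.
  have [z Sz zE] := S0P _ _ _ (p \o x) Vx (solvable_lin p sx).
  have /choice[w wP] : forall j, exists w, p w = z j by move=> j; apply: psurj.
  have pw : p \o w = z by apply/funext.
  have [u uE] : exists u, mxact D (e \o u) = x - mxact D w.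
    have /choice[r rP] : forall l, exists r, e r = (x - mxact D w) l.
      move=> l; apply/pker.
      rewrite -[LHS]/(p (x l - mxact D w l)) linearB /= -[p (mxact D w l)]/((p \o mxact D w) l).
      by rewrite -mxact_lin pw zE subrr.
    have [u uE] : solvable D r.
      apply: pe; have := solvableB sx (ex_intro _ w erefl); congr solvable.
      by apply/funext => l; rewrite -rP.
    by exists u; rewrite mxact_lin uE; apply/funext => l; apply: rP.
  exists (w + (e \o u : 'I_n -> Y)); last by rewrite mxactD uE addrC subrK.
  move=> j; have peu : p (e (u j)) = 0 by apply/pker; exists (u j).
  by rewrite -[V0 _]/(S0 (p (w j + e (u j)))) linearD peu addr0 wP.
have [V [v [pv vV]]] := pure_submod_module pV0.
have [|e' pe' e'P] := pure_factor (pure_inj pv) pe.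
  move=> x; apply/vV; rewrite /V0 /=; have /pker -> : exists z', e z' = e x by exists x.
  by apply: submod0; case: pS0.
have [c cinj] : embeds {z | S0 z} mu by apply/(small_embeds natmu).
have pvS z : S0 (p (v z)) by apply/vV; exists z.
have Vk k' : embeds mu k' -> small k' G -> embeds V k'.
  move=> muk' smG'; have natk' := embeds_trans natmu muk'.
  have Nk' : embeds N k'.
    by apply: (small_module inji _ smG') => x; apply/iG; exists x.
  apply: embeds_trans (embeds_prod_le natk' muk' Nk').
  have /choice[s sP] := psurj.
  have /choice[r rP] : forall z, exists r, e r = v z - s (p (v z)).
    by move=> z; apply/pker; rewrite linearB /= sP subrr.
  exists (fun z => (c (exist _ (p (v z)) (pvS z)), r z)) => z z' [/cinj[pz] rz].
  apply: (pure_inj pv); rewrite -[v z](subrK (s (p (v z)))) -rP rz rP pz.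
  by rewrite subrK.
have natk := embeds_trans natmu muk.
have [f pf fP] : exists2 f : {linear V -> W}, pure f & forall x, f (e' x) = h x.
  apply: (pure_embed_over natk muk (Vk k muk smG) nlk piW piota pe' ph (flat_pure_sub pv FY)).
  move=> Q q FQ qsurj qker; apply: univZ FQ _.
  have /choice[s sP] := qsurj.
  exists (fun z => c (exist _ (p (v (s z))) (pvS (s z)))) => z z' /cinj[E].
  rewrite -(sP z) -(sP z'); apply/eqP; rewrite -subr_eq0 -linearB; apply/eqP/qker.
  have /pker[x xE] : p (v (s z) - v (s z')) = 0 by rewrite linearB /= E subrr.
  exists x; apply: (pure_inj pv); rewrite linearB /= -[RHS]xE.
  exact: e'P.
exists [set z | exists a, z = (v a, f a)]; split.
- move=> z /iG[x <-]; exists (e' x); rewrite fP e'P.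
  by rewrite /e /h /=; case: (i x).
- split.
    split; first by exists 0; rewrite !raddf0.
    move=> a _ _ [x ->] [z ->]; exists (a *: x + z).
    by rewrite -(linearP (linear_pair v f)).
  move=> m n D x /choice[a aP] sx.
  have [w wE] : solvable D a.
    case: sx => sx; [apply: pv|apply: pf]; move: sx; congr solvable;
    by apply/funext => l /=; rewrite aP.
  exists (linear_pair v f \o w) => [j|]; first by exists (w j).
  by rewrite mxact_lin wE; apply/funext => l /=; rewrite aP.
- have /vV[a aE] : V0 y by apply: S0y.
  by exists (f a), a; rewrite aE.
- move=> k' muk' smG'; have := small_range (embeds_trans natmu muk') (fun a => (v a, f a)) (Vk k' muk' smG').
  by apply: small_sub => _ [a ->]; exists a.
Qed.

(** The well-order of Y is initial, so that each stage of the recursion has a domain of size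
    less than lambda and a spare copy of Z is left. *)
Lemma filtration_embedding : exists f : {linear Y -> W}, pure f.
Proof.
have natmu := nat_ring_card R.
have [le [wo init]] := initial_wo Y.
pose kk i := (segment le i + mu)%type.
have mukk i : embeds mu (kk i) by exists inr => x y [].
have segkk i : embeds (segment le i) (kk i) by exists inl => x y [].
have nlkk i : ~ embeds lam (kk i).
  move=> lkk; have [sm|/not_embeds ms] := pselect (embeds (segment le i) mu).
    apply/nlmu/(embeds_trans lkk)/embeds_sum_le => //; exact: embeds_refl.
  apply: (init i); apply: embeds_trans Yl _; apply: (embeds_trans lkk).
  by apply: embeds_sum_le => //; [apply: embeds_trans natmu ms|apply: embeds_refl].
have /choice[step0 step0P] : forall z : Y * set T, exists G', [/\ z.2 `<=` G',
    partial_iso z.2 -> partial_iso G',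
    forall k', embeds mu k' -> small k' z.2 -> small k' G' &
    partial_iso z.2 -> (exists k : Type, [/\ embeds mu k, small k z.2 & ~ embeds lam k]) ->
      exists w, G' (z.1, w)].
  move=> [y G] /=.
  have [[pG [k [muk smG nlk]]]|nG] := pselect (partial_iso G /\ exists k : Type, [/\ embeds mu k, small k G & ~ embeds lam k]).
    by have [G' [GG' pG' G'y smG']] := partial_iso_step y pG muk smG nlk; exists G'.
  by exists G; split=> // pG ex; case: nG.
pose step j G := step0 (j, G).
have step_sub j G : G `<=` step j G by have [] := step0P (j, G).
have [X XE] := tower_exists wo [set (0 : T)] step.
have pX : forall i, partial_iso (X i).
  apply: (tower_ind wo XE step_sub) => [|j|].
  - split; first by split=> // a _ _ -> ->; rewrite scaler0 addr0.
    move=> m n D p p0 _; exists 0 => //; rewrite mxact0; apply/funext => l.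
    by rewrite p0.
  - by have [_ H _ _] := step0P (j, X j).
  - exact: partial_iso_bigcup.
have smX : forall i, small (kk i) (X i).
  apply: (wo_ind wo) => i IH; rewrite XE.
  have natkk : embeds nat (kk i) := embeds_trans natmu (mukk i).
  apply: small_setU => //.
    exact: small_set1.
  have := @small_bigcup (kk i) natkk (segment le i) T (fun j => step (sval j) (X (sval j))) (segkk i).
  move=> H; apply: small_sub (H _) => [x [j [ji Sx]]|j]; first by exists (exist _ j ji).
  have [_ _ smS _] := step0P (sval j, X (sval j)); apply: smS => //=.
  apply: small_trans (IH _ (proj2_sig j)).
  apply: embeds_sum_le => //; apply: embeds_trans (segkk i).
  exact/(segment_embeds wo)/(strict_le wo)/(proj2_sig j).
pose G : set T := [set z | exists i, step i (X i) z].
have pG : partial_iso G.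
  rewrite (_ : G = \bigcup_(H in range (fun i => step i (X i))) H).
    apply: partial_iso_bigcup => [_ [i _ <-]|_ _ [i _ <-] [j _ <-]|].
    - by have [_ H _ _] := step0P (i, X i); exact: H (pX i).
    - have [/(le_eqVstrict wo)[->|ij]|/(le_eqVstrict wo)[->|ji]] := wo_total wo i j; try by left.
        by left=> x Sx; apply/step_sub/(tower_step XE ij).
      by right=> x Sx; apply/step_sub/(tower_step XE ji).
    - by exists (step 0 (X 0)), 0.
  apply/seteqP; split=> x; first by move=> [i Sx]; exists (step i (X i)) => //; exists i.
  by move=> [_ [i _ <-] Sx]; exists i.
have [subG GP] := pG.
have /choice[f fP] : forall y, exists w, G (y, w).
  move=> y; have [_ _ _ H] := step0P (y, X y).
  have [w Sw] : exists w, step0 (y, X y) (y, w).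
    by apply: H; [apply: pX|exists (kk y); split=> //; apply: smX].
  by exists w, y.
have Gfun y w w' : G (y, w) -> G (y, w') -> w = w'.
  move=> Gw Gw'; pose p (_ : 'I_1) : T := (y, w) - (y, w').
  have sp : solvable (0 : 'M[R]_(1, 0)) (fst \o p).
    by exists 0; rewrite mxact0; apply/funext => l /=; rewrite subrr.
  have [u _] := GP _ _ _ p (fun _ => submodB subG Gw Gw') (or_introl sp).
  move=> /(congr1 (@^~ 0)); rewrite mxact0l => /(congr1 snd) /= E.
  by apply/eqP; rewrite -subr_eq0 -E.
have lf : linear f.
  move=> a x y; apply: (Gfun (a *: x + y)) => //.
  by case: subG => _ H; apply: (H a _ _ (fP x) (fP y)).
exists (linear_pack lf) => m n D p sp.
have [w Gw wE] := GP m n D (fun l => (p l, f (p l))) (fun l => fP (p l)) (or_intror sp).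
exists (linear_fst Y W \o w); rewrite mxact_lin wE.
by apply/funext => l.
Qed.

End Filtration.

Section SigmaPureInjective.
Variable R : nzRingType.
Hypothesis env : forall (M E : lmodType R) (e : M -> E), flat M -> is_pure_injective_envelope e -> flat E.
Local Notation mu := (ring_card R).
Local Notation lam := (set mu).

(** There are (2^mu)^mu = 2^mu systems of at most mu formulas over a set of size 2^mu. *)
Lemma solutions_small (U : lmodType R) (S : set U) : small lam S -> exists S', [/\ S `<=` S', small lam S' &
  forall (dom : set (formula R)) (p : formula R -> nat -> U),
    (forall phi n, S (p phi n)) -> (exists x, forall phi, dom phi -> holds phi (p phi) x) ->
    exists x, S' x /\ forall phi, dom phi -> holds phi (p phi) x].
Proof.
move=> smS; have natl := nat_set_ring_card R; have natmu := nat_ring_card R.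
pose I := (set (formula R) * (formula R * nat -> {x | S x}))%type.
have Il : embeds I lam.
  have Fmu : embeds (formula R) mu by apply: embeds_formula => //; exact: embeds_refl.
  apply: embeds_prod_le => //.
    exact: embeds_set_set.
  apply: (@embeds_trans (formula R * nat -> lam)).
    by apply: embeds_fun; [exact: infinite_point|exact: embeds_refl|exact/(small_embeds natl)].
  apply: embeds_fun_set; apply: embeds_prod_le => //; last exact: embeds_refl.
  exact: embeds_prod_le.
have /choice[sol solP] : forall z : I, exists x,
    (exists x, forall phi, z.1 phi -> holds phi (fun n => sval (z.2 (phi, n))) x) ->
    forall phi, z.1 phi -> holds phi (fun n => sval (z.2 (phi, n))) x.
  move=> z; have [[x xP]|nx] := pselect (exists x, forall phi, z.1 phi -> holds phi (fun n => sval (z.2 (phi, n))) x); first by exists x.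
  by exists 0.
exists (S `|` range sol); split; [by move=> x; left|by apply: small_setU => //; apply: small_range|].
move=> dom p pS ex.
pose z : I := (dom, fun w => exist _ (p w.1 w.2) (pS w.1 w.2)).
by exists (sol z); split; [right; exists z|apply: (solP z)].
Qed.

(** A tower of length mu^+ that is closed under solutions of systems and under taking pure
    closures; its union is pure injective as in [long_tower_pure_injective]. *)
Lemma large_universal_pure_injective : exists W : lmodType R,
  [/\ flat W, pure_injective W, embeds W lam, embeds lam W & is_universal_for lam W].
Proof.
have natl := nat_set_ring_card R; have natmu := nat_ring_card R.
have mul : embeds mu lam := embeds_set mu.
have [Z [FZ Zl univZ]] := small_flats_universal R.
have [U [iota [FU piU piota]]] := flat_pure_injective_extension env (@flat_direct_sum R lam _ FZ).
have [A [le [wo segmu nAmu]]] := hartogs mu.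
have Al : embeds A lam := segments_embed wo segmu (@not_embeds_set mu).
have /choice[step0 step0P] : forall S : set U, exists S', [/\ S `<=` S', pure_submod S -> pure_submod S',
    small lam S -> small lam S' & small lam S ->
    forall (dom : set (formula R)) (p : formula R -> nat -> U),
    (forall phi n, S (p phi n)) -> (exists x, forall phi, dom phi -> holds phi (p phi) x) ->
    exists x, S' x /\ forall phi, dom phi -> holds phi (p phi) x].
  move=> S; have [smS|nS] := pselect (small lam S); last by exists S; split=> // /nS.
  have [S1 [SS1 smS1 solS1]] := solutions_small smS.
  have [S2 [S12 pS2 smS2]] := @pure_closure R U lam S1 natl mul smS1.
  exists S2; split=> // [x /SS1/S12 //|_ dom p pS ex].
  by have [x [/S12 Sx xP]] := solS1 dom p pS ex; exists x.
pose step (j : A) := step0.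
have step_sub j Y : Y `<=` step j Y by have [] := step0P Y.
have [X XE] := tower_exists wo (range iota) step.
have mono := tower_mono wo XE step_sub.
have smX : forall i, small lam (X i).
  apply: (tower_small wo XE natl) => [|i|j].
  - apply: small_range => //; apply: embeds_direct_sum => //; exact: embeds_refl.
  - exact: embeds_trans (embeds_sig _) Al.
  - by have [_ _ H _] := step0P (X j).
have [_ [a0] nextA] := long_limit_ordinal natmu wo segmu nAmu.
have [|pX pU] := tower_pure wo XE step_sub (inhabits a0) (pure_range piota).
  by move=> j Y pY; have [_ H _ _] := step0P Y; apply: H.
have [W [f [pf fX]]] := pure_submod_module pU.
have FW := flat_pure_sub pf FU.
have piW : pure_injective W.
  refine (long_tower_pure_injective natmu segmu nAmu (embeds_refl _) piU mono _ pf fX).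
  move=> i dom p Xp ex; have [_ _ _ H] := step0P (X i).
  have [x [Sx xP]] := H (smX i) dom p Xp ex.
  have [j ij] := nextA i; exists j, x; split=> //.
  by rewrite (tower_next wo XE step_sub ij).
have Wl : embeds W lam.
  apply: (@small_module R U lam W f [set x | exists i, X i x] (pure_inj pf)).
    by move=> n; apply/fX; exists n.
  exact: small_bigcup.
have [|g pg _] := pure_factor (pure_inj pf) piota.
  by move=> z; apply/fX; exists a0; apply: (tower_base XE); exists z.
have univW : is_universal_for lam W.
  by move=> C FC Cl; apply: (filtration_embedding piW pg univZ FC Cl (@not_embeds_set mu)).
exists W; split=> //.
have [i pi] := univW _ (@flat_free R lam) (embeds_free_sum natl mul).
apply: embeds_trans (embeds_free_basis R _) _.
by exists i; apply: pure_inj.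
Qed.

Lemma sigma_flats_pure_injective :
  (forall M : lmodType R, is_limit_model M -> sigma_pure_injective M) -> flats_pure_injective R.
Proof.
move=> sig; have [W [FW piW Wl lW univW]] := large_universal_pure_injective.
have limS := omega_limit_model (nat_set_ring_card R) FW piW Wl lW univW.
apply: (dcc_flats_pure_injective (M := direct_sum nat W)).
  by move=> C FC Cmu; apply: (limit_model_universal limS) FC (embeds_trans Cmu (embeds_set _)).
by apply: sum_pure_injective_dcc; apply: sig; exists lam.
Qed.

End SigmaPureInjective.

Theorem theorem4p12 (R : nzRingType)
  (envelope_flat : forall (M E : lmodType R) (e : M -> E),
     flat M -> is_pure_injective_envelope e -> flat E) :
  [<-> left_perfect R;
       flat_superstable R;
       exists kappa lambda : cardinal,
         [/\ is_succ_cardinal (ring_card R) kappa, cle kappa lambda &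
             uniqueness_of_limit_models R lambda];
       forall M : lmodType R, is_limit_model M -> sigma_pure_injective M;
       forall lambda : cardinal,
         cle (ring_card R) lambda -> uniqueness_of_limit_models R lambda].
Proof.
have uniq : flats_pure_injective R -> forall lambda : cardinal,
    cle (ring_card R) lambda -> uniqueness_of_limit_models R lambda.
  move=> fpi lambda /cleP Rl; apply: pure_injective_uniqueness => //.
  exact: embeds_trans (nat_ring_card R) Rl.
have [kappa sk] := succ_cardinal_exists (ring_card R).
have [[Rk _] _] := sk.
tfae.
- move=> perf; exists (ring_card R); apply: uniq.
  exact: perfect_pure_injective.
- move=> [mu muP]; exists kappa, (kappa + mu)%type; split=> //.
    by apply/cleP; exists inl => x y [].
  by apply: muP; apply/cleP; exists inr => x y [].
- move=> [k [lambda [sk' kl un]]] M limM.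
  by apply: pure_injective_sigma limM; apply: uniqueness_flats_pure_injective sk' kl un.
- by move=> sig; apply/uniq/sigma_flats_pure_injective.
- move=> un; apply: pure_injective_perfect.
  apply: (uniqueness_flats_pure_injective envelope_flat sk (proj2 (cleP kappa kappa) (embeds_refl kappa))).
  exact: un.
Qed.
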